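(* Let $y,y^n\in\mathbb{D}(\mathbb{R}_+;\mathbb{R}^d)$, $n\ge1$, be such that $y^n\to y$ in the Skorokhod $J_1$-topology. Let $(x,k)$ be the solution of the Skorokhod problem in $\bar D$ associated with $y$, and let $(x^n,k^n)$ be the solution of the penalized equation $$x^n_t=y^n_t-n\int_0^t(x^n_s-\Pi(x^n_s))\,ds=:y^n_t+k^n_t,\quad t\ge0.$$ Let $g:\mathbb{R}_+\times\mathbb{R}^d\to\mathbb{R}$ be continuous and let $T>0$. If $\Delta y_T=0$, then, as $n\to\infty$, $$\int_0^Tg(s,x^n_s)\,d|k^n|_s\longrightarrow I_T(g,x,k),$$ where $$I_T(g,x,k)=\int_{[0,T]}g(s,x_s)\,d\|k\|_s+\sum_{0\le s\le T}\int_0^{|\Delta k_s|}\bar g(s,x_s-r\mathbf{n}(x_s))\,dr,\qquad \bar g(s,z)=g(s,z)-g(s,\Pi(z)).$$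
   Context: $D\subset\mathbb{R}^d$ is a bounded convex $C^2$-domain, $\Pi(z)$ is the projection of $z\in\mathbb{R}^d$ onto $\bar D$, and $\mathbf{n}(z)$ is the inward unit normal vector at $z\in\partial D$. $\mathbb{R}_+=[0,\infty)$ and $\mathbb{D}(\mathbb{R}_+;\mathbb{R}^d)$ is the space of right-continuous functions $\mathbb{R}_+\to\mathbb{R}^d$ with left-hand limits. $\Delta y_t=y_t-y_{t-}$. For a function $k$ of locally bounded variation, $|k|_t$ is the total variation of $k$ on $[0,t]$ (defined as the supremum of $\sum_i|k_{t_i}-k_{t_{i-1}}|$ over partitions $0=t_0<\dots<t_m=t$, so that the value $k_0$ is not counted), and $\|k\|_t=|k_0|+|k|_t$. $\int_0^t$ denotes the integral over $(0,t]$; for integrals over $[0,t]$ and for jumps at $0$ the convention $k_{0-}=0$, i.e. $\Delta k_0=k_0$ (and $\|k\|_{0-}=0$), is used; thus $\int_{[0,T]}g(s,x_s)\,d\|k\|_s=g(0,x_0)|k_0|+\int_0^Tg(s,x_s)\,d|k|_s$. Skorokhod problem: for $y\in\mathbb{D}(\mathbb{R}_+;\mathbb{R}^d)$ (with $y_0\in\mathbb{R}^d$ arbitrary, not necessarily in $\bar D$), a pair $(x,k)\in\mathbb{D}(\mathbb{R}_+;\mathbb{R}^{2d})$ is a solution of the Skorokhod problem associated with $y$ if (a) $x_t=y_t+k_t$, $t\ge0$; (b) $x$ is $\bar D$-valued, $k$ has locally bounded variation, $k_0=\Pi(y_0)-y_0$, $k_t=k_0+\int_0^t\mathbf{n}(x_s)\,d|k|_s$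 and $|k|_t=\int_0^t\mathbf{1}_{\{x_s\in\partial D\}}\,d|k|_s$, $t\ge0$. (The solution exists and is unique; $x_s\in\partial D$ whenever $\Delta k_s\ne0$, and terms with $\Delta k_s=0$ in the sum are zero.) *)

(* Defs.v *)
From HB Require Import structures.
From mathcomp Require Import all_boot all_order all_algebra.
From mathcomp Require Import all_classical all_reals all_analysis.

Set Implicit Arguments.
Unset Strict Implicit.
Unset Printing Implicit Defensive.
Import Order.TTheory GRing.Theory Num.Theory.
Import numFieldNormedType.Exports.

Local Open Scope classical_set_scope.
Local Open Scope ring_scope.

(* The library norm `|_| of 'rV[R]_d is the sup norm. It induces the usual
   topology, but distances and variations have to be Euclidean. *)
Definition enorm (R : realType) (d : nat) (v : 'rV[R]_d) : R :=
  Num.sqrt (\sum_(i < d) v 0 i ^+ 2).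

Section Domain.
Context {R : realType} {d : nat}.
Implicit Types (D U : set 'rV[R]_d) (phi : 'rV[R]_d -> R) (z v : 'rV[R]_d).

Definition boundary D : set 'rV[R]_d := closure D `\` D°.

Definition partial (i : 'I_d) phi : 'rV[R]_d -> R := 'D_(delta_mx 0 i) phi.

Definition gradient phi z : 'rV[R]_d := \row_i partial i phi z.

Definition C2_on U phi : Prop :=
  {in U, continuous phi} /\
  forall i j z, U z ->
    [/\ derivable phi z (delta_mx 0 i),
        {for z, continuous (partial i phi)},
        derivable (partial i phi) z (delta_mx 0 j)
      & {for z, continuous (partial j (partial i phi))}].

Definition local_defining_function D z U phi : Prop :=
  [/\ open_nbhs z U, C2_on U phi,
      forall w, U w -> gradient phi w != 0
    & D `&` U = [set w | 0 < phi w] `&` U].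

Definition C2_domain D : Prop :=
  [/\ open D, D !=set0, connected D
    & forall z, boundary D z -> exists U phi, local_defining_function D z U phi].

(* As phi is positive inside D, its gradient points into D. *)
Definition is_inward_unit_normal D z v : Prop :=
  boundary D z /\
  exists U phi, local_defining_function D z U phi /\
    v = (enorm (gradient phi z))^-1 *: gradient phi z.

(* The normal is extended by 0 off the boundary. *)
Definition normal D z : 'rV[R]_d :=
  xget 0 [set v | is_inward_unit_normal D z v].

Definition proj D z : 'rV[R]_d :=
  xget 0 [set p | closure D p /\
                  forall q, closure D q -> enorm (z - p) <= enorm (z - q)].

End Domain.

(* Paths indexed by [0, +oo[ are functions on R of which only the values at
   nonnegative times matter. *)
Section Paths.
Context {R : realType} {d : nat}.
Implicit Types (f k x y : R -> 'rV[R]_d) (t : R).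

Definition cadlag f : Prop :=
  (forall t, 0 <= t -> f s @[s --> t^'+] --> f t) /\
  (forall t, 0 < t -> cvg (f s @[s --> t^'-])).

(* The jump at 0 follows the convention f_{0-} = 0. *)
Definition jump f t : 'rV[R]_d :=
  if 0 < t then f t - lim (f s @[s --> t^'-]) else f t.

Definition time_change (l : R -> R) : Prop :=
  [/\ l 0 = 0,
      {in `[0, +oo[ &, {homo l : s t / s < t}},
      {within `[0, +oo[, continuous l}
    & l @` `[0, +oo[%classic = `[0, +oo[%classic].

(* Convergence in the Skorokhod J1-topology of D(R_+; R^d), as in Jacod and
   Shiryaev, Limit Theorems for Stochastic Processes, VI.1. *)
Definition J1_cvg (yn : nat -> R -> 'rV[R]_d) y : Prop :=
  exists l : nat -> R -> R,
  [/\ forall n, time_change (l n),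
      forall e, 0 < e ->
        \forall n \near \oo, forall t, 0 <= t -> `|l n t - t| <= e
    & forall (N e : R), 0 < e ->
        \forall n \near \oo, forall t, 0 <= t <= N ->
          enorm (yn n (l n t) - y t) <= e].

(* The library's variation and total_variation only cover real-valued
   functions. *)
Definition evariation (a b : R) f (s : seq R) : R :=
  let F := f \o nth b (a :: s) in
  \sum_(0 <= n < size s) enorm (F n.+1 - F n).

Definition evariations (a b : R) f : set R :=
  [set evariation a b f s | s in itv_partition a b].

Definition locally_bounded_variation f : Prop :=
  forall t, 0 <= t -> has_ubound (evariations 0 t f).

(* |k|_t; it is 0 for t < 0, where there is no partition and sup set0 = 0. *)
Definition tvar k t : R := sup (evariations 0 t k).

(* ||k||_t, with ||k||_t = 0 for t < 0. *)
Definition tvar0 k t : R := if 0 <= t then enorm (k 0) + tvar k t else 0.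

End Paths.

Section Integrals.
Context {R : realType}.

Definition cumul (F : R -> R) (ndF : nondecreasing F)
  (rcF : right_continuous F) : R -> R := F.

HB.instance Definition _ F ndF rcF :=
  isCumulative.Build R _ R (@cumul F ndF rcF) ndF rcF.

(* The measure dF. The default value 0 is never used below for a right-continuous
   k of locally bounded variation: tvar k and tvar0 k are then nondecreasing and
   right-continuous. *)
Definition stieltjes (F : R -> R) :
    {measure set (measurableTypeR R) -> \bar R} :=
  match pselect (nondecreasing F /\ right_continuous F) with
  | left H => lebesgue_stieltjes_measure (cumul H.1 H.2)
  | right _ => mzero
  end.

Definition vintegral (d : nat) (mu : {measure set (measurableTypeR R) -> \bar R})
    (A : set R) (f : R -> 'rV[R]_d) : 'rV[R]_d :=
  \row_i \int[mu]_(s in A) f s 0 i.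

(* Sum of an absolutely summable family over a possibly uncountable index set. *)
Definition usum (A : set R) (f : R -> R) : R :=
  fine (\esum_(s in A) (f^\+ s)%:E) - fine (\esum_(s in A) (f^\- s)%:E).

End Integrals.

Section Skorokhod.
Context {R : realType} {d : nat}.
Implicit Types (D : set 'rV[R]_d) (x y k : R -> 'rV[R]_d)
  (g : R -> 'rV[R]_d -> R).

Record skorokhod_solution D y x k : Prop := {
  sk_cadlag_x : cadlag x;
  sk_cadlag_k : cadlag k;
  sk_eq : forall t, 0 <= t -> x t = y t + k t;
  sk_in : forall t, 0 <= t -> closure D (x t);
  sk_bv : locally_bounded_variation k;
  sk_k0 : k 0 = proj D (y 0) - y 0;
  sk_normal : forall t, 0 <= t ->
    k t = k 0 + vintegral (stieltjes (tvar k)) `]0, t]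
                  (fun s => normal D (x s));
  sk_support : forall t, 0 <= t ->
    tvar k t = \int[stieltjes (tvar k)]_(s in `]0, t])
                 \1_[set u | boundary D (x u)] s }.

Record penalized_solution D (n : nat) y x k : Prop := {
  pen_cadlag : cadlag x;
  pen_k : forall t, 0 <= t ->
    k t = (- n%:R) *: vintegral lebesgue_measure `]0, t]
                        (fun s => x s - proj D (x s));
  pen_eq : forall t, 0 <= t -> x t = y t + k t }.

Definition gbar D g (s : R) (z : 'rV[R]_d) : R := g s z - g s (proj D z).

Definition I_lim D (T : R) g x k : R :=
  \int[stieltjes (tvar0 k)]_(s in `[0, T]) g s (x s) +
  usum `[0, T] (fun s =>
    \int[lebesgue_measure]_(r in `[0, enorm (jump k s)])
      gbar D g s (x s - r *: normal D (x s))).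

End Skorokhod.

(* Main.v *)
(* Cut [0, T] into finitely many links, i.e. intervals [a, b[ on which y and x
   oscillate little, and look at the penalized solution at the times l n a and
   l n b given by the time changes of the J1 convergence. On a link the penalized
   equation has almost no input: it relaxes exponentially along the segment from
   its starting point to the projection of that point, so that in time O(1/n) it
   comes close to closure D, and its projection hardly moves.

   - A ball inside D turns the decrease of the squared distance to its centre into
     a bound, uniform in n, of the variation of kn.
   - Write k- t for the integral of the normal over [0, t[. Both kn o l n and k-
     push towards closure D, and at the end of a link their difference is almost
     that of two points of closure D. Hence its square grows by little on a link,
     and kn (l n t) --> k- t for every t, jump times included.
   - On a link the penalized path is therefore close to the ray
     y a + k- a + c * nu, where nu is the (almost constant) normal direction and c
     the displacement of kn along nu. The functional is thus almost the increment
     of a primitive of g along that ray. In the limit the part of the ray outside D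
     produces the jump integral at a, and the rest the integral over ]a, b[.

   The continuity of y at T allows one to replace l n T by T. *)
Require Import Defs.
From mathcomp Require Import all_boot all_order all_algebra.
From mathcomp Require Import all_classical all_reals all_analysis.
From mathcomp Require Import measurable_realfun.
From mathcomp Require Import ring lra.
Set Implicit Arguments.
Unset Strict Implicit.
Unset Printing Implicit Defensive.
Import Order.TTheory GRing.Theory Num.Theory.
Import numFieldNormedType.Exports.
Local Open Scope classical_set_scope.
Local Open Scope ring_scope.

(* [proj] is also a projection of product topologies in the library. *)
Local Notation proj := Defs.proj.

(** * Euclidean geometry *)

(** One cannot pass to the limit inside the integral: at a jump the path [xn] crosses the region
    outside [closure D] within a time of order [1/n], so it is not uniformly close to [x] there, and
    the cost of the crossing survives. A jump at the end of a link is therefore assigned to the next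
    link, which starts from the point [y + kleft] reached before reflection rather than from [x];
    this is why [kn] is compared with the left version [kleft] of [k]. Errors on a link are of two
    kinds. Some are a small multiple of the masses of the link, and add up to a small multiple of
    total masses that are bounded uniformly in [n]. The others are arbitrarily small constants, one
    per link; they are harmless because all thresholds, and with them the finite partition, are
    fixed before [n] tends to infinity. As [xn] is only cadlag, its primitives have right
    derivatives only. All differential inequalities are hence derived from one monotonicity
    criterion, [rprim_le], for left-continuous functions with right derivatives. *)

Section Euclid.
Context {R : realType} {d : nat}.
Implicit Types (u v w z : 'rV[R]_d) (a b c : R).

Definition dot u v : R := \sum_(i < d) u 0 i * v 0 i.

Lemma dotC u v : dot u v = dot v u.
Proof. by apply: eq_bigr => i _; rewrite mulrC. Qed.

Lemma dotDl u v w : dot (u + v) w = dot u w + dot v w.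
Proof. by rewrite -big_split; apply: eq_bigr => i _; rewrite mxE mulrDl. Qed.

Lemma dotZl a u v : dot (a *: u) v = a * dot u v.
Proof. by rewrite mulr_sumr; apply: eq_bigr => i _; rewrite mxE mulrA. Qed.

Lemma dotNl u v : dot (- u) v = - dot u v.
Proof. by rewrite -scaleN1r dotZl mulN1r. Qed.

Lemma dot0l u : dot 0 u = 0.
Proof. by rewrite -(scale0r 0) dotZl mul0r. Qed.

Lemma dotDr u v w : dot w (u + v) = dot w u + dot w v.
Proof. by rewrite !(dotC w) dotDl. Qed.

Lemma dotZr a u v : dot v (a *: u) = a * dot v u.
Proof. by rewrite !(dotC v) dotZl. Qed.

Lemma dotNr u v : dot v (- u) = - dot v u.
Proof. by rewrite !(dotC v) dotNl. Qed.

Lemma dot0r u : dot u 0 = 0.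
Proof. by rewrite dotC dot0l. Qed.

Definition dotE := (dotDl, dotDr, dotNl, dotNr, dotZl, dotZr, dot0l, dot0r).

Lemma dot_ge0 u : 0 <= dot u u.
Proof. by apply: sumr_ge0 => i _; rewrite -expr2 sqr_ge0. Qed.

Lemma enormE u : enorm u = Num.sqrt (dot u u).
Proof. by congr Num.sqrt; apply: eq_bigr => i _; rewrite expr2. Qed.

Lemma sqr_enorm u : enorm u ^+ 2 = dot u u.
Proof. by rewrite enormE sqr_sqrtr// dot_ge0. Qed.

Lemma enorm_ge0 u : 0 <= enorm u.
Proof. exact: sqrtr_ge0. Qed.
Hint Resolve enorm_ge0 : core.

Lemma enorm_leP u c : 0 <= c -> (enorm u <= c) = (dot u u <= c ^+ 2).
Proof. by move=> c0; rewrite -sqr_enorm ler_pXn2r// nnegrE. Qed.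

Lemma enorm0 : enorm (0 : 'rV[R]_d) = 0.
Proof. by rewrite enormE dot0l sqrtr0. Qed.

Lemma enormN u : enorm (- u) = enorm u.
Proof. by rewrite !enormE !dotE opprK. Qed.

Lemma enormB u v : enorm (u - v) = enorm (v - u).
Proof. by rewrite -enormN opprB. Qed.

Lemma enormZ a u : enorm (a *: u) = `|a| * enorm u.
Proof.
by rewrite !enormE !dotE mulrA -expr2 sqrtrM ?sqr_ge0// sqrtr_sqr.
Qed.

Lemma enorm_eq0 u : enorm u = 0 -> u = 0.
Proof.
move=> u0; have : dot u u = 0 by rewrite -sqr_enorm u0 expr0n.
move/eqP; rewrite psumr_eq0 => [/allP h|i _]; last by rewrite -expr2 sqr_ge0.
apply/rowP => i; rewrite mxE.
by have := h i (mem_index_enum _); rewrite -expr2 sqrf_eq0 => /eqP.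
Qed.

Lemma enorm_gt0 u : u != 0 -> 0 < enorm u.
Proof.
by move=> u0; rewrite lt_neqAle enorm_ge0 andbT eq_sym; apply: contra_neq u0; exact: enorm_eq0.
Qed.

Lemma cauchy_schwarz u v : dot u v <= enorm u * enorm v.
Proof.
have [->|u0] := eqVneq u 0; first by rewrite dot0l enorm0 mul0r.
have [->|v0] := eqVneq v 0; first by rewrite dot0r enorm0 mulr0.
have nu := enorm_gt0 u0; have nv := enorm_gt0 v0.
have := dot_ge0 (enorm v *: u - enorm u *: v).
rewrite !dotE (dotC v u) -!sqr_enorm => h.
have : 0 <= (enorm u * enorm v) * (enorm u * enorm v - dot u v) by nra.
by rewrite pmulr_rge0 ?mulr_gt0// subr_ge0.
Qed.

Lemma cauchy_schwarz_norm u v : `|dot u v| <= enorm u * enorm v.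
Proof.
rewrite ler_norml cauchy_schwarz andbT lerNl -dotNl.
by rewrite (le_trans (cauchy_schwarz _ _))// enormN.
Qed.

Lemma dot_le u v a b : enorm u <= a -> enorm v <= b -> dot u v <= a * b.
Proof.
by move=> ua vb; apply: (le_trans (cauchy_schwarz _ _)); apply: ler_pM.
Qed.

Lemma ler_enormD u v : enorm (u + v) <= enorm u + enorm v.
Proof.
rewrite enorm_leP ?addr_ge0// !dotE (dotC v u) -!sqr_enorm.
by have := cauchy_schwarz u v; nra.
Qed.

Lemma ler_enormB u v : enorm (u - v) <= enorm u + enorm v.
Proof. by rewrite (le_trans (ler_enormD _ _))// enormN. Qed.

Lemma ler_enorm_dist w u v : enorm (u - v) <= enorm (u - w) + enorm (w - v).
Proof. by rewrite (le_trans _ (ler_enormD _ _))// addrA subrK. Qed.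

(** Duality: testing against unit vectors turns norm bounds on vector-valued increments and
    integrals into scalar estimates. *)
Lemma enorm_dir u c : 0 <= c -> (forall e, enorm e = 1 -> dot e u <= c) ->
  enorm u <= c.
Proof.
move=> c0 h; have [->|u0] := eqVneq u 0; first by rewrite enorm0.
have nu := enorm_gt0 u0.
have := h ((enorm u)^-1 *: u).
rewrite enormZ gtr0_norm ?invr_gt0// mulVf ?gt_eqF// => /(_ erefl).
by rewrite dotE -sqr_enorm expr2 mulKf ?gt_eqF.
Qed.

Lemma coord_le_enorm u i : `|u 0 i| <= enorm u.
Proof.
rewrite enormE -sqrtr_sqr ler_wsqrtr// /dot (bigD1 i)//= -expr2 lerDl.
by apply: sumr_ge0 => j _; rewrite -expr2 sqr_ge0.
Qed.

Lemma norm_le_enorm u : `|u| <= enorm u.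
Proof.
rewrite /Num.Def.normr/= mx_normrE; apply/bigmax_leP; split => //= -[i j] _.
by rewrite ord1 coord_le_enorm.
Qed.

Lemma coord_le_norm u i : `|u 0 i| <= `|u|.
Proof.
rewrite [leRHS]/Num.Def.normr/= mx_normrE.
by apply: (le_bigmax _ (fun ij => `|u ij.1 ij.2|) (0, i)).
Qed.

Lemma enorm_le_norm u : enorm u <= d%:R * `|u|.
Proof.
rewrite enorm_leP ?mulr_ge0//.
apply: (@le_trans _ _ (\sum_(i < d) `|u| ^+ 2)).
  apply: ler_sum => i _; rewrite -expr2 -real_normK ?num_real//.
  by rewrite ler_pXn2r ?nnegrE// coord_le_norm.
rewrite sumr_const card_ord -(mulr_natl (`|u| ^+ 2)) exprMn ler_wpM2r ?sqr_ge0//.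
by rewrite -natrX ler_nat -mulnn; have [->//|/leq_pmulr->] := posnP d.
Qed.

Lemma enorm_cvg {T} (F : set_system T) {FF : Filter F} (f : T -> 'rV[R]_d) (l : 'rV[R]_d) :
  f @ F --> l <-> forall e, 0 < e -> \forall t \near F, enorm (f t - l) <= e.
Proof.
split=> [/cvgrPdist_le h e e0|h].
  (* [d.+1] instead of [d] keeps the divisor positive in dimension 0. *)
  have e'0 : 0 < e / d.+1%:R by rewrite divr_gt0.
  move: (h _ e'0); apply: filterS => t ht.
  rewrite enormB (le_trans (enorm_le_norm _))//.
  rewrite (le_trans (ler_wpM2l _ ht))//.
  by rewrite mulrCA ger_pMr// ler_pdivrMr// mul1r ler_nat.
apply/cvgrPdist_le => e e0; move: (h _ e0); apply: filterS => t.
by rewrite enormB; apply: le_trans; exact: norm_le_enorm.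
Qed.

Lemma cvg_coord {T} (F : set_system T) {FF : Filter F} (f : T -> 'rV[R]_d)
    (l : 'rV[R]_d) i :
  f @ F --> l -> f t 0 i @[t --> F] --> l 0 i.
Proof.
move=> fl; apply: (@continuous_cvg _ _ _ F FF f (fun M : 'rV[R]_d => M 0 i)) => //.
exact: coord_continuous.
Qed.

Lemma cvg_dot {T} (F : set_system T) {FF : Filter F} (f g : T -> 'rV[R]_d)
    (k l : 'rV[R]_d) :
  f @ F --> k -> g @ F --> l -> dot (f t) (g t) @[t --> F] --> dot k l.
Proof.
move=> fk gl; rewrite /dot; elim: index_enum => [|i r IH].
  by rewrite big_nil; under eq_fun do rewrite big_nil; exact: cvg_cst.
rewrite big_cons; under eq_fun do rewrite big_cons.
by apply: cvgD => //; apply: cvgM; exact: cvg_coord.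
Qed.

Lemma cvg_enorm {T} (F : set_system T) {FF : Filter F} (f : T -> 'rV[R]_d) (k : 'rV[R]_d) :
  f @ F --> k -> enorm (f t) @[t --> F] --> enorm k.
Proof.
move=> fk; under eq_fun do rewrite enormE; rewrite enormE.
apply: continuous_cvg; first exact: sqrt_continuous.
exact: cvg_dot.
Qed.

Lemma enorm_continuous : continuous (@enorm R d).
Proof.
by move=> u; have := @cvg_enorm _ (nbhs u) _ id u; apply; exact: cvg_id.
Qed.

Lemma lip_continuous (f : 'rV[R]_d -> R) :
  (forall p q, `|f p - f q| <= enorm (p - q)) -> continuous f.
Proof.
move=> fl p; have /enorm_cvg h : id @ nbhs p --> p by exact: cvg_id.
apply/(@cvgrPdist_le _ _ _ (nbhs p)) => e e0; near=> q.
by rewrite (le_trans (fl _ _))// enormB; near: q; exact: h.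
Unshelve. all: by end_near. Qed.

Lemma ler_dist_enorm u v : `|enorm u - enorm v| <= enorm (u - v).
Proof.
apply/ler_normlP; split.
  by rewrite opprB lerBlDr enormB -[leLHS]/(enorm v) -{1}(subrK u v) ler_enormD.
by rewrite lerBlDr -{1}(subrK v u) ler_enormD.
Qed.

End Euclid.
#[export] Hint Extern 0 (is_true (0 <= enorm _)) => exact: enorm_ge0 : core.

(* Merges [dot a b] and [dot b a] before calling [ring]. *)
Ltac dot_sym := repeat match goal with |- context [dot ?a ?b] =>
  tryif constr_eq a b then fail else
  match goal with |- context [dot b a] => rewrite (dotC b a) end end.
Ltac dot_ring := rewrite ?dotE; dot_sym; ring.

(** * Right derivatives *)

Section RightDerivative.
Context {R : realType}.
Implicit Types (f g F : R -> R) (a b c u v l m : R).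

(** One-sided because the integrands are cadlag: their primitives have a right derivative
    everywhere, but in general no two-sided one at a jump. *)
Definition rderiv f u l : Prop := (f v - f u) / (v - u) @[v --> u^'+] --> l.

Lemma rderiv_cvg f u l : rderiv f u l -> f v @[v --> u^'+] --> f u.
Proof.
move=> fl; have h : (f v - f u) / (v - u) * (v - u) + f u @[v --> u^'+] -->
    l * (u - u) + f u.
  apply: cvgD; last exact: cvg_cst.
  apply: cvgM => //; apply: cvgB; last exact: cvg_cst.
  by apply: cvg_at_right_filter; exact: cvg_id.
rewrite subrr mulr0 add0r in h; apply: cvg_trans h; apply: near_eq_cvg.
near=> v; rewrite divfK ?subrK// subr_eq0 gt_eqF//.
Unshelve. all: by end_near. Qed.

Lemma rderiv_cst c u : rderiv (fun=> c) u 0.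
Proof. by rewrite /rderiv subrr; under eq_fun do rewrite mul0r; exact: cvg_cst. Qed.

Lemma rderiv_id u : rderiv id u 1.
Proof.
apply: (@cvg_trans _ ((fun=> 1 : R) @ u^'+)); last exact: cvg_cst.
apply: near_eq_cvg; near=> v; rewrite divff// subr_eq0 gt_eqF//.
Unshelve. all: by end_near. Qed.

Lemma rderivD f g u l m : rderiv f u l -> rderiv g u m ->
  rderiv (fun v => f v + g v) u (l + m).
Proof.
move=> fl gm; rewrite /rderiv.
under eq_fun do rewrite opprD addrACA mulrDl.
exact: cvgD.
Qed.

Lemma rderivM f g u l m : rderiv f u l -> rderiv g u m ->
  rderiv (fun v => f v * g v) u (l * g u + f u * m).
Proof.
move=> fl gm; rewrite /rderiv.
have -> : (fun v => (f v * g v - f u * g u) / (v - u)) =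
    (fun v => (f v - f u) / (v - u) * g v + f u * ((g v - g u) / (v - u))).
  by apply/funext => v; ring.
apply: cvgD; first by apply: cvgM => //; exact: rderiv_cvg gm.
by apply: cvgM => //; exact: cvg_cst.
Qed.

Lemma rderivP f u l : rderiv f u l <-> forall e, 0 < e ->
  \forall v \near u^'+, `|f v - f u - l * (v - u)| <= e * (v - u).
Proof.
have key v e : u < v -> (`|f v - f u - l * (v - u)| <= e * (v - u)) =
    (`|l - (f v - f u) / (v - u)| <= e).
  rewrite -subr_gt0 => uv; rewrite -[RHS](ler_pM2r uv); congr (_ <= _).
  by rewrite -[X in _ = _ * X](gtr0_norm uv) -normrM mulrBl divfK ?gt_eqF// distrC.
split=> [/cvgrPdist_le h e e0|h].
  near=> v; have uv : u < v by [].
  by rewrite key//; near: v; exact: h.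
apply/cvgrPdist_le => e e0; near=> v; have uv : u < v by [].
by rewrite -key//; near: v; exact: h.
Unshelve. all: by end_near. Qed.

(* Chain rule for an outer function that is only controlled by its increments:
   [F] has derivative [G] and the inner function may be constant near [u]. *)
Lemma rderiv_comp F G f u l : rderiv f u l ->
  (forall e, 0 < e -> \forall c \near f u,
     `|F c - F (f u) - G * (c - f u)| <= e * `|c - f u|) ->
  rderiv (F \o f) u (G * l).
Proof.
move=> fl FG; apply/rderivP => e e0.
(* The error of [F] costs [e1 * (|l| + 1)] and that of [f] costs [|G| * e1]; together they make
   [e / 2]. *)
pose e1 := e / 2 / (`|l| + 1 + `|G|); have e10 : 0 < e1.
  by rewrite !divr_gt0// addr_ge0_gt0// ?ltr_wpDl// ltr_pwDl.
have fcv := rderiv_cvg fl; have /(_ 1 ltr01) f1 := (rderivP f u l).1 fl.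
have /(_ e1 e10) f2 := (rderivP f u l).1 fl.
near=> v; have uv : u < v by near: v; exact: nbhs_right_gt.
have h1 : `|f v - f u - l * (v - u)| <= 1 * (v - u) by near: v; exact: f1.
have h2 : `|f v - f u - l * (v - u)| <= e1 * (v - u) by near: v; exact: f2.
have h3 : `|F (f v) - F (f u) - G * (f v - f u)| <= e1 * `|f v - f u|.
  near: v; exact: (fcv _ (FG _ e10)).
have h4 : `|f v - f u| <= (`|l| + 1) * (v - u).
  rewrite -(subrK (l * (v - u)) (f v - f u)) (le_trans (ler_normD _ _))//.
  rewrite normrM (@gtr0_norm _ (v - u)) ?subr_gt0//; lra.
have -> : (F \o f) v - (F \o f) u - G * l * (v - u) =
  (F (f v) - F (f u) - G * (f v - f u)) + G * (f v - f u - l * (v - u)).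
  by rewrite /=; ring.
rewrite (le_trans (ler_normD _ _))// normrM.
have h5 : `|G| * `|f v - f u - l * (v - u)| <= `|G| * (e1 * (v - u)).
  by rewrite ler_wpM2l.
have h6 : e1 * `|f v - f u| <= e1 * ((`|l| + 1) * (v - u)).
  by rewrite ler_pM2l.
have h7 : e1 * (`|l| + 1 + `|G|) = e / 2.
  by rewrite divfK// gt_eqF// addr_ge0_gt0// ?ltr_wpDl// ltr_pwDl.
have : 0 < e * (v - u) by rewrite mulr_gt0// subr_gt0.
have E : `|G| * (e1 * (v - u)) = e1 * (`|l| + 1 + `|G|) * (v - u)
   - e1 * ((`|l| + 1) * (v - u)) by ring.
by rewrite h7 in E; lra.
Unshelve. all: by end_near. Qed.

(** Left continuity is required separately, since a right derivative only yields right continuity;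
    both are what the supremum argument of [rprim_le] consumes. *)
Definition rprim a b f f' : Prop :=
  (forall u, a <= u < b -> rderiv f u (f' u)) /\
  (forall u, a < u <= b -> f v @[v --> u^'-] --> f u).

Lemma rprimS a b a' b' f f' : a <= a' -> b' <= b -> rprim a b f f' ->
  rprim a' b' f f'.
Proof.
move=> aa bb [h1 h2]; split=> u /andP[h3 h4].
  by apply: h1; rewrite (le_trans aa)//= (lt_le_trans h4).
by apply: h2; rewrite (le_lt_trans aa)//= (le_trans h4).
Qed.

Lemma eq_rprim a b f f' g' : (forall u, a <= u < b -> f' u = g' u) ->
  rprim a b f f' -> rprim a b f g'.
Proof. by move=> h [h1 h2]; split=> // u hu; rewrite -h//; exact: h1. Qed.

Lemma rprim_cst a b c : rprim a b (fun=> c) (fun=> 0).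
Proof. by split=> u _; [exact: rderiv_cst|exact: cvg_cst]. Qed.

Lemma rprim_id a b : rprim a b id (fun=> 1).
Proof.
split=> u _; first exact: rderiv_id.
by apply: cvg_at_left_filter; exact: cvg_id.
Qed.

Lemma rprimD a b f f' g g' : rprim a b f f' -> rprim a b g g' ->
  rprim a b (fun v => f v + g v) (fun v => f' v + g' v).
Proof.
move=> [f1 f2] [g1 g2]; split=> u hu; first exact: rderivD (f1 _ hu) (g1 _ hu).
by apply: cvgD; [exact: f2|exact: g2].
Qed.

Lemma rprimM a b f f' g g' : rprim a b f f' -> rprim a b g g' ->
  rprim a b (fun v => f v * g v) (fun v => f' v * g v + f v * g' v).
Proof.
move=> [f1 f2] [g1 g2]; split=> u hu; first exact: rderivM (f1 _ hu) (g1 _ hu).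
by apply: cvgM; [exact: f2|exact: g2].
Qed.

Lemma rprimZ a b c f f' : rprim a b f f' ->
  rprim a b (fun v => c * f v) (fun v => c * f' v).
Proof.
move=> /(rprimM (rprim_cst a b c)).
by apply: eq_rprim => u _; rewrite mul0r add0r.
Qed.

Lemma rprimB a b f f' g g' : rprim a b f f' -> rprim a b g g' ->
  rprim a b (fun v => f v - g v) (fun v => f' v - g' v).
Proof.
move=> hf /(rprimZ (-1)) /(rprimD hf).
under eq_fun do rewrite mulN1r; apply: eq_rprim => u _.
by rewrite mulN1r.
Qed.

Lemma rprim_sum (I : Type) (r : seq I) a b (f f' : I -> R -> R) :
  (forall i, rprim a b (f i) (f' i)) ->
  rprim a b (fun v => \sum_(i <- r) f i v) (fun v => \sum_(i <- r) f' i v).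
Proof.
move=> h; elim: r => [|i r IH].
  under eq_fun do rewrite big_nil; apply: eq_rprim (rprim_cst a b 0) => u _.
  by rewrite big_nil.
under eq_fun do rewrite big_cons.
apply: eq_rprim (rprimD (h i) IH) => u _; by rewrite big_cons.
Qed.

(** Supremum of the times up to which [f] has grown with slope at most [e]: left continuity puts the
    supremum itself into the set, and the right derivative moves it further unless it is [b]. *)
Lemma rprim_le a b f f' : a <= b -> rprim a b f f' ->
  (forall u, a <= u < b -> f' u <= 0) -> f b <= f a.
Proof.
move=> ab [f1 f2] f'0.
suff h e : 0 < e -> f b <= f a + e * (b - a).
  move: ab; rewrite le_eqVlt => /predU1P[->//|ab].
  apply/ler_addgt0Pr => e e0.
  have := h (e / (b - a)); rewrite divfK ?subr_eq0 ?gt_eqF//; apply.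
  by rewrite divr_gt0// subr_gt0.
move=> e0; pose S := [set t | a <= t <= b /\ f t <= f a + e * (t - a)].
have Sa : S a by rewrite /S/= lexx ab subrr mulr0 addr0.
have Sb : ubound S b by move=> t [/andP[]].
have supS : has_sup S by split; [exists a|exists b].
pose s := sup S; have sb : s <= b by apply: ge_sup => //; exists a.
have as_ : a <= s by apply: ub_le_sup => //; exists b.
have Ss : S s.
  split; first by rewrite as_ sb.
  move: as_; rewrite le_eqVlt => /predU1P[<-|as_].
    by rewrite subrr mulr0 addr0.
  apply/ler_addgt0Pr => c c0.
  have : \forall v \near s^'-, `|f s - f v| <= c.
    have /cvgrPdist_le : f v @[v --> s^'-] --> f s by apply: f2; rewrite as_ sb.
    exact.
  move=> [r /= r0 hr].
  have [t [/andP[at_ tb] ft]] : exists2 t, S t & s - r < t.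
    exact: sup_adherent.
  move=> st; have ts : t <= s by apply: ub_le_sup => //; [exists b|split => //; apply/andP].
  move: ts; rewrite le_eqVlt => /predU1P[<-|ts]; first by rewrite ler_wpDr// ltW.
  have : `|f s - f t| <= c.
    apply: (hr t _ ts); have : 0 < s - t by rewrite subr_gt0.
    by rewrite /= => /gtr0_norm ->; lra.
  move=> /ler_normlP[_ h]; have := ler_wpM2l (ltW e0) (ltW ts).
  by move: ft h; rewrite !mulrBr; lra.
move: sb; rewrite le_eqVlt => /predU1P[<-|sb]; first by case: Ss.
have h : \forall v \near s^'+, `|f v - f s - f' s * (v - s)| <= e * (v - s).
  by apply: (rderivP _ _ _).1 => //; apply: f1; rewrite as_ sb.
have [v [sv [vb hv]]] : exists v, s < v /\ v <= b /\
    `|f v - f s - f' s * (v - s)| <= e * (v - s).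
  near (s^'+)%R => v; exists v; split => //; split; near: v => //.
  exact: nbhs_right_le.
have : v <= s.
  apply: ub_le_sup; first by exists b.
  split; first by rewrite vb (le_trans as_ (ltW sv)).
  have f's : f' s <= 0 by apply: f'0; rewrite as_ sb.
  have [_ fs] := Ss; move/ler_normlP : hv => [_ hv].
  have : f' s * (v - s) <= 0 by rewrite mulr_le0_ge0// subr_ge0 ltW.
  by move: fs hv; rewrite !mulrBr; lra.
by rewrite leNgt sv.
Unshelve. all: by end_near. Qed.

Lemma rprim_le2 a b f f' g g' : a <= b -> rprim a b f f' -> rprim a b g g' ->
  (forall u, a <= u < b -> f' u <= g' u) -> f b - f a <= g b - g a.
Proof.
move=> ab hf hg h; suff : f b - g b <= f a - g a by lra.
by apply: (rprim_le ab (rprimB hf hg)) => u /h; rewrite subr_le0.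
Qed.

End RightDerivative.

(** * Vector-valued primitives *)

Section VectorPrimitive.
Context {R : realType} {d : nat}.
Implicit Types (k : R -> 'rV[R]_d) (e z : 'rV[R]_d).

Definition vprim a b k k' : Prop :=
  forall i : 'I_d, rprim a b (fun u => k u 0 i) (fun u => k' u 0 i).

Lemma vprimS a b a' b' k k' : a <= a' -> b' <= b -> vprim a b k k' ->
  vprim a' b' k k'.
Proof. by move=> ? ? h i; exact: rprimS (h i). Qed.

Lemma vprim_shift a b z k k' : vprim a b k k' -> vprim a b (fun u => k u + z) k'.
Proof.
move=> h i; under eq_fun do rewrite mxE.
by apply: eq_rprim (rprimD (h i) (rprim_cst a b (z 0 i))) => u _; rewrite addr0.
Qed.

Lemma vprimB a b k k' l l' : vprim a b k k' -> vprim a b l l' ->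
  vprim a b (fun u => k u - l u) (fun u => k' u - l' u).
Proof.
move=> hk hl i; under eq_fun do rewrite !mxE.
by apply: eq_rprim (rprimB (hk i) (hl i)) => u _; rewrite !mxE.
Qed.

Lemma rprim_dot a b k k' l l' : vprim a b k k' -> vprim a b l l' ->
  rprim a b (fun u => dot (k u) (l u)) (fun u => dot (k' u) (l u) + dot (k u) (l' u)).
Proof.
move=> hk hl; apply: eq_rprim (rprim_sum _ (fun i => rprimM (hk i) (hl i))) => u _.
by rewrite big_split.
Qed.

Lemma vprim_cst a b z : vprim a b (fun=> z) (fun=> 0).
Proof. by move=> i; apply: eq_rprim (rprim_cst a b (z 0 i)) => u _; rewrite mxE. Qed.

Lemma rprim_dotl a b e k k' : vprim a b k k' ->
  rprim a b (fun u => dot e (k u)) (fun u => dot e (k' u)).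
Proof.
move=> h; apply: eq_rprim (rprim_dot (vprim_cst a b e) h) => u _.
by rewrite dot0l add0r.
Qed.

Lemma rprim_sqr a b k k' : vprim a b k k' ->
  rprim a b (fun u => dot (k u) (k u)) (fun u => 2 * dot (k u) (k' u)).
Proof.
move=> h; apply: eq_rprim (rprim_dot h h) => u _.
by rewrite (dotC (k' u)); ring.
Qed.

(** Mean value inequality, reduced by [enorm_dir] to the scalar comparison along each unit
    vector. *)
Lemma vprim_le a b k k' (g g' : R -> R) : a <= b -> vprim a b k k' ->
  rprim a b g g' -> (forall u, a <= u < b -> enorm (k' u) <= g' u) ->
  enorm (k b - k a) <= g b - g a.
Proof.
move=> ab hk hg h; apply: enorm_dir.
  rewrite -[leLHS](subrr (0 : R)).
  by apply: (rprim_le2 ab (rprim_cst a b 0) hg) => u /h; apply: le_trans; exact: enorm_ge0.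
move=> e e1; rewrite !dotE.
apply: (rprim_le2 ab (rprim_dotl e hk) hg) => u /h; apply: le_trans.
by rewrite -[leRHS]mul1r; apply: dot_le => //; rewrite e1.
Qed.

End VectorPrimitive.

(** * Projection onto a convex domain *)

Section Projection.
Context {R : realType} {d : nat} (D : set 'rV[R]_d).
Context (openD : open D) (D_neq0 : D !=set0) (bndD : bounded_set D)
  (cvxD : convex_set D).
Implicit Types (p q v w z : 'rV[R]_d) (e t r : R).

Lemma nbhs_enorm p (A : set 'rV[R]_d) :
  nbhs p A <-> exists2 e, 0 < e & forall q, enorm (q - p) <= e -> A q.
Proof.
split=> [/nbhs_ballP[e /= e0 h]|[e e0 h]].
  exists (e / 2); first by rewrite divr_gt0.
  move=> q hq; apply: h; rewrite -ball_normE/= distrC.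
  by rewrite (le_lt_trans (norm_le_enorm _))// (le_lt_trans hq)// ltr_pdivrMr// ltr_pMr// ltr1n.
have /enorm_cvg hp : id @ nbhs p --> p by exact: cvg_id.
exact: filterS (hp _ e0).
Qed.

Lemma closure_enorm (A : set 'rV[R]_d) p :
  closure A p <-> forall e, 0 < e -> exists2 q, A q & enorm (p - q) <= e.
Proof.
split=> [h e e0|h B /nbhs_enorm[e e0 hB]].
  have [|q [Aq pq]] := h [set q | enorm (q - p) <= e].
    by apply/nbhs_enorm; exists e.
  by exists q => //; rewrite enormB.
have [q Aq pq] := h _ e0; exists q; split => //; apply: hB.
by rewrite enormB.
Qed.

Lemma segD p q t : D p -> D q -> 0 <= t <= 1 -> D (p + t *: (q - p)).
Proof.
move=> Dp Dq /andP[t0 t1].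
have := cvxD (Itv01 t0 t1) (mem_set Dq) (mem_set Dp).
rewrite inE; congr D.
apply/rowP => i; rewrite !mxE /= /unstable.onem; ring.
Qed.

Lemma seg_closure p q t : closure D p -> closure D q -> 0 <= t <= 1 ->
  closure D (p + t *: (q - p)).
Proof.
move=> /closure_enorm Cp /closure_enorm Cq /andP[t0 t1].
apply/closure_enorm => e e0.
have [p' Dp pp] := Cp _ e0; have [q' Dq qq] := Cq _ e0.
exists (p' + t *: (q' - p')); first by apply: segD => //; rewrite t0.
have -> : p + t *: (q - p) - (p' + t *: (q' - p')) =
  (1 - t) *: (p - p') + t *: (q - q').
  by apply/rowP => i; rewrite !mxE; ring.
rewrite (le_trans (ler_enormD _ _))// !enormZ !ger0_norm ?subr_ge0//.
have := ler_wpM2l t0 qq; have : 0 <= 1 - t by lra.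
by move=> /ler_wpM2l /(_ _ _ pp); lra.
Qed.

Lemma inner_ball q : D q -> exists2 r, 0 < r &
  forall w, enorm (w - q) <= r -> D w.
Proof. by move=> Dq; apply/nbhs_enorm; exact: open_nbhs_nbhs. Qed.

Lemma seg_interior p q t : closure D p -> D q -> 0 < t <= 1 ->
  D (p + t *: (q - p)).
Proof.
move=> /closure_enorm Cp Dq /andP[t0 t1].
have [r r0 hr] := inner_ball Dq.
have [p' Dp pp] := Cp _ (mulr_gt0 t0 r0).
(* The point is rewritten as a combination of [p'], which lies in [D] near [p], and of [q']; as
   [p - p'] has norm at most [t * r], [q'] stays in the ball around [q]. *)
pose q' := q + ((1 - t) / t) *: (p - p').
have -> : p + t *: (q - p) = p' + t *: (q' - p').
  apply/rowP => i; rewrite !mxE; field; exact: lt0r_neq0.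
apply: segD => //; last by rewrite ltW.
apply: hr; rewrite /q' addrAC subrr add0r enormZ ger0_norm; last first.
  by rewrite divr_ge0 ?subr_ge0// ltW.
rewrite mulrAC ler_pdivrMr// (le_trans (ler_wpM2l _ pp)) ?subr_ge0//.
have := mulr_ge0 (ltW t0) (ltW (mulr_gt0 t0 r0)); lra.
Qed.

Lemma closure_neq0 : closure D !=set0.
Proof. by case: D_neq0 => z Dz; exists z; exact: subset_closure. Qed.

Lemma bounded_closureD : exists2 M, 0 < M & forall z, closure D z -> enorm z <= M.
Proof.
have [M [_ hM]] := bndD.
exists (d%:R * `|M + 1| + 1); first by rewrite ltr_wpDl// mulr_ge0.
move=> z /closure_enorm /(_ 1 ltr01)[q Dq zq].
rewrite -(subrK q z) (le_trans (ler_enormD _ _))// addrC lerD//.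
rewrite (le_trans (enorm_le_norm _))// ler_wpM2l//.
by rewrite (le_trans (hM (M + 1) _ _ Dq)) ?ltrDl// ler_norm.
Qed.

Lemma compact_closureD : compact (closure D).
Proof.
apply: bounded_closed_compact; last exact: closed_closure.
have [M _ hM] := bounded_closureD; exists M; split; first exact: num_real.
move=> N /ltW MN z /= Cz.
by rewrite (le_trans (norm_le_enorm _))// (le_trans (hM _ Cz)).
Qed.

Lemma proj_spec z : closure D (proj D z) /\
  forall q, closure D q -> enorm (z - proj D z) <= enorm (z - q).
Proof.
rewrite /Defs.proj.
have cf : {within closure D, continuous (fun q => enorm (z - q))}.
  apply: continuous_subspaceT; apply: lip_continuous => p q.
  rewrite (le_trans (ler_dist_enorm _ _))// (_ : z - p - _ = q - p) 1?enormB//.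
  by apply/rowP => i; rewrite !mxE; ring.
have [c Cc hc] := compact_EVT_min closure_neq0 compact_closureD cf.
case: xgetP => [p _ //|/(_ c)]; case.
split; first by rewrite inE in Cc.
by move=> q Cq; apply: hc; rewrite inE.
Qed.

Lemma proj_in z : closure D (proj D z).
Proof. by case: (proj_spec z). Qed.

(* The quadratic [t |-> |z - p - t (q - p)|^2] is minimal at [t = 0]. *)
Lemma proj_var z q : closure D q -> dot (z - proj D z) (q - proj D z) <= 0.
Proof.
move=> Cq; have [Cp hp] := proj_spec z; set p := proj D z in Cp hp *.
set v := z - p; set w := q - p; rewrite leNgt; apply/negP => vw.
have w0 : 0 < dot w w + dot v w.
  by rewrite ltr_wpDl// dot_ge0.
pose t := dot v w / (dot w w + dot v w).
have t0 : 0 < t by rewrite divr_gt0.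
have t1 : t <= 1 by rewrite ler_pdivrMr// mul1r lerDr dot_ge0.
have := hp _ (seg_closure Cp Cq (_ : 0 <= t <= 1)).
rewrite (ltW t0) t1 => /(_ isT).
rewrite opprD addrA -/v -/w enorm_leP// sqr_enorm; clearbody v w; rewrite !dotE (dotC w v).
have : t * (dot w w + dot v w) = dot v w by rewrite divfK// gt_eqF.
have := mulr_gt0 t0 vw; have := dot_ge0 w; move: (dot v w) (dot w w) (dot v v) => a b c.
by nra.
Qed.

Lemma proj_unique z p : closure D p ->
  (forall q, closure D q -> dot (z - p) (q - p) <= 0) -> proj D z = p.
Proof.
move=> Cp h; have h1 := proj_var z Cp; have h2 := h _ (@proj_in z).
apply/eqP; rewrite -subr_eq0; apply/eqP/enorm_eq0/eqP.
rewrite -sqrf_eq0 sqr_enorm eq_le dot_ge0 andbT.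
have -> : dot (proj D z - p) (proj D z - p) =
  dot (z - p) (proj D z - p) + dot (z - proj D z) (p - proj D z).
  by rewrite !dotE; ring.
lra.
Qed.

Lemma proj_id z : closure D z -> proj D z = z.
Proof. by move=> Cz; apply: proj_unique => // q _; rewrite subrr dot0l. Qed.

(** Firm nonexpansiveness, the sum of the variational inequalities at [z] and [w]. It is stronger
    than the Lipschitz bound, and [relaxation] needs this strength. *)
Lemma proj_mono z w :
  dot (proj D z - proj D w) (proj D z - proj D w) <=
  dot (z - w) (proj D z - proj D w).
Proof.
have h1 := proj_var z (@proj_in w); have h2 := proj_var w (@proj_in z).
rewrite -subr_ge0.
have -> : dot (z - w) (proj D z - proj D w)
    - dot (proj D z - proj D w) (proj D z - proj D w) =
    - dot (z - proj D z) (proj D w - proj D z)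
    - dot (w - proj D w) (proj D z - proj D w).
  by move: (proj D z) (proj D w) => p q; rewrite !dotE; ring.
lra.
Qed.

Lemma proj_lip z w : enorm (proj D z - proj D w) <= enorm (z - w).
Proof.
have := le_trans (proj_mono z w) (cauchy_schwarz _ _).
rewrite -sqr_enorm expr2.
have [->//|] := eqVneq (enorm (proj D z - proj D w)) 0.
by move=> h; rewrite ler_pM2r// lt_neqAle eq_sym h/=.
Qed.

(** The variational inequality tested with the point of the ball that is farthest in the direction
    of [z - proj D z]. This is the source of all bounds on the variation of [kn]. *)
Lemma proj_ball a r z : (forall w, enorm (w - a) <= r -> D w) -> 0 <= r ->
  r * enorm (z - proj D z) <= dot (z - proj D z) (proj D z - a).
Proof.
move=> hr r0; have [->|v0] := eqVneq (z - proj D z) 0.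
  by rewrite dot0l enorm0 mulr0.
set v := z - proj D z in v0 *; have nv := enorm_gt0 v0.
have Cq : closure D (a + (r / enorm v) *: v).
  apply: subset_closure; apply: hr.
  by rewrite addrAC subrr add0r enormZ ger0_norm ?divfK ?gt_eqF// divr_ge0// ltW.
have := proj_var z Cq; rewrite -/v; clearbody v; rewrite !dotE.
have : r / enorm v * dot v v = r * enorm v.
  by rewrite -sqr_enorm expr2 mulrA divfK ?gt_eqF.
lra.
Qed.

(** Were the projection interior, [proj_ball] with a ball centred at it would force [z] to equal
    it. *)
Lemma proj_boundary z : ~ closure D z -> boundary D (proj D z).
Proof.
move=> Cz; split; first exact: proj_in.
move=> /interior_subset Dp; apply: Cz.
have [r r0 hr] := inner_ball Dp.
have := proj_ball z hr (ltW r0); rewrite subrr dot0r => h.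
have : enorm (z - proj D z) = 0.
  by apply/eqP; rewrite eq_le enorm_ge0 andbT -(pmulr_rle0 _ r0).
by move=> /enorm_eq0 /eqP; rewrite subr_eq0 => /eqP ->; exact: proj_in.
Qed.

End Projection.

(** * First-order expansion from continuous partial derivatives *)

Section DirectionalExpansion.
Context {R : realType} {d : nat}.
Implicit Types (U : set 'rV[R]_d) (phi : 'rV[R]_d -> R) (z p : 'rV[R]_d).

Lemma mean_value_line phi p (e : 'rV[R]_d) (c : R) :
  (forall s : R, `|s| <= `|c| -> derivable phi (p + s *: e) e) ->
  exists2 s : R, `|s| <= `|c| & phi (p + c *: e) - phi p = c * 'D_e phi (p + s *: e).
Proof.
move=> dphi; pose psi (s : R) : R := phi (p + s *: e).
have quot (s : R) : (fun h : R => h^-1 *: ((psi \o shift s) (h *: (1 : R)) - psi s)) =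
    (fun h => h^-1 *: ((phi \o shift (p + s *: e)) (h *: e) - phi (p + s *: e))).
  apply/funext => h; rewrite /psi/=; congr (_ *: (phi _ - _)).
  by rewrite [h *: 1]mulr1 scalerDl addrCA.
have der (s : R) : `|s| <= `|c| -> is_derive s 1 psi ('D_e phi (p + s *: e)).
  move=> /dphi ds; apply: DeriveDef; first by rewrite /derivable quot.
  by rewrite /derive quot.
have cont (a b : R) : (forall s, s \in `[a, b] -> `|s| <= `|c|) ->
    {within `[a, b], continuous psi}.
  move=> h; apply: derivable_within_continuous => s /h /der[] //.
have psi0 : psi 0 = phi p by rewrite /psi scale0r addr0.
have [c0|c0] := leP 0 c.
- have bnd s : s \in `[0, c] -> `|s| <= `|c|.
    by rewrite in_itv/= => /andP[s0 sc]; rewrite !ger0_norm.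
  have [s sc] := MVT_segment c0 (fun s hs => der s (bnd s (subset_itv_oo_cc hs)))
    (cont _ _ bnd).
  by rewrite subr0 psi0 mulrC => ?; exists s => //; exact: bnd.
- have bnd s : s \in `[c, 0] -> `|s| <= `|c|.
    by rewrite in_itv/= => /andP[cs s0]; rewrite !ler0_norm ?lerN2// ltW.
  have [s sc] := MVT_segment (ltW c0) (fun s hs => der s (bnd s (subset_itv_oo_cc hs)))
    (cont _ _ bnd).
  rewrite sub0r psi0 mulrN => h; exists s; first exact: bnd.
  by rewrite -opprB -[phi (p + _)]/(psi c) h opprK mulrC.
Qed.

(** Only partial derivatives are available, so the coordinates of [h] are switched on one at a time
    ([hh]), with the mean value theorem along each axis and continuity of the partial derivatives at
    [z]. *)
Lemma directional_expansion U phi z (h : 'rV[R]_d) : open_nbhs z U -> C2_on U phi ->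
  forall e : R, 0 < e -> exists2 r, 0 < r & forall t, 0 < t <= r ->
    `|phi (z + t *: h) - phi z - t * dot (gradient phi z) h| <= e * t.
Proof.
move=> [openU Uz] [_ C2] e e0.
have [r1 r10 hU] : exists2 r1, 0 < r1 & forall w, enorm (w - z) <= r1 -> U w.
  by apply/nbhs_enorm; exact: open_nbhs_nbhs.
(* Each of the [d] coordinate steps costs at most [t * (enorm h + 1) * e1], so together they stay
   below [e * t]. *)
pose e1 := e / ((enorm h + 1) * d.+1%:R).
have e10 : 0 < e1 by rewrite divr_gt0// mulr_gt0// ltr_wpDl.
have : \forall w \near z, forall i, `|partial i phi z - partial i phi w| <= e1.
  apply: (@filter_forall _ _ _ (nbhs z)) => i.
  by case: (C2 i i z Uz) => _ + _ _ => /cvgrPdist_le; exact.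
move=> /nbhs_enorm[r2 r20 hp].
pose r := Num.min r1 r2 / (2 * (enorm h + 1)).
have r0 : 0 < r by rewrite divr_gt0 ?lt_min ?r10// mulr_gt0// ltr_wpDl.
exists r => // t /andP[t0 tr].
pose hh (m : nat) : 'rV[R]_d := \row_j (if (j < m)%N then h 0 j else 0).
have hhd : hh d = h by apply/rowP => j; rewrite mxE ltn_ord.
have hh0 : hh 0%N = 0 by apply/rowP => j; rewrite !mxE.
have hhn m : enorm (hh m) <= enorm h.
  rewrite !enormE ler_wsqrtr//; apply: ler_sum => j _.
  by rewrite mxE; case: ifP => // _; rewrite mulr0 -expr2 sqr_ge0.
have hhS (i : 'I_d) : hh i.+1 = hh i + h 0 i *: delta_mx 0 i.
  apply/rowP => j; rewrite !mxE eqxx/= ltnS leq_eqVlt.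
  have [<-|ji] := eqVneq i j; first by rewrite eqxx ltnn/= add0r mulr1.
  by rewrite (_ : _ == _ = false) ?mulr0 ?addr0//; apply: contra_neqF ji => /eqP/val_inj.
have step (i : 'I_d) : `|phi (z + t *: hh i.+1) - phi (z + t *: hh i) -
    t * (h 0 i * partial i phi z)| <= t * (enorm h + 1) * e1.
  have close s : `|s| <= `|t * h 0 i| ->
      enorm (z + t *: hh i + s *: delta_mx 0 i - z) <= Num.min r1 r2.
    move=> hs; rewrite addrC !addrA addNr add0r.
    rewrite (le_trans (ler_enormD _ _))// !enormZ.
    have -> : enorm (delta_mx 0 i : 'rV[R]_d) = 1.
      rewrite enormE /dot (bigD1 i)//= big1 ?addr0 ?mxE ?eqxx ?mulr1 ?sqrtr1//.
      by move=> j ji; rewrite !mxE eqxx/= (negPf ji) mulr0.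
    have h1 : `|t * h 0 i| <= t * enorm h.
      by rewrite normrM (gtr0_norm t0) ler_pM2l// coord_le_enorm.
    have h2 : `|t| * enorm (hh i) <= t * enorm h.
      by rewrite (gtr0_norm t0) ler_pM2l.
    have : t * (2 * (enorm h + 1)) <= Num.min r1 r2.
      by rewrite -ler_pdivlMr// mulr_gt0// ltr_wpDl.
    by move: hs; rewrite mulr1; have := t0; lra.
  have [s hs] : exists2 s : R, `|s| <= `|t * h 0 i| &
      phi (z + t *: hh i + (t * h 0 i) *: delta_mx 0 i) - phi (z + t *: hh i) =
      (t * h 0 i) * 'D_(delta_mx 0 i) phi (z + t *: hh i + s *: delta_mx 0 i).
    apply: mean_value_line => s hs.
    have Uw : U (z + t *: hh i + s *: delta_mx 0 i).
      by apply: hU; rewrite (le_trans (close _ hs))// ge_min lexx.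
    by have [der _ _ _] := C2 i i _ Uw; exact: der.
  rewrite hhS scalerDr scalerA addrA => ->; rewrite -/(partial i phi _).
  have := hp (z + t *: hh i + s *: delta_mx 0 i) _ i.
  rewrite (le_trans (close _ hs)) ?ge_min ?lexx ?orbT// => /(_ isT) hpi.
  rewrite -mulrA -mulrBr -mulrBr !normrM (gtr0_norm t0) -mulrA ler_pM2l// distrC.
  by apply: ler_pM => //; rewrite (le_trans (coord_le_enorm _ _))// lerDl.
have -> : phi (z + t *: h) - phi z = \sum_(i < d)
    (phi (z + t *: hh i.+1) - phi (z + t *: hh i)).
  rewrite -(big_mkord xpredT (fun i => phi (z + t *: hh i.+1) - phi (z + t *: hh i))).
  by rewrite telescope_sumr// hhd hh0 scaler0 addr0.
rewrite mulr_sumr -sumrB (le_trans (ler_norm_sum _ _ _))//.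
apply: (@le_trans _ _ (\sum_(i < d) t * (enorm h + 1) * e1)).
  by apply: ler_sum => i _; rewrite mxE [X in t * X]mulrC; exact: step.
rewrite sumr_const card_ord -mulr_natl.
have -> : e = e1 * (enorm h + 1) * d.+1%:R.
  by rewrite /e1 -mulrA divfK// gt_eqF// mulr_gt0// ltr_wpDl.
rewrite -natr1; have : 0 <= t * (enorm h + 1) * e1.
  by rewrite mulr_ge0 ?(ltW e10)// mulr_ge0 ?(ltW t0)// addr_ge0.
by move: (d%:R : R) => m; lra.
Qed.

End DirectionalExpansion.

(** * Inner normals *)

Section Normal.
Context {R : realType} {d : nat} (D : set 'rV[R]_d).
Context (C2D : C2_domain D) (bndD : bounded_set D) (cvxD : convex_set D).
Implicit Types (p q v w z : 'rV[R]_d) (e t r : R).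

Let openD : open D. Proof. by case: C2D. Qed.
Let D_neq0 : D !=set0. Proof. by case: C2D. Qed.

(** The normal described by supporting half-spaces, without defining functions. These conditions are
    closed in the pair [(z, v)], which makes the graph of the normal compact. *)
Definition inner_unit_normal z v : Prop :=
  [/\ boundary D z, enorm v = 1 & forall w, closure D w -> 0 <= dot (w - z) v].

Lemma boundaryE z : boundary D z <-> closure D z /\ ~ D z.
Proof. by rewrite /boundary (interior_id D).1. Qed.

(** Since [phi] vanishes at [z], its first-order expansion relates the sign of
    [dot (gradient phi z) v] to membership of [z + t *: v] in [D] for small [t]; convexity makes the
    first conclusion global. *)
Lemma defining_function_support z U phi : boundary D z ->
  local_defining_function D z U phi ->
  (forall w, closure D w -> 0 <= dot (gradient phi z) (w - z)) /\
  (forall v, 0 < dot (gradient phi z) v ->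
     exists2 t, 0 < t & D (z + t *: v)).
Proof.
move=> /boundaryE[Cz nDz] [oU C2 _ DU]; have [openU Uz] := oU.
have DUw w : U w -> D w <-> 0 < phi w.
  move=> Uw; have h : (D `&` U) w = ([set w | 0 < phi w] `&` U) w by rewrite DU.
  split=> [Dw|pw]; first by have : (D `&` U) w by []; rewrite h => -[].
  by have : ([set w | 0 < phi w] `&` U) w by []; rewrite -h => -[].
have [r1 r10 hU] : exists2 r1, 0 < r1 & forall w, enorm (w - z) <= r1 -> U w.
  by apply/nbhs_enorm; exact: open_nbhs_nbhs.
have phiz0 : phi z <= 0 by rewrite leNgt; apply/negP => /(DUw _ Uz).2.
have phiz : 0 <= phi z.
  rewrite leNgt; apply/negP => phin.
  have [C2c _] := C2; have /cvgrPdist_le /(_ (- phi z)) := C2c z (mem_set Uz).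
  rewrite oppr_gt0 => /(_ phin) /nbhs_enorm[r2 r20 h2].
  have r12 : 0 < Num.min r1 r2 by rewrite lt_min r10.
  have [q Dq zq] := (closure_enorm _ _).1 Cz _ r12.
  have Uq : U q by apply: hU; rewrite enormB (le_trans zq)// ge_min lexx.
  have := h2 q; rewrite enormB (le_trans zq) ?ge_min ?lexx ?orbT// => /(_ isT).
  move=> /ler_normlP[h _]; have := (DUw _ Uq).1 Dq.
  by move: h; lra.
have smallU v : exists2 r, 0 < r & forall t, 0 < t <= r -> U (z + t *: v).
  exists (r1 / (enorm v + 1)); first by rewrite divr_gt0// ltr_wpDl.
  move=> t /andP[t0]; rewrite ler_pdivlMr ?ltr_wpDl// => tr; apply: hU.
  rewrite addrAC subrr add0r enormZ gtr0_norm//; lra.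
split=> [|v gv]; last first.
  have e0 : 0 < dot (gradient phi z) v / 2 by rewrite divr_gt0.
  have [r r0 h] := directional_expansion v oU C2 e0.
  have [r' r'0 hU'] := smallU v.
  pose t := Num.min r r'; have t0 : 0 < t by rewrite lt_min r0.
  exists t => //; apply/DUw; first by apply: hU'; rewrite t0 ge_min lexx orbT.
  have := h t; rewrite t0 ge_min lexx => /(_ isT) /ler_normlP[h1 _].
  by have := mulr_gt0 e0 t0; lra.
suff hD w : D w -> 0 <= dot (gradient phi z) (w - z).
  move=> w Cw; apply/ler_addgt0Pr => e e0.
  have e1 : 0 < e / (enorm (gradient phi z) + 1) by rewrite divr_gt0// ltr_wpDl.
  have [q /hD Dq wq] := (closure_enorm _ _).1 Cw _ e1.
  have := cauchy_schwarz (gradient phi z) (q - w); rewrite enormB.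
  have := ler_wpM2l (enorm_ge0 (gradient phi z)) wq.
  have : (enorm (gradient phi z) + 1) * (e / (enorm (gradient phi z) + 1)) = e.
    by rewrite mulrC divfK// gt_eqF// ltr_wpDl.
  move: Dq; rewrite !dotE; lra.
(* If the product were negative, [phi] would be negative at [z + t *: (w - z)] for small [t],
   although [seg_interior] puts this point in [D]. *)
move=> Dw; rewrite leNgt; apply/negP => gw.
have e0 : 0 < - dot (gradient phi z) (w - z) / 2 by rewrite divr_gt0// oppr_gt0.
have [r r0 h] := directional_expansion (w - z) oU C2 e0.
have [r' r'0 hU'] := smallU (w - z).
pose t := Num.min 1 (Num.min r r').
have t0 : 0 < t by rewrite !lt_min r0 r'0 ltr01.
have Dt : D (z + t *: (w - z)).
  by apply: seg_interior => //; rewrite t0 ge_min lexx.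
have Ut : U (z + t *: (w - z)) by apply: hU'; rewrite t0 !ge_min lexx !orbT.
have := (DUw _ Ut).1 Dt; have := h t.
rewrite t0 !ge_min lexx !orbT => /(_ isT) /ler_normlP[_ h1].
by have := mulr_gt0 e0 t0; lra.
Qed.

(** If the normalized gradient [u] differed from [v], the direction [u - v] would have a positive
    product with [u], hence enter [D], but a negative product with [v]. *)
Lemma inner_unit_normal_unique z U phi v :
  local_defining_function D z U phi -> inner_unit_normal z v ->
  v = (enorm (gradient phi z))^-1 *: gradient phi z.
Proof.
move=> ldf [bz v1 hv]; have [_ hG] := defining_function_support bz ldf.
have G0 : 0 < enorm (gradient phi z).
  by apply: enorm_gt0; case: ldf => [[_ Uz]] _ /(_ _ Uz).
set u := _ *: _; have u1 : enorm u = 1.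
  by rewrite enormZ gtr0_norm ?invr_gt0// mulVf// gt_eqF.
have Gu : gradient phi z = enorm (gradient phi z) *: u.
  by rewrite scalerA divff ?scale1r// gt_eqF.
apply/eqP; rewrite -subr_eq0; apply/eqP/enorm_eq0/eqP.
rewrite -sqrf_eq0 sqr_enorm eq_le dot_ge0 andbT.
have uu : dot u u = 1 by rewrite -sqr_enorm u1 expr1n.
have vv : dot v v = 1 by rewrite -sqr_enorm v1 expr1n.
suff : 1 <= dot u v by move: uu vv; clearbody u; rewrite !dotE (dotC v u); lra.
rewrite leNgt; apply/negP => uv.
have [|t t0 Dt] := hG (u - v).
  by rewrite Gu dotZl mulr_gt0//; move: uu uv; clearbody u; rewrite !dotE; lra.
have := hv _ (subset_closure Dt); rewrite addrAC subrr add0r dotZl.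
by rewrite pmulr_rge0//; move: vv uv; clearbody u; rewrite !dotE; lra.
Qed.

Lemma normal_inner z : boundary D z -> inner_unit_normal z (normal D z).
Proof.
move=> bz; case: (C2D) => _ _ _ /(_ z bz)[U [phi ldf]].
rewrite /normal; case: xgetP => [v _ [_ [U' [phi' [ldf' ->]]]]|/(_ _)]; last first.
  by move=> /(_ _ (conj bz (ex_intro _ U (ex_intro _ phi (conj ldf erefl))))).
have G0 : 0 < enorm (gradient phi' z).
  by apply: enorm_gt0; case: ldf' => [[_ Uz]] _ /(_ _ Uz).
split=> //; first by rewrite enormZ gtr0_norm ?invr_gt0// mulVf// gt_eqF.
move=> w Cw; rewrite dotC dotZl mulr_ge0 ?invr_ge0//.
by have [h _] := defining_function_support bz ldf'; exact: h.
Qed.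

Lemma normal_unique z v : inner_unit_normal z v -> v = normal D z.
Proof.
move=> hv; have [bz _ _] := hv.
case: (C2D) => _ _ _ /(_ z bz)[U [phi ldf]].
by rewrite (inner_unit_normal_unique ldf hv)
  (inner_unit_normal_unique ldf (normal_inner bz)).
Qed.

Lemma normal_off z : ~ boundary D z -> normal D z = 0.
Proof. by move=> bz; rewrite /normal; case: xgetP => // v _ [/bz]. Qed.

Lemma enorm_normal_le1 z : enorm (normal D z) <= 1.
Proof.
have [/normal_inner[_ -> _]//|/normal_off ->] := pselect (boundary D z).
by rewrite enorm0.
Qed.

Lemma dot_normal_ge0 w z : closure D w -> 0 <= dot (w - z) (normal D z).
Proof.
move=> Cw; have [/normal_inner[_ _ ->]//|/normal_off ->] := pselect (boundary D z).
by rewrite dot0r.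
Qed.

(** Valid for every [z]: on [closure D] both sides vanish, whatever the value of the normal. *)
Lemma proj_normal z : proj D z - z = enorm (z - proj D z) *: normal D (proj D z).
Proof.
have [Cz|Cz] := pselect (closure D z).
  by rewrite (proj_id D_neq0 bndD cvxD Cz) subrr enorm0 scale0r.
have bz := proj_boundary openD D_neq0 bndD cvxD Cz.
have v0 : 0 < enorm (z - proj D z).
  apply: enorm_gt0; apply: contra_notN Cz; rewrite subr_eq0 => /eqP ->.
  by have [] := bz.
rewrite -(@normal_unique (proj D z) ((enorm (z - proj D z))^-1 *: (proj D z - z))).
  by rewrite scalerA divff ?scale1r// gt_eqF.
split=> //; first by rewrite enormZ (enormB (proj D z)) gtr0_norm ?invr_gt0// mulVf// gt_eqF.
move=> w /(proj_var D_neq0 bndD cvxD z) h.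
rewrite dotZr mulr_ge0 ?invr_ge0// dotC -opprB dotNl oppr_ge0; exact: h.
Qed.

Lemma proj_ray z r : closure D z -> 0 <= r -> proj D (z - r *: normal D z) = z.
Proof.
move=> Cz r0; apply: (proj_unique D_neq0 bndD cvxD) => // q Cq.
rewrite addrAC subrr add0r dotNl dotZl oppr_le0 mulr_ge0// dotC.
exact: dot_normal_ge0.
Qed.

Lemma boundary_proj z : z != proj D z -> boundary D (proj D z).
Proof.
move=> zp; apply: (proj_boundary openD D_neq0 bndD cvxD) => Cz.
by rewrite (proj_id D_neq0 bndD cvxD Cz) eqxx in zp.
Qed.

Lemma dot_normal_ball a r z : (forall w, enorm (w - a) <= r -> D w) -> 0 <= r ->
  boundary D z -> r <= dot (a - z) (normal D z).
Proof.
move=> hr r0 /normal_inner[_ n1 hn].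
have /hn : closure D (a - r *: normal D z).
  apply: subset_closure; apply: hr.
  by rewrite addrAC subrr add0r enormN enormZ n1 mulr1 ger0_norm.
have : dot (normal D z) (normal D z) = 1 by rewrite -sqr_enorm n1 expr1n.
by rewrite addrAC !dotE => ->; rewrite !mulr1; lra.
Qed.

Lemma inner_unit_normal_compact :
  compact [set p : 'rV[R]_d * 'rV[R]_d | inner_unit_normal p.1 p.2].
Proof.
have [M M0 hM] := bounded_closureD bndD.
have cB : compact [set v : 'rV[R]_d | enorm v <= 1].
  apply: bounded_closed_compact.
    exists 1; split; first exact: num_real.
    move=> N /ltW N1 v /= v1; rewrite (le_trans (norm_le_enorm _))//.
    exact: le_trans v1 N1.
  rewrite (_ : [set _ | _] = @enorm R d @^-1` [set x | x <= 1])//.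
  by apply: preimage_closed => [v _|]; [exact: enorm_continuous|exact: closed_le].
apply: (subclosed_compact _ (compact_setX (compact_closureD bndD) cB)); last first.
  by move=> [z v] [/= [Cz _] v1 _]; split => //=; rewrite v1.
have c1 : continuous (fun p : 'rV[R]_d * 'rV[R]_d => p.1) by move=> p; exact: cvg_fst.
have c2 : continuous (fun p : 'rV[R]_d * 'rV[R]_d => p.2) by move=> p; exact: cvg_snd.
rewrite (_ : [set _ | _] = (fst @^-1` boundary D) `&`
  ((fun x : 'rV[R]_d * 'rV[R]_d => enorm x.2) @^-1` [set 1]) `&`
  \bigcap_(w in closure D) ((fun x : 'rV[R]_d * 'rV[R]_d => dot (w - x.1) x.2) @^-1` [set x | 0 <= x])).
  apply: closedI; first apply: closedI.
  - apply: preimage_closed => [p _|]; first exact: c1.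
    apply: closedI; first exact: closed_closure.
    by apply: open_closedC; exact: open_interior.
  - apply: preimage_closed => [p _|]; last exact: closed_eq.
    exact: (cvg_enorm (c2 p)).
  - apply: closed_bigI => w _; apply: preimage_closed => [p _|]; last exact: closed_ge.
    apply: (@cvg_dot _ _ _ (nbhs p)); last exact: c2.
    by apply: cvgB; [exact: cvg_cst|exact: c1].
apply/seteqP; split => -[z v] /=; first by move=> [? ? ?].
by move=> [[? ?] ?].
Qed.

(** On the compact set [S] of pairs of graph points whose normals differ by at least [e], the
    distance of the base points attains its minimum; it is positive because equal base points have
    equal normals. Half of it serves as radius. *)
Lemma normal_unif_continuous e : 0 < e -> exists2 r, 0 < r &
  forall z z', boundary D z -> boundary D z' -> enorm (z - z') <= r ->
    enorm (normal D z - normal D z') <= e.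
Proof.
move=> e0; pose G := [set p : 'rV[R]_d * 'rV[R]_d | inner_unit_normal p.1 p.2].
pose S := (G `*` G) `&` [set q | e <= enorm (q.1.2 - q.2.2)].
have cS : compact S.
  apply: compact_closedI.
    exact: compact_setX inner_unit_normal_compact inner_unit_normal_compact.
  rewrite (_ : [set _ | _] = (fun q : ('rV[R]_d * 'rV[R]_d) * ('rV[R]_d * 'rV[R]_d)
    => enorm (q.1.2 - q.2.2)) @^-1` [set x | e <= x])//.
  apply: preimage_closed => [p _|]; last exact: closed_ge.
  apply: (@cvg_enorm _ _ _ (nbhs p)); apply: cvgB.
    by apply: (cvg_comp fst snd); [exact: cvg_fst|exact: cvg_snd].
  by apply: (cvg_comp snd snd); [exact: cvg_snd|exact: cvg_snd].
have [S0|/nonemptyPn S0] := pselect (S !=set0); last first.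
  exists 1 => // z z' bz bz' _; rewrite leNgt; apply/negP => /ltW h.
  suff : S ((z, normal D z), (z', normal D z')) by rewrite S0.
  by split => //; split; exact: normal_inner.
have cf : {within S, continuous (fun x : ('rV[R]_d * 'rV[R]_d) * ('rV[R]_d * 'rV[R]_d) => enorm (x.1.1 - x.2.1))}.
  apply: continuous_subspaceT => p.
  apply: (@cvg_enorm _ _ _ (nbhs p)); apply: cvgB.
    by apply: (cvg_comp fst fst); [exact: cvg_fst|exact: cvg_fst].
  by apply: (cvg_comp snd fst); [exact: cvg_snd|exact: cvg_fst].
have [[[z v] [z' v']]] := compact_EVT_min S0 cS cf.
rewrite inE => -[[nz0 nz'0] evv] hmin.
have nz : inner_unit_normal z v by [].
have nz' : inner_unit_normal z' v' by [].
have zz : 0 < enorm (z - z').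
  apply: enorm_gt0; rewrite subr_eq0; apply: contra_ltN e0 => /eqP zz.
  rewrite (le_trans evv)// (normal_unique nz) (normal_unique nz') zz subrr.
  by rewrite enorm0.
exists (enorm (z - z') / 2); first by rewrite divr_gt0.
move=> w w' bw bw' ww; rewrite leNgt; apply/negP => /ltW h.
have Sw : S ((w, normal D w), (w', normal D w')).
  by split => //; split; exact: normal_inner.
by have /= := hmin _ (mem_set Sw); lra.
Qed.

End Normal.

(** * Penalized equation with small noise *)

Section PenalizedLink.
Context {R : realType} {d : nat} (D : set 'rV[R]_d).
Context (C2D : C2_domain D) (bndD : bounded_set D) (cvxD : convex_set D).

Let D_neq0 : D !=set0. Proof. by case: C2D. Qed.
Let P_in z : closure D (proj D z). Proof. exact: proj_in. Qed.
Let P_var z q : closure D q -> dot (z - proj D z) (q - proj D z) <= 0.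
Proof. exact: proj_var. Qed.
Let P_lip z w : enorm (proj D z - proj D w) <= enorm (z - w).
Proof. exact: proj_lip. Qed.

Lemma proj_segment z (t : R) : 0 <= t -> proj D (proj D z + t *: (z - proj D z)) = proj D z.
Proof.
move=> t0; apply: (proj_unique D_neq0 bndD cvxD) => // q Cq.
by rewrite addrAC subrr add0r dotZl mulr_ge0_le0// P_var.
Qed.

Lemma rderiv_is_derive (f : R -> R) (u l : R) : is_derive u 1 f l -> rderiv f u l.
Proof.
move=> [df <-]; have h : h^-1 *: ((f \o shift u) (h *: 1) - f u) @[h --> 0^'] --> 'D_1 f u.
  exact: df.
apply/cvgrPdist_le => e e0; have /cvgrPdist_le /(_ e e0) := h.
move=> [r /= r0 hr]; exists r => //= v; rewrite /ball_/= => uv u_lt_v.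
have := hr (v - u); rewrite /= sub0r normrN distrC => /(_ uv).
rewrite subr_eq0 gt_eqF// => /(_ isT).
by rewrite /GRing.scale/= mulr1 subrK mulrC.
Qed.

(** [c] stands for the penalization parameter and [A] for the accumulated variation of [k]. *)
Context (c s s' : R) (x k : R -> 'rV[R]_d) (A : R -> R).
Context (c0 : 0 < c) (ss' : s <= s').
Let p u := proj D (x u).
Let rho u := enorm (x u - p u).
Context (hk : vprim s s' k (fun u => c *: (p u - x u)))
        (hA : rprim s s' A (fun u => c * rho u)).
(* [v] is the path of the link with the noise removed. *)
Context (v : R -> 'rV[R]_d) (hv : forall u, v u = x s + (k u - k s)).
Context (e : R) (he : forall u, s <= u < s' -> enorm (x u - v u) <= e).

Let vprim_v : vprim s s' v (fun u => c *: (p u - x u)).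
Proof.
have -> : v = (fun u => k u + (x s - k s)).
  by apply/funext => u; rewrite hv addrCA.
exact: vprim_shift hk.
Qed.

Lemma enorm_increment_le a b : s <= a -> a <= b -> b <= s' ->
  enorm (k b - k a) <= A b - A a.
Proof.
move=> sa ab bs'; apply: (vprim_le ab (vprimS sa bs' hk) (rprimS sa bs' hA)).
by move=> u _; rewrite enormZ enormB gtr0_norm.
Qed.

Lemma increment_ge0 a b : s <= a -> a <= b -> b <= s' -> 0 <= A b - A a.
Proof. by move=> *; apply: le_trans (enorm_ge0 _) _; exact: enorm_increment_le. Qed.

Let dist_prim z : rprim s s' (fun u => dot (v u - z) (v u - z))
  (fun u => 2 * dot (v u - z) (c *: (p u - x u))).
Proof. exact: rprim_sqr (vprim_shift (- z) vprim_v). Qed.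

Let noise u : s <= u < s' -> dot (x u - v u) (x u - p u) <= e * rho u.
Proof. by move=> hu; apply: dot_le => //; exact: he. Qed.

(** By [proj_ball] the squared distance to [q] would decrease at rate [2 * r * (c * rho)]; the
    noise, at most [r / 2], destroys no more than half of it. *)
Lemma mass_decrease q r a b : (forall w, enorm (w - q) <= r -> D w) ->
  0 <= r -> e <= r / 2 -> s <= a -> a <= b -> b <= s' ->
  dot (v b - q) (v b - q) + r * (A b - A a) <= dot (v a - q) (v a - q).
Proof.
move=> hr r0 er sa ab bs'.
have := rprim_le2 ab (rprimS sa bs' (rprimD (dist_prim q) (rprimZ r hA)))
  (rprim_cst a b 0).
rewrite subrr => h; suff : dot (v b - q) (v b - q) + r * A b -
  (dot (v a - q) (v a - q) + r * A a) <= 0 by lra.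
apply: h => u /andP[au ub]; have hu : s <= u < s'.
  by rewrite (le_trans sa)// (lt_le_trans ub).
have h1 := proj_ball D_neq0 bndD cvxD (x u) hr r0; rewrite -/(p u) -/(rho u) in h1.
have h2 := noise hu.
have h3 : dot (v u - q) (p u - x u) <= - (r / 2) * rho u.
  have -> : dot (v u - q) (p u - x u) = dot (x u - v u) (x u - p u) -
      dot (x u - p u) (p u - q) - dot (x u - p u) (x u - p u).
    by dot_ring.
  have := dot_ge0 (x u - p u); have := ler_wpM2r (enorm_ge0 (x u - p u)) er.
  by rewrite -/(rho u); lra.
rewrite dotZr; have := ler_wpM2l (ltW c0) h3; lra.
Qed.

(** Without noise the flow does not increase the distance to any point of [closure D]; only the
    noise term [2 * e] times the variation remains. *)
Lemma dist_increase z a b : closure D z -> s <= a -> a <= b -> b <= s' ->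
  dot (v b - z) (v b - z) <= dot (v a - z) (v a - z) + 2 * e * (A b - A a).
Proof.
move=> Cz sa ab bs'.
have := rprim_le2 ab (rprimS sa bs' (dist_prim z)) (rprimS sa bs' (rprimZ (2 * e) hA)).
move=> h; suff : dot (v b - z) (v b - z) - dot (v a - z) (v a - z) <=
  2 * e * A b - 2 * e * A a by lra.
apply: h => u /andP[au ub]; have hu : s <= u < s'.
  by rewrite (le_trans sa)// (lt_le_trans ub).
have h2 := noise hu; have h1 := P_var (x u) Cz; rewrite -/(p u) in h1.
have h3 : dot (v u - z) (p u - x u) <= e * rho u.
  have -> : dot (v u - z) (p u - x u) = dot (x u - v u) (x u - p u) +
      dot (x u - p u) (z - p u) - dot (x u - p u) (x u - p u).
    by dot_ring.
  by have := dot_ge0 (x u - p u); lra.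
rewrite dotZr; have := ler_wpM2l (ltW c0) h3; lra.
Qed.

(* Without noise the equation would be solved by this exponential relaxation
   along the segment from [x s] to its projection. *)
Let W u := p s + expR (- c * (u - s)) *: (x s - p s).

Let vprim_W : vprim s s' W (fun u => c *: (p s - W u)).
Proof.
move=> i; under eq_fun do rewrite /W !mxE mulrC.
have E : rprim s s' (fun u => expR (- c * (u - s))) (fun u => - c * expR (- c * (u - s))).
  have der (u : R) : is_derive u 1 (fun u => expR (- c * (u - s))) (- c * expR (- c * (u - s))).
    have h1 : is_derive u (1 : R) (fun u : R => - c * (u - s)) (- c).
      rewrite (_ : (fun _ => _) = (- c) *: (id - cst s) :> (R -> R))//.
      by apply: is_derive_eq; rewrite subr0 /GRing.scale/= mulr1.
    have := @is_derive1_comp R expR (fun u : R => - c * (u - s)) u _ _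
      (is_derive_expR _) h1.
    by rewrite mulrC.
  split=> u _; first exact: rderiv_is_derive.
  apply: cvg_at_left_filter.
  have [/derivable1_diffP df _] := der u.
  exact: (differentiable_continuous df).
apply: eq_rprim (rprimD (rprim_cst s s' (p s 0 i)) (rprimZ (x s 0 i - p s 0 i) E)) => u _.
by rewrite /W !mxE; ring.
Qed.

Let proj_W u : proj D (W u) = p s.
Proof. by apply: proj_segment; exact: expR_ge0. Qed.

(** The displacement [z - proj D z] is firmly nonexpansive too. For the difference [q] of the
    displacements of [x] and [W] this leaves [e * |q| - |q|^2], which is at most [e ^+ 2 / 4], in
    the derivative of the squared distance. *)
Lemma relaxation u : s <= u <= s' ->
  dot (v u - W u) (v u - W u) <= c * e ^+ 2 / 2 * (u - s).
Proof.
move=> /andP[su us'].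
have hd := rprim_sqr (vprimB vprim_v vprim_W).
have := rprim_le2 su (rprimS (lexx s) us' hd)
  (rprimS (lexx s) us' (rprimZ (c * e ^+ 2 / 2) (rprim_id s s'))).
move=> h; have v0 : v s - W s = 0.
  by rewrite hv /W !subrr mulr0 expR0 scale1r addr0 addrCA subrr addr0 subrr.
suff : dot (v u - W u) (v u - W u) - dot (v s - W s) (v s - W s) <=
   c * e ^+ 2 / 2 * u - c * e ^+ 2 / 2 * s by rewrite v0 dot0l; lra.
apply: h => t /andP[st tu]; have ht : s <= t < s' by rewrite st (lt_le_trans tu).
rewrite -scalerBr dotZr mulr1.
have h1 := proj_mono D_neq0 bndD cvxD (x t) (W t); rewrite proj_W -/(p t) in h1.
set q := (x t - p t) - (W t - p s).
have -> : p t - x t - (p s - W t) = - q by rewrite /q; apply/rowP => i; rewrite !mxE; ring.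
have h2 : dot q q <= dot (x t - W t) q.
  rewrite -subr_ge0; move: h1; rewrite -subr_ge0; congr (0 <= _).
  by rewrite /q; move: (x t) (p t) (p s) (W t) => x1 p1 p0 w1; dot_ring.
have h3 : dot (x t - v t) q <= e * enorm q by apply: dot_le => //; exact: he.
have h4 : dot (v t - W t) (- q) = dot (x t - v t) q - dot (x t - W t) q.
  by clearbody q; dot_ring.
rewrite h4; rewrite -sqr_enorm in h2.
have h5 : 2 * (dot (x t - v t) q - dot (x t - W t) q) <= e ^+ 2 / 2.
  have : 0 <= (enorm q - e / 2) ^+ 2 by rewrite sqr_ge0.
  by move: h2 h3; move: (enorm q) (dot _ q) (dot _ q) => b1 b2 b3; nra.
have := ler_wpM2l (ltW c0) h5; lra.
Qed.

Context (theta B M : R) (theta0 : 0 < theta) (theta1 : theta <= 1)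
  (he2 : e = theta ^+ 2) (hB : rho s <= B) (hM : A s' - A s <= M).
Let K := 2 + B + 2 * M.
(** The length balances two requirements: it is short enough for the noise [e = theta ^+ 2] to move
    [v] away from [W] by at most [theta], and long enough for the exponential factor, [expR] of
    minus the inverse of [theta ^+ 2], to fall below [theta]. *)
Let u0 := s + (c * theta ^+ 2)^-1.

Let M0 : 0 <= M. Proof. by rewrite (le_trans _ hM)// increment_ge0. Qed.
Let B0 : 0 <= B. Proof. by rewrite (le_trans _ hB)// /rho. Qed.

Let e_theta : e <= theta.
Proof. by rewrite he2 expr2 ger_pMr. Qed.

Let early u : s <= u -> u <= s' -> u <= u0 -> enorm (v u - W u) <= theta.
Proof.
move=> su us' uu0; rewrite enorm_leP; last exact: ltW.
have /relaxation h : s <= u <= s' by rewrite su.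
apply: (le_trans h); have ct : 0 < c * theta ^+ 2 by rewrite mulr_gt0// exprn_gt0.
have : c * theta ^+ 2 * (u - s) <= 1.
  by rewrite mulrC -ler_pdivlMr// mul1r lerBlDl.
have t2 : 0 <= theta ^+ 2 by rewrite exprn_ge0// ltW.
by move/(ler_wpM2r t2); rewrite he2; lra.
Qed.

(** At [u0] the distance is at most [(1 + B) * theta]; afterwards [dist_increase], applied at the
    point [p s] of [closure D], adds at most [2 * theta ^+ 2 * M] to its square. The last unit in
    [K] is spent on the noise in [late_path]. *)
Lemma late_dist u : u0 <= u -> u <= s' -> enorm (v u - p s) <= (K - 1) * theta.
Proof.
move=> u0u us'.
have su0 : s <= u0 by rewrite lerDl invr_ge0 mulr_ge0 ?exprn_ge0// ltW.
have h0 : enorm (v u0 - p s) <= theta * (1 + B).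
  rewrite (le_trans (ler_enorm_dist (W u0) _ _))// mulrDr mulr1 lerD//.
    exact: early (le_trans u0u us') (lexx _).
  rewrite /W addrAC subrr add0r enormZ ger0_norm ?expR_ge0//.
  apply: ler_pM => //.
  rewrite /u0 addrAC subrr add0r invfM mulrA mulNr divff ?gt_eqF// mulN1r expRN.
  rewrite invf_ple ?posrE ?expR_gt0//.
  apply: (@le_trans _ _ (theta ^+ 2)^-1); last first.
    by rewrite (le_trans _ (expR_ge1Dx _))// lerDr.
  rewrite lef_pV2 ?posrE ?exprn_gt0//; by rewrite expr2 ger_pMr.
have h1 := dist_increase (@P_in (x s)) su0 u0u us'; rewrite -/(p s) in h1.
have hM' : A u - A u0 <= M.
  have := increment_ge0 (lexx s) su0 (le_trans u0u us').
  have := increment_ge0 (le_trans su0 u0u) us' (lexx s').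
  by move: hM; lra.
have h2 : dot (v u0 - p s) (v u0 - p s) <= (theta * (1 + B)) ^+ 2.
  by rewrite -enorm_leP// mulr_ge0 ?(ltW theta0)// addr_ge0.
rewrite enorm_leP; last by rewrite mulr_ge0 ?(ltW theta0)// /K; have := M0; have := B0; lra.
have e0 : 0 <= 2 * e by rewrite he2 mulr_ge0// exprn_ge0// ltW.
have h3 : 2 * e * (A u - A u0) <= 2 * theta ^+ 2 * M.
  by rewrite -he2; exact: ler_wpM2l.
apply: (le_trans h1); apply: (le_trans (lerD h2 h3)).
have -> : (K - 1) * theta = theta * (1 + B) + theta * (2 * M) by rewrite /K; ring.
have t2 : 0 <= theta ^+ 2 by rewrite exprn_ge0// ltW.
have := mulr_ge0 t2 M0; have := mulr_ge0 (mulr_ge0 t2 M0) B0.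
have := mulr_ge0 (mulr_ge0 t2 M0) M0; lra.
Qed.

Lemma late_path u : u0 <= u -> u < s' -> enorm (x u - p s) <= K * theta.
Proof.
move=> u0u us'; rewrite (le_trans (ler_enorm_dist (v u) _ _))//.
have su0 : s <= u0 by rewrite lerDl invr_ge0 mulr_ge0 ?exprn_ge0// ltW.
have := late_dist u0u (ltW us'); have : enorm (x u - v u) <= e.
  by apply: he; rewrite us' (le_trans su0).
by have := e_theta; lra.
Qed.

(** Up to [u0] the path is close to [W], whose projection is constantly [p s]; later it is close to
    [p s] itself. *)
Lemma proj_oscillation u : s <= u < s' -> enorm (p u - p s) <= K * theta.
Proof.
move=> hu; have /andP[su us'] := hu; have [u0u|/ltW uu0] := leP u0 u.
  rewrite -[p s](proj_id D_neq0 bndD cvxD (@P_in (x s))).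
  by rewrite (le_trans (P_lip _ _))// late_path.
rewrite -(proj_W u) (le_trans (P_lip _ _))//.
rewrite (le_trans (ler_enorm_dist (v u) _ _))//.
have := early su (ltW us') uu0; have := he hu; have := e_theta.
have : 0 <= theta * (B + 2 * M) by rewrite mulr_ge0 ?(ltW theta0)// addr_ge0// mulr_ge0.
by rewrite /K; lra.
Qed.

(** At time [u] the push is normal at [p u], where the variational inequality gives the sign;
    freezing that point at [p s] costs the oscillation of the projection. *)
Lemma normal_pairing z a b : closure D z -> s <= a -> a <= b -> b <= s' ->
  dot (p s - z) (k b - k a) <= K * theta * (A b - A a).
Proof.
move=> Cz sa ab bs'; rewrite dotDr dotNr mulrBr.
apply: (rprim_le2 ab (rprimS sa bs' (rprim_dotl (p s - z) hk))
  (rprimS sa bs' (rprimZ (K * theta) hA))) => u /andP[au ub].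
have hu : s <= u < s' by rewrite (le_trans sa)// (lt_le_trans ub).
have h1 := P_var (x u) Cz; rewrite -/(p u) in h1.
have h2 : dot (p u - p s) (x u - p u) <= K * theta * rho u.
  by apply: dot_le => //; exact: proj_oscillation.
have -> : dot (p s - z) (c *: (p u - x u)) =
  c * (dot (p u - p s) (x u - p u) + dot (x u - p u) (z - p u)).
  by move: (p s) (p u) (x u) => p0 p1 x1; dot_ring.
have h3 : dot (p u - p s) (x u - p u) + dot (x u - p u) (z - p u) <= K * theta * rho u by lra.
have := ler_wpM2l (ltW c0) h3; lra.
Qed.

End PenalizedLink.

(** * Motion along a nearly constant normal *)

Section DirectedLink.
Context {R : realType} {d : nat} (D : set 'rV[R]_d).
Context (C2D : C2_domain D) (bndD : bounded_set D) (cvxD : convex_set D).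
Context (c s s' : R) (x k : R -> 'rV[R]_d) (A : R -> R).
Context (c0 : 0 < c) (ss' : s <= s').
Let p u := proj D (x u).
Let rho u := enorm (x u - p u).
Context (hk : vprim s s' k (fun u => c *: (p u - x u)))
        (hA : rprim s s' A (fun u => c * rho u)).
Context (nu : 'rV[R]_d) (w : R) (nu1 : enorm nu = 1) (w0 : 0 <= w)
  (hnu : forall u, s <= u < s' -> x u != p u ->
     enorm (normal D (p u) - nu) <= w).
Let N u := normal D (p u).

Let velocity u : c *: (p u - x u) = (c * rho u) *: N u.
Proof. by rewrite (proj_normal C2D bndD cvxD) scalerA. Qed.

Let at_rest u : x u = p u -> c * rho u = 0.
Proof. by rewrite /rho => <-; rewrite subrr enorm0 mulr0. Qed.

Let speed_ge0 u : 0 <= c * rho u.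
Proof. exact: mulr_ge0 (ltW c0) (enorm_ge0 _). Qed.

Let dot_nu u : s <= u < s' -> x u != p u -> `|dot nu (N u) - 1| <= w.
Proof.
move=> hu xp; have [_ n1 _] := normal_inner C2D cvxD (boundary_proj C2D bndD cvxD xp).
have -> : dot nu (N u) - 1 = - dot (N u - nu) (N u).
  by rewrite -[1](expr1n _ 2) -n1 sqr_enorm -/(N u); dot_ring.
rewrite normrN (le_trans (cauchy_schwarz_norm _ _))// n1 mulr1; exact: hnu.
Qed.

(** Orthogonally to [nu] the velocity is at most [2 * w] times the speed: one [w] comes from
    [N - nu], the other from [dot nu N - 1]. *)
Lemma straight_displacement u : s <= u <= s' ->
  enorm (k u - k s - dot nu (k u - k s) *: nu) <= 2 * w * (A u - A s).
Proof.
move=> /andP[su us'].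
have hv : vprim s u (fun u => k u - dot nu (k u) *: nu)
    (fun u => c *: (p u - x u) - dot nu (c *: (p u - x u)) *: nu).
  apply: vprimB; first exact: vprimS hk.
  move=> i; apply: (@eq_rprim _ _ _ _ (fun u => nu 0 i * dot nu (c *: (p u - x u)))).
    by move=> t _; rewrite !mxE mulrC.
  under eq_fun do rewrite mxE mulrC.
  exact: rprimZ (rprimS (lexx _) us' (rprim_dotl nu hk)).
have := vprim_le su hv (rprimS (lexx _) us' (rprimZ (2 * w) hA)).
rewrite -mulrBr (_ : k u - _ - _ = k u - k s - dot nu (k u - k s) *: nu); last first.
  by rewrite !dotE; apply/rowP => i; rewrite !mxE; ring.
apply=> t /andP[st tu]; have ht : s <= t < s' by rewrite st (lt_le_trans tu).
rewrite velocity dotZr -[(c * rho t * _) *: nu]scalerA -scalerBr enormZ ger0_norm//.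
have [xp|xp] := eqVneq (x t) (p t); first by rewrite at_rest// !mul0r mulr0.
rewrite [leRHS]mulrC ler_wpM2l//.
have -> : N t - dot nu (N t) *: nu = (N t - nu) - (dot nu (N t) - 1) *: nu.
  by apply/rowP => i; rewrite !mxE; ring.
rewrite (le_trans (ler_enormB _ _))// enormZ nu1 mulr1.
by have := hnu ht xp; have := dot_nu ht xp; rewrite -/(N t); lra.
Qed.

Lemma directed_ge0 u : w <= 1 -> s <= u <= s' -> 0 <= dot nu (k u - k s).
Proof.
move=> w1 /andP[su us'].
have hcc := rprim_dotl nu (vprimS (lexx s) us' hk).
have := rprim_le2 su (rprim_cst s u 0) hcc _.
rewrite subrr dotDr dotNr; apply=> t /andP[st tu].
have ht : s <= t < s' by rewrite st (lt_le_trans tu).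
rewrite velocity dotZr; have [xp|xp] := eqVneq (x t) (p t).
  by rewrite at_rest// mul0r.
rewrite mulr_ge0//; have := dot_nu ht xp; rewrite ler_norml -/(N t); lra.
Qed.

(** With speed [c * rho], the right derivatives of [H] and of [Gam] along the displacement are [gg]
    and [G * dot nu N] times the speed. Their difference is [kap] from the integrands and [Gm * w]
    from the angle. *)
Lemma functional_along_direction (H gg G Gam : R -> R) (kap Gm : R) :
  rprim s s' H (fun u => gg u * (c * rho u)) ->
  (forall u, s <= u <= s' -> forall e, 0 < e ->
     \forall r \near dot nu (k u - k s),
       `|Gam r - Gam (dot nu (k u - k s))
         - G (dot nu (k u - k s)) * (r - dot nu (k u - k s))|
       <= e * `|r - dot nu (k u - k s)|) ->
  (forall u, s <= u < s' -> `|gg u - G (dot nu (k u - k s))| <= kap) ->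
  (forall u, s <= u < s' -> `|G (dot nu (k u - k s))| <= Gm) ->
  `|H s' - H s - (Gam (dot nu (k s' - k s)) - Gam 0)|
    <= (kap + Gm * w) * (A s' - A s).
Proof.
move=> hH hGam hkap hGm; pose cc u := dot nu (k u - k s).
have ccs : cc s = 0 by rewrite /cc subrr dot0r.
have hcc : rprim s s' cc (fun u => dot nu (c *: (p u - x u))).
  by apply: rprim_dotl; exact: vprim_shift hk.
have hG : rprim s s' (Gam \o cc) (fun u => G (cc u) * dot nu (c *: (p u - x u))).
  split=> u hu.
    apply: rderiv_comp; first by case: hcc => + _; apply.
    by apply: hGam; case/andP: hu => -> /ltW.
  have cu : cc v @[v --> u^'-] --> cc u by case: hcc => _; apply.
  apply: (cvg_comp cc Gam cu).
  apply/cvgrPdist_le => e e0.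
  have hu' : s <= u <= s' by case/andP: hu => /ltW ->.
  have e1 : 0 < e / (`|G (cc u)| + 1) by rewrite divr_gt0// ltr_wpDl.
  have [] := (@cvgrPdist_le _ _ _ (nbhs (cc u)) _ id (cc u)); move=> /(_ cvg_id) /(_ _ e1) h1 _.
  near=> r.
  have h2 : `|Gam r - Gam (cc u) - G (cc u) * (r - cc u)| <= 1 * `|r - cc u|.
    by near: r; exact: hGam.
  have h3 : `|cc u - r| <= e / (`|G (cc u)| + 1) by near: r; exact: h1.
  rewrite distrC -(subrK (G (cc u) * (r - cc u)) (_ - _)) (le_trans (ler_normD _ _))//.
  rewrite normrM; rewrite distrC ler_pdivlMr ?ltr_wpDl// in h3; lra.
have main t : s <= t < s' -> `|gg t * (c * rho t) - G (cc t) * dot nu (c *: (p t - x t))|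
    <= (kap + Gm * w) * (c * rho t).
  move=> ht; rewrite velocity dotZr.
  have -> : gg t * (c * rho t) - G (cc t) * (c * rho t * dot nu (N t)) =
    c * rho t * (gg t - G (cc t) * dot nu (N t)) by ring.
  rewrite normrM ger0_norm//.
  have [xp|xp] := eqVneq (x t) (p t); first by rewrite at_rest// !mul0r mulr0.
  rewrite [leRHS]mulrC ler_wpM2l//.
  have -> : gg t - G (cc t) * dot nu (N t) =
     (gg t - G (cc t)) - G (cc t) * (dot nu (N t) - 1) by ring.
  rewrite (le_trans (ler_normB _ _))// normrM lerD//; first exact: hkap.
  by apply: ler_pM => //; [exact: hGm|exact: dot_nu].
have hd := rprimB hH hG; have hr := rprimZ (kap + Gm * w) hA.
apply/ler_normlP; split; last first.
  have := rprim_le2 ss' hd hr (fun t ht => le_trans (ler_norm _) (main t ht)).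
  by rewrite /= ccs -/(cc s') -mulrBr; lra.
have := rprim_le2 ss' (rprimZ (-1) hd) hr _.
rewrite /= ccs -/(cc s') -!mulrBr => h; apply: le_trans (h _); first lra.
move=> t ht; rewrite mulN1r (le_trans _ (main t ht))// -normrN ler_norm//.
Unshelve. all: by end_near. Qed.

End DirectedLink.

(** * Partitions adapted to right-continuous paths *)

Section Chains.
Context {R : realType}.
Implicit Types (P : R -> R -> Prop) (a b c t T : R).

(** A finite partition as an inductive predicate: estimates on links are summed by induction,
    without naming the division points. *)
Inductive chain P a : R -> Prop :=
| chain_nil : chain P a a
| chain_rcons b c : chain P a b -> b < c -> P b c -> chain P a c.

Lemma chain_le P a b : chain P a b -> a <= b.
Proof. by elim=> // {}b c _ ab bc _; rewrite (le_trans ab)// ltW. Qed.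

(** Compactness of [[a, T]] as a supremum argument: the condition on the left of [t] reaches the
    supremum of the attainable points, the one on the right passes beyond it. *)
Lemma chain_exists P a T : a <= T ->
  (forall t, a <= t < T -> exists2 r, 0 < r & forall b, t < b < t + r -> P t b) ->
  (forall t, a < t <= T -> exists2 r, 0 < r & forall u, a <= u -> t - r < u < t -> P u t) ->
  chain P a T.
Proof.
move=> aT hr hl; pose S := [set t | t <= T /\ chain P a t].
have Sa : S a by split => //; exact: chain_nil.
have Sb : ubound S T by move=> t [].
have supS : has_sup S by split; [exists a|exists T].
pose s := sup S; have sT : s <= T by apply: ge_sup => //; exists a.
have as_ : a <= s by apply: ub_le_sup => //; exists T.
have Ss : chain P a s.
  move: as_; rewrite le_eqVlt => /predU1P[<-|as_]; first exact: chain_nil.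
  have [r r0 h] := hl s (introT andP (conj as_ sT)).
  have [t [tT ct] st] := sup_adherent r0 supS; rewrite -/s in st.
  have ts : t <= s by apply: ub_le_sup => //; exists T.
  move: ts; rewrite le_eqVlt => /predU1P[ts|ts]; first by rewrite -ts.
  apply: (chain_rcons ct ts _); apply: h; first exact: chain_le ct.
  by rewrite st.
move: sT; rewrite le_eqVlt => /predU1P[<-//|sT].
have [r r0 h] := hr s (introT andP (conj as_ sT)).
pose t := Num.min T (s + r / 2).
have st : s < t by rewrite lt_min sT ltrDl divr_gt0.
have : t <= s.
  apply: ub_le_sup; first by exists T.
  split; first by rewrite ge_min lexx.
  apply: (chain_rcons Ss st _); apply: h; rewrite st/= gt_min ltrD2l.
  by rewrite ltr_pdivrMr// ltr_pMr// ltr1n orbT.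
by rewrite leNgt st.
Qed.

End Chains.

(** * Oscillation of cadlag paths *)

Section Cadlag.
Context {R : realType} {d : nat}.
Implicit Types (f x y : R -> 'rV[R]_d) (a b e t u T : R).

Lemma nbhs_rightP (t : R) (A : set R) : (\forall u \near t^'+, A u) <->
  exists2 r, 0 < r & forall u, t < u < t + r -> A u.
Proof.
split=> [[r /= r0 h]|[r r0 h]].
  exists r => // u /andP[tu ur]; apply: h => //=.
  by rewrite /ball_/= distrC gtr0_norm ?subr_gt0// ltrBlDl.
exists r => //= u; rewrite /ball_/= => ur tu; apply: h; rewrite tu/=.
by move: ur; rewrite distrC gtr0_norm ?subr_gt0// ltrBlDl.
Qed.

Lemma nbhs_leftP (t : R) (A : set R) : (\forall u \near t^'-, A u) <->
  exists2 r, 0 < r & forall u, t - r < u < t -> A u.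
Proof.
split=> [[r /= r0 h]|[r r0 h]].
  exists r => // u /andP[tu ur]; apply: h => //=.
  by rewrite /ball_/= gtr0_norm ?subr_gt0// ltrBlDl -ltrBlDr.
exists r => //= u; rewrite /ball_/= => ur tu; apply: h; rewrite tu/= andbT.
by move: ur; rewrite gtr0_norm ?subr_gt0// ltrBlDl -ltrBlDr.
Qed.

Lemma cadlag_right f e t : cadlag f -> 0 < e -> 0 <= t ->
  exists2 r, 0 < r & forall u, t <= u < t + r -> enorm (f u - f t) <= e.
Proof.
move=> [fr _] e0 t0; have /enorm_cvg /(_ e e0) /nbhs_rightP [r r0 h] := fr t t0.
exists r => // u /andP[]; rewrite le_eqVlt => /predU1P[<- _|tu ur].
  by rewrite subrr enorm0 ltW.
by apply: h; rewrite tu.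
Qed.

Lemma cadlag_left f e t : cadlag f -> 0 < e -> 0 < t ->
  exists2 r, 0 < r & forall u, t - r < u < t ->
    enorm (f u - lim (f v @[v --> t^'-])) <= e.
Proof.
move=> [_ fl] e0 t0; have /enorm_cvg /(_ e e0) := fl t t0.
by move/nbhs_leftP.
Qed.

Lemma cadlag_left2 f e t : cadlag f -> 0 < e -> 0 < t ->
  exists2 r, 0 < r & forall u v, t - r < u < t -> t - r < v < t ->
    enorm (f u - f v) <= e.
Proof.
move=> cf e0 t0; have [|r r0 h] := @cadlag_left f (e / 2) t cf _ t0.
  by rewrite divr_gt0.
exists r => // u v /h hu /h hv.
rewrite (le_trans (ler_enorm_dist (lim (f v @[v --> t^'-])) _ _))//.
by rewrite (enormB _ (f v)); lra.
Qed.

(* [b] is excluded, so that [f] may jump there. *)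
Definition steady e f a b := forall u, a <= u < b -> enorm (f u - f a) <= e.

Definition link e y x a b := [/\ b - a <= e, steady e y a b & steady e x a b].

Lemma link_right e y x t : cadlag y -> cadlag x -> 0 < e -> 0 <= t ->
  exists2 r, 0 < r & forall b, t < b < t + r -> link e y x t b.
Proof.
move=> cy cx e0 t0.
have [r1 r10 h1] := cadlag_right cy e0 t0; have [r2 r20 h2] := cadlag_right cx e0 t0.
exists (Num.min e (Num.min r1 r2)); first by rewrite !lt_min e0 r10.
move=> b /andP[tb]; rewrite -ltrBlDl !lt_min => /and3P[be b1 b2].
split=> [|u /andP[tu ub]|u /andP[tu ub]]; first exact: ltW.
  by apply: h1; rewrite tu -ltrBlDl (lt_trans _ b1)// ltrD2r.
by apply: h2; rewrite tu -ltrBlDl (lt_trans _ b2)// ltrD2r.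
Qed.

Lemma link_left e y x t : cadlag y -> cadlag x -> 0 < e -> 0 < t ->
  exists2 r, 0 < r & forall u, t - r < u < t -> link e y x u t.
Proof.
move=> cy cx e0 t0.
have [r1 r10 h1] := cadlag_left2 cy e0 t0; have [r2 r20 h2] := cadlag_left2 cx e0 t0.
exists (Num.min e (Num.min r1 r2)); first by rewrite !lt_min e0 r10.
move=> u /andP[+ ut]; rewrite ltrBlDr -ltrBlDl !lt_min => /and3P[be b1 b2].
split=> [|v /andP[uv vt]|v /andP[uv vt]]; first exact: ltW.
  by apply: h1; rewrite ?ut ?vt andbT ltrBlDr -ltrBlDl// (le_lt_trans _ b1)// lerD2l lerN2.
by apply: h2; rewrite ?ut ?vt andbT ltrBlDr -ltrBlDl// (le_lt_trans _ b2)// lerD2l lerN2.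
Qed.

Lemma link_chain e y x a T : cadlag y -> cadlag x -> 0 < e -> 0 <= a -> a <= T ->
  chain (link e y x) a T.
Proof.
move=> cy cx e0 a0 aT; apply: chain_exists => // t /andP[ht tT].
  by apply: link_right => //; exact: le_trans ht.
have [|r r0 h] := @link_left e y x t cy cx e0; first exact: le_lt_trans ht.
by exists r => // u _; exact: h.
Qed.

Lemma cadlag_bounded f T : cadlag f -> 0 <= T ->
  exists2 M, 0 < M & forall t, 0 <= t <= T -> enorm (f t) <= M.
Proof.
move=> cf T0.
have : exists2 M, 0 < M & forall t, 0 <= t < T -> enorm (f t) <= M.
  elim: (link_chain cf cf ltr01 (lexx 0) T0) => [|b c cb [M M0 hM] bc [_ fb _]].
    by exists 1 => // t /andP[t0 /(le_lt_trans t0)]; rewrite ltxx.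
  exists (Num.max M (enorm (f b) + 1)); first by rewrite lt_max M0.
  move=> t /andP[t0 tc]; rewrite le_max; have [bt|tb] := leP b t.
    apply/orP; right; rewrite -(subrK (f b) (f t)) addrC.
    by rewrite (le_trans (ler_enormD _ _))// lerD// fb// bt.
  by rewrite hM// t0.
move=> [M M0 hM]; exists (Num.max M (enorm (f T))); first by rewrite lt_max M0.
move=> t /andP[t0]; rewrite le_eqVlt le_max => /predU1P[->|tT].
  by rewrite lexx orbT.
by rewrite hM// t0.
Qed.

End Cadlag.

(** * Integrals of bounded functions *)

Section BoundedIntegral.
Context {R : realType}.
Notation TR := (measurableTypeR R).
Context (mu : {measure set TR -> \bar R}).
Implicit Types (A B : set TR) (h : TR -> R) (c e M : R).

(** A sufficient condition for integrability that, unlike integrability itself, is preserved by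
    products. *)
Definition bounded_on A h :=
  [/\ measurable A, (mu A < +oo)%E, measurable_fun A h &
      exists M, forall t, A t -> `|h t| <= M].

Lemma bounded_on_integrable A h : bounded_on A h -> mu.-integrable A (EFin \o h).
Proof.
move=> [mA fA mh [M hM]]; apply: measurable_bounded_integrable => //.
exists M; split; first exact: num_real.
by move=> N /ltW MN t At; exact: le_trans (hM _ At) MN.
Qed.

Lemma bounded_on_cst A c : measurable A -> (mu A < +oo)%E -> bounded_on A (fun=> c).
Proof. by move=> mA fA; split => //; exists `|c|. Qed.

Lemma bounded_onD A h h' : bounded_on A h -> bounded_on A h' ->
  bounded_on A (fun t => h t + h' t).
Proof.
move=> [mA fA mh [M hM]] [_ _ mh' [M' hM']]; split => //; first exact: measurable_funD.
by exists (M + M') => t At; rewrite (le_trans (ler_normD _ _))// lerD ?hM ?hM'.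
Qed.

Lemma bounded_onM A h h' : bounded_on A h -> bounded_on A h' ->
  bounded_on A (fun t => h t * h' t).
Proof.
move=> [mA fA mh [M hM]] [_ _ mh' [M' hM']]; split => //; first exact: measurable_funM.
by exists (M * M') => t At; rewrite normrM ler_pM ?hM ?hM'.
Qed.

Lemma bounded_onZ A c h : bounded_on A h -> bounded_on A (fun t => c * h t).
Proof. by move=> hA; apply: bounded_onM => //; case: hA => *; exact: bounded_on_cst. Qed.

Lemma bounded_on_sum (I : Type) (r : seq I) A (h : I -> TR -> R) :
  measurable A -> (mu A < +oo)%E ->
  (forall i, bounded_on A (h i)) -> bounded_on A (fun t => \sum_(i <- r) h i t).
Proof.
move=> mA fA hA; elim: r => [|i r IH].
  by under eq_fun do rewrite big_nil; exact: bounded_on_cst.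
by under eq_fun do rewrite big_cons; exact: bounded_onD.
Qed.

Lemma Rintegral_sum (I : Type) (r : seq I) A (h : I -> TR -> R) :
  measurable A -> (mu A < +oo)%E -> (forall i, bounded_on A (h i)) ->
  \int[mu]_(t in A) (\sum_(i <- r) h i t) = \sum_(i <- r) \int[mu]_(t in A) h i t.
Proof.
move=> mA fA hA; elim: r => [|i r IH].
  under eq_Rintegral do rewrite big_nil.
  by rewrite Rintegral_cst// mul0r big_nil.
under eq_Rintegral do rewrite big_cons.
rewrite RintegralD ?big_cons ?IH//; apply: bounded_on_integrable => //.
exact: bounded_on_sum.
Qed.

Definition mass A : R := fine (mu A).

Lemma mass_ge0 A : 0 <= mass A. Proof. exact: fine_ge0. Qed.

Lemma Rintegral_mono A h h' : bounded_on A h -> bounded_on A h' ->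
  (forall t, A t -> h t <= h' t) ->
  \int[mu]_(t in A) h t <= \int[mu]_(t in A) h' t.
Proof.
move=> hA h'A le_h; have [mA _ _ _] := hA.
by apply: le_Rintegral => //; exact: bounded_on_integrable.
Qed.

Lemma Rintegral_le_mass A h c : bounded_on A h -> (forall t, A t -> h t <= c) ->
  \int[mu]_(t in A) h t <= c * mass A.
Proof.
move=> hA hc; have [mA fA _ _] := hA; rewrite -[leRHS]Rintegral_cst//.
by apply: Rintegral_mono => //; exact: bounded_on_cst.
Qed.

Lemma Rintegral_ge_mass A h c : bounded_on A h -> (forall t, A t -> c <= h t) ->
  c * mass A <= \int[mu]_(t in A) h t.
Proof.
move=> hA hc; have [mA fA _ _] := hA; rewrite -[leLHS]Rintegral_cst//.
by apply: Rintegral_mono => //; exact: bounded_on_cst.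
Qed.

Lemma Rintegral_close A h c e : bounded_on A h ->
  (forall t, A t -> `|h t - c| <= e) ->
  `|\int[mu]_(t in A) h t - c * mass A| <= e * mass A.
Proof.
move=> hA hc; apply/ler_normlP; split.
  have := @Rintegral_ge_mass A h (c - e) hA _; rewrite mulrBl => H.
  have := H (fun t At => ltac:(have /ler_normlP[? ?] := hc t At; lra)); lra.
have := @Rintegral_le_mass A h (c + e) hA _; rewrite mulrDl => H.
have := H (fun t At => ltac:(have /ler_normlP[? ?] := hc t At; lra)); lra.
Qed.

Lemma Rintegral_norm_le A h e : bounded_on A h -> (forall t, A t -> `|h t| <= e) ->
  `|\int[mu]_(t in A) h t| <= e * mass A.
Proof.
move=> hA he; have := @Rintegral_close A h 0 e hA _.
by rewrite mul0r subr0; apply => t At; rewrite subr0; exact: he.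
Qed.

Lemma Rintegral_disjoint A B h : bounded_on (A `|` B) h -> measurable A -> measurable B ->
  A `&` B = set0 ->
  \int[mu]_(t in A `|` B) h t = \int[mu]_(t in A) h t + \int[mu]_(t in B) h t.
Proof.
move=> hAB mA mB AB; apply: Rintegral_setU => //; first exact: bounded_on_integrable.
by apply/disj_setPS; rewrite AB.
Qed.

Lemma mass_disjoint A B : measurable A -> measurable B -> (mu (A `|` B) < +oo)%E ->
  A `&` B = set0 -> mass (A `|` B) = mass A + mass B.
Proof.
move=> mA mB fAB AB; rewrite -[LHS]mul1r -Rintegral_cst; last exact: measurableU.
rewrite Rintegral_disjoint//; last by apply: bounded_on_cst => //; exact: measurableU.
by rewrite !Rintegral_cst// !mul1r.
Qed.

End BoundedIntegral.

(** * Primitives of right-continuous functions *)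

Section RightContinuous.
Context {R : realType}.
Notation TR := (measurableTypeR R).
Implicit Types (h : R -> R).

Definition right_cont h := forall t, 0 <= t -> h s @[s --> t^'+] --> h t.

(* [h] is the limit of the step functions taking the value of [h] at the right
   end of dyadic-like cells. *)
Lemma measurable_right_cont h : right_cont h ->
  measurable_fun (`[0, +oo[%classic : set TR) (h : TR -> R).
Proof.
move=> hr; pose st (n : nat) (t : R) : R := (Num.truncn (n.+1%:R * t)).+1%:R / n.+1%:R.
apply: (@measurable_fun_cvg _ _ _ _ (fun n (t : TR) => h (st n t))) => [n|t].
  move=> mD B mB.
  rewrite (_ : _ `&` _ = \bigcup_(m in [set m : nat | B (h (m.+1%:R / n.+1%:R))])
     `[m%:R / n.+1%:R, m.+1%:R / n.+1%:R[%classic); last first.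
    apply/seteqP; split=> [t /= [t0 Bt]|t [m /= Bm]].
      rewrite in_itv/= andbT in t0.
      exists (Num.truncn (n.+1%:R * t)) => //=; rewrite in_itv/=.
      rewrite ler_pdivrMr// ltr_pdivlMr// ![t * _]mulrC.
      have := @truncn_itv R (n.+1%:R * t); rewrite mulr_ge0//; exact.
    rewrite in_itv/= => /andP[m1 m2]; split.
      by rewrite /= in_itv/= andbT (le_trans _ m1)// divr_ge0.
    rewrite /= /st (_ : Num.truncn _ = m)//; apply/eqP; rewrite truncn_eq.
      by rewrite mulrC -ler_pdivrMr// -ltr_pdivlMr// m1.
    by rewrite mulr_ge0// (le_trans _ m1)// divr_ge0.
  by apply: bigcup_measurable => m _; exact: measurable_itv.
rewrite /= in_itv/= andbT => t0.
have ht : h s @[s --> t^'+] --> h t by exact: hr.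
apply: cvg_trans ht => A /nbhs_rightP[r r0 hA].
suff : \forall n \near \oo, A (h (st n t)) by [].
near=> n; apply: (hA (st n t)).
have := @truncn_itv R (n.+1%:R * t); rewrite mulr_ge0// => /(_ isT) /andP[h1 h2].
rewrite /st; apply/andP; split; first by rewrite ltr_pdivlMr// mulrC.
rewrite ltr_pdivrMr// -natr1.
have : 1 < r * n.+1%:R.
  rewrite -ltr_pdivrMl// mulr1; near: n.
  exists (Num.truncn r^-1) => // n /= rn; apply: (lt_le_trans (truncnS_gt _)).
  by rewrite ler_nat.
lra.
Unshelve. all: by end_near. Qed.

Lemma right_cont_bounded_on (mu : {measure set TR -> \bar R}) (A : set TR) h T :
  right_cont h -> measurable A -> (mu A < +oo)%E ->
  A `<=` `[0, T] -> (exists M, forall t, 0 <= t <= T -> `|h t| <= M) ->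
  bounded_on mu A h.
Proof.
move=> hr mA fA AT [M hM]; split => //.
  apply: (measurable_funS _ _ (measurable_right_cont hr)) => //.
  by move=> t /AT /=; rewrite !in_itv/= => /andP[->].
by exists M => t /AT /=; rewrite in_itv/= => /hM.
Qed.

Context (mu : {measure set TR -> \bar R}) (m : R -> R) (T : R).
Context (T0 : 0 <= T)
  (mum : forall a b, 0 <= a -> a <= b -> b <= T -> mu `]a, b]%classic = (m b - m a)%:E).
Context (h : R -> R) (hr : right_cont h)
  (hM : exists M, forall t, 0 <= t <= T -> `|h t| <= M).

Definition primitive t := \int[mu]_(s in `]0, t]) h s.

Lemma bounded_on_itvoc a b : 0 <= a -> a <= b -> b <= T -> bounded_on mu `]a, b] h.
Proof.
move=> a0 ab bT; apply: right_cont_bounded_on hM => //; rewrite ?mum ?ltry//.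
move=> t /=; rewrite !in_itv/= => /andP[at_ tb].
by rewrite (le_trans tb)// (le_trans a0)// ltW.
Qed.

Lemma mass_itvoc a b : 0 <= a -> a <= b -> b <= T -> mass mu `]a, b] = m b - m a.
Proof. by move=> *; rewrite /mass mum. Qed.

Lemma primitiveB a b : 0 <= a -> a <= b -> b <= T ->
  primitive b - primitive a = \int[mu]_(s in `]a, b]) h s.
Proof.
move=> a0 ab bT; rewrite /primitive.
have E : `]0, b]%classic = `]0, a] `|` `]a, b] :> set TR.
  by apply: itv_bndbnd_setU; rewrite bnd_simp.
rewrite E Rintegral_disjoint//.
- by rewrite addrC addKr.
- by rewrite -E; apply: bounded_on_itvoc => //; exact: le_trans ab.
- apply/seteqP; split => // t [/=]; rewrite !in_itv/= => /andP[_ ta] /andP[at_ _].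
  by have := lt_le_trans at_ ta; rewrite ltxx.
Qed.

(** Differentiation through the distribution function [m], without a density: just after [u] the
    integrand is almost [h u] and the mass almost [m' u * (v - u)]. It serves both for Lebesgue
    measure ([m = id]) and for the variation measure of [kn]. *)
Lemma rprim_primitive b m' : b <= T -> rprim 0 b m m' ->
  rprim 0 b primitive (fun t => h t * m' t).
Proof.
move=> bT [m1 m2]; have [M hM'] := hM; split=> u /andP[u0 ub].
  apply/rderivP => e e0.
  (* [e1] controls the integrand and [e2] the mass, each for a share [e / 2]; the minimum with 1
     gives the mass bound [(|m' u| + 1) * (v - u)] used with [e1]. *)
  pose e1 := e / (2 * (`|m' u| + 1)); pose e2 := Num.min 1 (e / (2 * (`|h u| + 1))).
  have e10 : 0 < e1 by rewrite divr_gt0// mulr_gt0// ltr_wpDl.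
  have e20 : 0 < e2 by rewrite lt_min ltr01 divr_gt0// mulr_gt0// ltr_wpDl.
  have /(rderivP _ _ _).1 /(_ _ e20) /nbhs_rightP [r1 r10 h1] := m1 u (introT andP (conj u0 ub)).
  have /cvgrPdist_le /(_ _ e10) /nbhs_rightP [r2 r20 h2] := hr u0.
  apply/nbhs_rightP; exists (Num.min (b - u) (Num.min r1 r2)).
    by rewrite !lt_min subr_gt0 ub r10.
  move=> v /andP[uv]; rewrite -ltrBlDl !lt_min => /and3P[vb vr1 vr2].
  have vb' : v <= b by lra.
  have vT := le_trans vb' bT.
  rewrite primitiveB// ?(ltW uv)//.
  have hb := bounded_on_itvoc u0 (ltW uv) vT.
  have close : `|\int[mu]_(s in `]u, v]) h s - h u * mass mu `]u, v]|
      <= e1 * mass mu `]u, v].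
    apply: Rintegral_close => // t; rewrite /= in_itv/= => /andP[ut tv].
    by rewrite distrC; apply: h2; rewrite ut/=; lra.
  rewrite mass_itvoc// ?(ltW uv)// in close.
  have hm := h1 v _; rewrite uv/= in hm.
  have {}hm : `|m v - m u - m' u * (v - u)| <= e2 * (v - u) by apply: hm; lra.
  have vu : 0 < v - u by lra.
  have mle : m v - m u <= (`|m' u| + 1) * (v - u).
    have /ler_normlP[_ hm1] := hm.
    have := ler_wpM2r (ltW vu) (ler_norm (m' u)).
    have : e2 * (v - u) <= 1 * (v - u) by rewrite ler_pM2r// ge_min lexx.
    lra.
  have -> : \int[mu]_(s in `]u, v]) h s - h u * m' u * (v - u) =
    (\int[mu]_(s in `]u, v]) h s - h u * (m v - m u)) +
    h u * (m v - m u - m' u * (v - u)) by ring.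
  rewrite (le_trans (ler_normD _ _))// normrM.
  have p1 : e1 * (m v - m u) <= e / 2 * (v - u).
    have := ler_wpM2l (ltW e10) mle; rewrite mulrA.
    have -> // : e1 * (`|m' u| + 1) = e / 2.
      by rewrite /e1 invfM mulrA divfK// gt_eqF// ltr_wpDl.
  have p2 : `|h u| * `|m v - m u - m' u * (v - u)| <= e / 2 * (v - u).
    apply: (@le_trans _ _ ((`|h u| + 1) * (e2 * (v - u)))).
      by apply: ler_pM => //; rewrite lerDl.
    rewrite mulrA ler_pM2r//.
    apply: (@le_trans _ _ ((`|h u| + 1) * (e / (2 * (`|h u| + 1))))).
      by rewrite ler_pM2l ?ltr_wpDl// ge_min lexx orbT.
    have X1 : `|h u| + 1 != 0 by rewrite gt_eqF// ltr_wpDl.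
    by rewrite le_eqVlt; apply/orP; left; apply/eqP; field.
  lra.
apply/cvgrPdist_le => e e0.
have e1 : 0 < e / (`|M| + 1) by rewrite divr_gt0// ltr_wpDl.
have /cvgrPdist_le /(_ _ e1) /nbhs_leftP [r r0 h1] := m2 u (introT andP (conj u0 ub)).
apply/nbhs_leftP; exists (Num.min r u); first by rewrite lt_min r0.
move=> v /andP[]; rewrite ltrBlDr -ltrBlDl lt_min => /andP[vr v0] vu.
have v0' : 0 <= v by lra.
have uT := le_trans ub bT.
rewrite primitiveB// ?(ltW vu)//.
have hb := bounded_on_itvoc v0' (ltW vu) uT.
have : `|\int[mu]_(s in `]v, u]) h s| <= `|M| * mass mu `]v, u].
  apply: Rintegral_norm_le => // t; rewrite /= in_itv/= => /andP[vt tu].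
  by rewrite (le_trans (hM' t _)) ?ler_norm//; lra.
move/le_trans; apply; rewrite mass_itvoc// ?(ltW vu)//.
have /ler_normlP[_] : `|m u - m v| <= e / (`|M| + 1) by apply: h1; rewrite vu andbT; lra.
rewrite ler_pdivlMr ?ltr_wpDl//.
have : 0 <= m u - m v by rewrite -mass_itvoc// ?(ltW vu)// mass_ge0.
have := normr_ge0 M; nra.
Qed.

End RightContinuous.

(** * Variation measures *)

Section Stieltjes.
Context {R : realType}.
Notation TR := (measurableTypeR R).
Implicit Types (F : R -> R) (a b : R).

Lemma stieltjes_itvoc F a b : nondecreasing F -> right_continuous F -> a <= b ->
  stieltjes F `]a, b]%classic = (F b - F a)%:E.
Proof.
move=> ndF rcF ab; rewrite /stieltjes; case: pselect => [H|]; last by case.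
rewrite /= /lebesgue_stieltjes_measure/= /measure_extension measurable_mu_extE/=; last first.
  exact: is_ocitv.
by rewrite wlength_itv_bnd.
Qed.

Lemma stieltjes_default F : ~ (nondecreasing F /\ right_continuous F) ->
  stieltjes F = mzero.
Proof. by move=> h; rewrite /stieltjes; case: pselect. Qed.

End Stieltjes.

(** * Total variation under a dominating cumulative function *)

Section TotalVariation.
Context {R : realType} {d : nat}.
Implicit Types (k : R -> 'rV[R]_d) (a b t u v : R) (s : seq R).

Lemma evariation_nil a b k : evariation a b k [::] = 0.
Proof. by rewrite /evariation big_geq. Qed.

Lemma evariation_cons a b k t s :
  evariation a b k (t :: s) = enorm (k t - k a) + evariation t b k s.
Proof. by rewrite /evariation/= big_nat_recl. Qed.

Lemma itv_partition_consP a b t s :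
  itv_partition a b (t :: s) <-> a < t /\ itv_partition t b s.
Proof.
split=> [|[at_ [pt lb]]]; first by case=> /= /andP[at_ pt] lb.
by split => //=; rewrite at_.
Qed.

Lemma evariations_neg t k : t < 0 -> evariations 0 t k = set0.
Proof.
move=> t0; apply/seteqP; split => // r [s /itv_partition_le].
by rewrite leNgt t0.
Qed.

Lemma tvar_neg t k : t < 0 -> tvar k t = 0.
Proof. by move=> t0; rewrite /tvar evariations_neg// sup0. Qed.

Context (k : R -> 'rV[R]_d) (A : R -> R).
Context (hA : forall u v, 0 <= u -> u <= v -> enorm (k v - k u) <= A v - A u).

Lemma evariation_le a b s : 0 <= a -> itv_partition a b s ->
  evariation a b k s <= A b - A a.
Proof.
elim: s a => [|t s IH] a a0.
  by move=> /itv_partition_nil ->; rewrite evariation_nil subrr.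
move=> /itv_partition_consP[at_ hs]; rewrite evariation_cons.
have := hA a0 (ltW at_); have := IH t (le_trans a0 (ltW at_)) hs; lra.
Qed.

(** The partition is cut at [c]; the cell containing [c] is handled by the triangle inequality, and
    everything beyond [c] is dominated by [A]. *)
Lemma evariation_split a b c s : 0 <= a -> a <= c -> c <= b -> itv_partition a b s ->
  exists2 s', itv_partition a c s' &
    evariation a b k s <= evariation a c k s' + (A b - A c).
Proof.
elim: s a => [|t s IH] a a0 ac cb.
  move=> hs; have ab := itv_partition_nil hs.
  have ca : c = a by apply/eqP; rewrite eq_le ac andbT ab.
  exists [::]; first by split => //=; rewrite ca.
  by rewrite !evariation_nil ca ab subrr addr0.
move=> /itv_partition_consP[at_ hs]; have t0 := le_trans a0 (ltW at_).
rewrite evariation_cons; have [tc|ct] := leP t c.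
  have [s' hs' h] := IH t t0 tc cb hs.
  exists (t :: s'); first exact/itv_partition_consP.
  by rewrite evariation_cons -addrA lerD2l.
have h1 := evariation_le t0 hs; have c0 := le_trans a0 ac.
have h2 := hA c0 (ltW ct).
move: ac; rewrite le_eqVlt => /predU1P[ac|ac].
  exists [::]; first by split => //=; rewrite ac.
  by rewrite evariation_nil ac; lra.
exists [:: c]; first by split => //=; rewrite ac.
have := ler_enorm_dist (k c) (k t) (k a).
by rewrite evariation_cons evariation_nil; lra.
Qed.

Let evar_sup t : 0 <= t -> has_sup (evariations 0 t k).
Proof.
move=> t0; split.
  move: t0; rewrite le_eqVlt => /predU1P[<-|t0].
    by exists (evariation 0 0 k [::]); exists [::] => //; split => //=.
  by exists (evariation 0 t k [:: t]); exists [:: t] => //; split => //=; rewrite ?t0.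
by exists (A t - A 0) => _ [s hs <-]; exact: evariation_le.
Qed.

Lemma tvarB_ge u v : 0 <= u -> u <= v -> enorm (k v - k u) <= tvar k v - tvar k u.
Proof.
move=> u0; rewrite le_eqVlt => /predU1P[<-|uv]; first by rewrite !subrr enorm0.
rewrite lerBrDr addrC -lerBrDr; apply: ge_sup; first by case: (evar_sup u0).
move=> _ [s hs <-]; rewrite lerBrDr.
apply: ub_le_sup; first by case: (evar_sup (le_trans u0 (ltW uv))).
exists (rcons s v).
  case: hs => ps /eqP ls; split; last by rewrite last_rcons.
  by rewrite rcons_path ps ls.
elim: s (0 : R) hs => [|t s IH] a.
  by move=> /itv_partition_nil ->; rewrite evariation_cons !evariation_nil addr0 add0r.
move=> /itv_partition_consP[_ /IH h].
by rewrite rcons_cons !evariation_cons h addrA.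
Qed.

Lemma tvarB_le u v : 0 <= u -> u <= v -> tvar k v - tvar k u <= A v - A u.
Proof.
move=> u0 uv; rewrite lerBlDr; apply: ge_sup.
  by case: (evar_sup (le_trans u0 uv)).
move=> _ [s hs <-]; have [s' hs' h] := evariation_split (lexx 0) u0 uv hs.
rewrite addrC (le_trans h)// lerD2r; apply: ub_le_sup.
  by case: (evar_sup u0).
by exists s'.
Qed.

Lemma tvar_nondecreasing : nondecreasing (tvar k).
Proof.
have tv0 t : 0 <= t -> 0 <= tvar k t.
  move=> t0; have [[r [s hs _]] ub] := evar_sup t0.
  apply: (@le_trans _ _ (evariation 0 t k s)).
    by rewrite /evariation sumr_ge0.
  by apply: ub_le_sup => //; exists s.
move=> u v uv; have [u0|u0] := leP 0 u.
  by rewrite -subr_ge0 (le_trans _ (tvarB_ge u0 uv)).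
rewrite (tvar_neg _ u0); have [v0|v0] := leP 0 v; first exact: tv0.
by rewrite tvar_neg.
Qed.

Lemma tvar_right_continuous : (forall t, 0 <= t -> A u @[u --> t^'+] --> A t) ->
  right_continuous (tvar k).
Proof.
move=> hc t; have [t0|t0] := leP 0 t.
  apply/cvgrPdist_le => e e0.
  have /cvgrPdist_le /(_ _ e0) h := hc t t0; near=> u.
  have tu : t <= u by near: u; exact: nbhs_right_ge.
  have h1 := tvarB_le t0 tu; have h2 := tvarB_ge t0 tu.
  have : `|A t - A u| <= e by near: u; exact: h.
  rewrite !ler_norml; have := enorm_ge0 (k u - k t); lra.
apply: (@cvg_trans _ ((fun=> tvar k t) @ t^'+)); last exact: cvg_cst.
apply: near_eq_cvg.
near=> u; rewrite !tvar_neg//; near: u; exact: nbhs_right_lt.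
Unshelve. all: by end_near. Qed.

(** A squeeze: increments of [tvar k] lie between [enorm (k v - k u)] and those of [A]. Both have
    right derivative [enorm (k' u)], the lower one by testing against the direction [q] of
    [k' u]. *)
Lemma rprim_tvar b k' : vprim 0 b k k' -> rprim 0 b A (fun u => enorm (k' u)) ->
  rprim 0 b (tvar k) (fun u => enorm (k' u)).
Proof.
move=> hk [a1 a2]; split=> u hu.
  apply/rderivP => e e0; have u0 : 0 <= u by case/andP: hu.
  have /(rderivP _ _ _).1 /(_ _ e0) h1 := a1 u hu.
  have [q q1 qk] : exists2 q, enorm q <= 1 & dot q (k' u) = enorm (k' u).
    have [k0|k0] := eqVneq (k' u) 0.
      by exists 0; rewrite ?enorm0// k0 dot0l enorm0.
    have nk := enorm_gt0 k0; exists ((enorm (k' u))^-1 *: k' u).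
      by rewrite enormZ gtr0_norm ?invr_gt0// mulVf// gt_eqF.
    by rewrite dotZl -sqr_enorm expr2 mulKf// gt_eqF.
  have [/(_ u hu) h2 _] := rprim_dotl q hk.
  have /(rderivP _ _ _).1 /(_ _ e0) h2' := h2.
  near=> v; have uv : u < v by [].
  have g1 := tvarB_le u0 (ltW uv); have g2 := tvarB_ge u0 (ltW uv).
  have : `|A v - A u - enorm (k' u) * (v - u)| <= e * (v - u) by near: v; exact: h1.
  have : `|dot q (k v) - dot q (k u) - dot q (k' u) * (v - u)| <= e * (v - u).
    by near: v; exact: h2'.
  have : dot q (k v - k u) <= 1 * enorm (k v - k u) by exact: dot_le.
  rewrite dotDr dotNr qk !ler_norml; lra.
have /andP[u0 ub] := hu.
apply/cvgrPdist_le => e e0; have /cvgrPdist_le /(_ _ e0) h := a2 u hu.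
near=> v.
have vu : v <= u by near: v; exact: nbhs_left_le.
have v0 : 0 <= v by near: v; exact: nbhs_left_ge.
have h1 := tvarB_le v0 vu; have h2 := tvarB_ge v0 vu.
have : `|A u - A v| <= e by near: v; exact: h.
rewrite !ler_norml; have := enorm_ge0 (k u - k v); lra.
Unshelve. all: by end_near. Qed.

End TotalVariation.

(** * Uniform continuity of the integrand on compact sets *)

Section IntegrandModulus.
Context {R : realType} {d : nat} (g : R -> 'rV[R]_d -> R).
Context (hg : {within [set p : R * 'rV[R]_d | 0 <= p.1],
  continuous (fun p => g p.1 p.2)}).
Notation V := (R * 'rV[R]_d)%type.

(* [g] is extended by [g 0] to negative times: [(t + |t|) / 2 = max t 0]. *)
Let pos (t : R) := (t + `|t|) / 2.

Let pos_ge0 t : 0 <= pos t.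
Proof. by rewrite divr_ge0// -lerBlDl sub0r -normrN ler_norm. Qed.

Let pos_id t : 0 <= t -> pos t = t.
Proof. by move=> t0; rewrite /pos ger0_norm//; lra. Qed.

Let G (p : V) := g (pos p.1) p.2.

Let G_continuous : continuous G.
Proof.
move=> p; have /subspace_continuousP h := hg.
pose phi (q : V) : V := (pos q.1, q.2).
have c1 : q.1 @[q --> nbhs p] --> p.1 by exact: cvg_fst.
have c2 : q.2 @[q --> nbhs p] --> p.2 by exact: cvg_snd.
have c3 : pos q.1 @[q --> nbhs p] --> pos p.1.
  by apply: cvgM; [apply: cvgD => //; exact: cvg_norm|exact: cvg_cst].
have phic : phi q @[q --> nbhs p] --> nbhs (phi p).
  exact: (@cvg_pair _ _ _ (nbhs p) (nbhs (pos p.1)) (nbhs p.2) _ _ _ _ _ c3 c2).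
move=> A /(h (phi p) (pos_ge0 _)) /phic; apply: (@filterS _ (nbhs p)) => q.
by apply; exact: pos_ge0.
Qed.

Let K (T M : R) : set V := `[0, T]%classic `*` [set z | enorm z <= M].

Let K_compact T M : compact (K T M).
Proof.
apply: compact_setX; first exact: segment_compact.
apply: bounded_closed_compact.
  exists M; split; first exact: num_real.
  move=> N /ltW MN z /= zM; rewrite (le_trans (norm_le_enorm _))//.
  exact: le_trans zM MN.
rewrite (_ : [set _ | _] = @enorm R d @^-1` [set t | t <= M])//.
by apply: preimage_closed => [z _|]; [exact: enorm_continuous|exact: closed_le].
Qed.

Let GE (T M : R) (p : V) : K T M p -> G p = g p.1 p.2.
Proof.
by move=> [/= + _]; rewrite in_itv/= => /andP[p0 _]; rewrite /G pos_id.
Qed.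

Lemma integrand_bounded T M : exists2 C, 0 < C &
  forall s z, 0 <= s <= T -> enorm z <= M -> `|g s z| <= C.
Proof.
have inK s z : 0 <= s <= T -> enorm z <= M -> K T M (s, z).
  by move=> hs hz; split => //=; rewrite in_itv.
have [K0|/nonemptyPn K0] := pselect (K T M !=set0); last first.
  by exists 1 => // s z hs hz; have := inK s z hs hz; rewrite K0.
have cG : {within K T M, continuous (fun p => `|G p|)}.
  apply: continuous_subspaceT => p.
  by apply: (@cvg_norm _ _ _ (nbhs p)); exact: G_continuous.
have [c _ hc] := compact_EVT_max K0 (@K_compact T M) cG.
exists (`|G c| + 1); first by rewrite ltr_wpDl.
move=> s z hs hz; have Ksz := inK _ _ hs hz.
have := hc _ (mem_set Ksz); rewrite (GE Ksz)/= => h.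
by rewrite (le_trans h)// lerDl.
Qed.

(** The compactness argument of [normal_unif_continuous]: on pairs whose values differ by at least
    [e], the distance [f] has a positive minimum. *)
Lemma integrand_modulus T M e : 0 < e -> exists2 r, 0 < r &
  forall s s' z z', 0 <= s <= T -> 0 <= s' <= T -> enorm z <= M -> enorm z' <= M ->
    `|s - s'| <= r -> enorm (z - z') <= r -> `|g s z - g s' z'| <= e.
Proof.
move=> e0.
pose S := (K T M `*` K T M) `&` [set q : V * V | e <= `|G q.1 - G q.2|].
have inK s z : 0 <= s <= T -> enorm z <= M -> K T M (s, z).
  by move=> hs hz; split => //=; rewrite in_itv.
have f1 : continuous (fun q : V * V => q.1) by move=> q; exact: cvg_fst.
have f2 : continuous (fun q : V * V => q.2) by move=> q; exact: cvg_snd.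
have g1 : continuous (fun q : V => q.1) by move=> q; exact: cvg_fst.
have g2 : continuous (fun q : V => q.2) by move=> q; exact: cvg_snd.
have cS : compact S.
  apply: compact_closedI; first exact: compact_setX (@K_compact T M) (@K_compact T M).
  rewrite (_ : [set _ | _] = (fun q : V * V => `|G q.1 - G q.2|) @^-1` [set t | e <= t])//.
  apply: preimage_closed => [q _|]; last exact: closed_ge.
  apply: (@cvg_norm _ _ _ (nbhs q)); apply: cvgB.
    exact: (continuous_comp (f1 q) (@G_continuous _)).
  exact: (continuous_comp (f2 q) (@G_continuous _)).
have [S0|/nonemptyPn S0] := pselect (S !=set0); last first.
  exists 1 => // s s' z z' hs hs' hz hz' _ _; rewrite leNgt; apply/negP => /ltW h.
  suff : S ((s, z), (s', z')) by rewrite S0.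
  have k1 := inK _ _ hs hz; have k2 := inK _ _ hs' hz'.
  by split => //=; rewrite (GE k1) (GE k2).
pose f (q : V * V) := `|q.1.1 - q.2.1| + enorm (q.1.2 - q.2.2).
have cf : {within S, continuous f}.
  apply: continuous_subspaceT => q; apply: (@cvgD _ _ _ (nbhs q)).
    apply: (@cvg_norm _ _ _ (nbhs q)); apply: cvgB.
      exact: (continuous_comp (f1 q) (g1 _)).
    exact: (continuous_comp (f2 q) (g1 _)).
  apply: (@cvg_enorm _ _ _ (nbhs q)); apply: cvgB.
    exact: (continuous_comp (f1 q) (g2 _)).
  exact: (continuous_comp (f2 q) (g2 _)).
have [[[s z] [s' z']] /set_mem[_ eG] hmin] := compact_EVT_min S0 cS cf.
have f0 : 0 < f ((s, z), (s', z')).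
  rewrite lt_neqAle addr_ge0// andbT; apply/negP => /eqP/esym fE.
  have s0 : `|s - s'| = 0.
    by apply/eqP; rewrite eq_le normr_ge0 andbT -fE lerDl.
  have z0 : enorm (z - z') = 0.
    by apply/eqP; rewrite eq_le enorm_ge0 andbT -fE lerDr.
  move: eG; rewrite /= (_ : G (s, z) = G (s', z')) ?subrr ?normr0 ?leNgt ?e0//.
  congr (G (_, _)); first by apply/eqP; rewrite -subr_eq0 -normr_eq0 s0.
  by apply/eqP; rewrite -subr_eq0; apply/eqP; exact: enorm_eq0.
(* The time and space distances are bounded separately, and two thirds of the minimum stay below
   it. *)
exists (f ((s, z), (s', z')) / 3); first by rewrite divr_gt0.
move=> t t' w w' ht ht' hw hw' tt ww; rewrite leNgt; apply/negP => /ltW h.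
have k1 := inK _ _ ht hw; have k2 := inK _ _ ht' hw'.
have Sw : S ((t, w), (t', w')) by split => //=; rewrite (GE k1) (GE k2).
have := hmin _ (mem_set Sw); rewrite {2}/f/= => ?.
lra.
Qed.

Lemma integrand_right_cont (x : R -> 'rV[R]_d) : cadlag x ->
  right_cont (fun s => g s (x s)).
Proof.
move=> cx t t0; apply/cvgrPdist_le => e e0.
have [M M0 hM] := cadlag_bounded cx (addr_ge0 t0 ler01).
have [r r0 hr] := @integrand_modulus (t + 1) M e e0.
have [r' r'0 hr'] := cadlag_right cx r0 t0.
apply/nbhs_rightP; exists (Num.min 1 (Num.min r r')).
  by rewrite !lt_min ltr01 r0.
move=> u /andP[tu]; rewrite -ltrBlDl !lt_min => /and3P[u1 ur ur'].
have ht : 0 <= t <= t + 1 by rewrite t0/=; lra.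
have hu : 0 <= u <= t + 1 by apply/andP; split; lra.
apply: hr => //; [exact: hM|exact: hM| |].
  by rewrite distrC gtr0_norm; lra.
by rewrite enormB; apply: hr'; apply/andP; split; lra.
Qed.

Lemma integrand_path_bounded (x : R -> 'rV[R]_d) T : cadlag x -> 0 <= T ->
  exists M, forall t, 0 <= t <= T -> `|g t (x t)| <= M.
Proof.
move=> cx T0; have [M M0 hM] := cadlag_bounded cx T0.
have [C _ hC] := integrand_bounded T M; exists C => t ht.
by apply: hC => //; exact: hM.
Qed.

End IntegrandModulus.

(** * Calculus for the penalized equation *)

Section PenalizedCalculus.
Context {R : realType} {d : nat} (D : set 'rV[R]_d).
Context (C2D : C2_domain D) (bndD : bounded_set D) (cvxD : convex_set D).
Context (n : nat) (y x k : R -> 'rV[R]_d).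
Context (pen : penalized_solution D n y x k).
Context (g : R -> 'rV[R]_d -> R).
Context (hg : {within [set p : R * 'rV[R]_d | 0 <= p.1],
  continuous (fun p => g p.1 p.2)}).
Notation TR := (measurableTypeR R).

Let D_neq0 : D !=set0. Proof. by case: C2D. Qed.
Let cx : cadlag x. Proof. exact: pen_cadlag pen. Qed.

Lemma lebesgue_itvoc (a b : R) : a <= b ->
  lebesgue_measure (`]a, b]%classic : set TR) = (b - a)%:E.
Proof.
move=> ab; rewrite lebesgue_measure_itv/= lte_fin; case: ltP => [//|ba].
by rewrite (_ : b - a = 0)//; lra.
Qed.

(** Paths are specified at nonnegative times only, so functions can be exchanged only to the right
    of [a]. *)
Lemma rprim_ext (a b : R) (f f' h : R -> R) : (forall t, a <= t -> f t = h t) ->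
  rprim a b f f' -> rprim a b h f'.
Proof.
move=> fh [f1 f2]; split=> u /andP[au ub].
  have := f1 u (introT andP (conj au ub)); rewrite /rderiv; apply: cvg_trans.
  apply: near_eq_cvg; near=> v; rewrite !fh//.
  by rewrite (le_trans au)//; near: v; exact: nbhs_right_ge.
rewrite -fh ?(ltW au)//; have := f2 u (introT andP (conj au ub)); apply: cvg_trans.
apply: near_eq_cvg; near=> v; rewrite fh//.
by near: v; exact: nbhs_left_ge.
Unshelve. all: by end_near. Qed.

Let disp_cvg t : 0 <= t ->
  x s - proj D (x s) @[s --> t^'+] --> x t - proj D (x t).
Proof.
move=> t0; have [xr _] := cx; apply: cvgB; first exact: xr.
apply/enorm_cvg => e e0; have /enorm_cvg /(_ e e0) := xr t t0.
apply: filterS => s; apply: le_trans; exact: proj_lip.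
Qed.

Let rho t := enorm (x t - proj D (x t)).

Let rho_rc : right_cont rho.
Proof. by move=> t t0; apply: cvg_enorm; exact: disp_cvg. Qed.

Let disp_rc i : right_cont (fun t => (x t - proj D (x t)) 0 i).
Proof. by move=> t t0; apply: cvg_coord; exact: disp_cvg. Qed.

Let rho_bounded T : 0 <= T -> exists M, forall t, 0 <= t <= T -> rho t <= M.
Proof.
move=> T0; have [M _ hM] := cadlag_bounded cx T0.
have [M' _ hM'] := bounded_closureD bndD; exists (M + M') => t ht.
by rewrite (le_trans (ler_enormB _ _))// lerD ?hM// hM'//; exact: proj_in.
Qed.

(** The total variation of [k] on [[0, t]], written as a Lebesgue integral so that its right
    derivative is explicit. *)
Definition pen_mass t : R :=
  n%:R * \int[lebesgue_measure]_(s in `]0, t]) enorm (x s - proj D (x s)).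

Lemma rprim_pen_mass b : 0 <= b -> rprim 0 b pen_mass (fun u => n%:R * rho u).
Proof.
move=> b0; apply: rprimZ.
have [M hM] := rho_bounded b0.
have hM' : exists M, forall t, 0 <= t <= b -> `|rho t| <= M.
  by exists M => t /hM; rewrite /rho ger0_norm.
have := @rprim_primitive R lebesgue_measure id b (fun a c _ ac _ => lebesgue_itvoc ac)
  rho rho_rc hM' b (fun=> 1) (lexx b) (rprim_id 0 b).
by apply: eq_rprim => u _; rewrite mulr1.
Qed.

Lemma vprim_pen b : 0 <= b -> vprim 0 b k (fun u => n%:R *: (proj D (x u) - x u)).
Proof.
move=> b0 i; have [M hM] := rho_bounded b0.
have hM' : exists M, forall t, 0 <= t <= b -> `|(x t - proj D (x t)) 0 i| <= M.
  by exists M => t /hM; apply: le_trans; exact: coord_le_enorm.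
have := @rprim_primitive R lebesgue_measure id b (fun a c _ ac _ => lebesgue_itvoc ac)
  _ (@disp_rc i) hM' b (fun=> 1) (lexx b) (rprim_id 0 b).
move=> /(rprimZ (- n%:R)) h; apply: (rprim_ext (f := fun t => _)); last first.
  by apply: eq_rprim h => u _; rewrite !mxE; ring.
by move=> t t0; rewrite (pen_k pen)// /vintegral !mxE.
Qed.

Lemma pen0 : k 0 = 0.
Proof.
rewrite (pen_k pen)//; apply/rowP => i; rewrite !mxE set_itvoc0.
by rewrite Rintegral_set0 mulr0.
Qed.

Lemma pen_mass0 : pen_mass 0 = 0.
Proof. by rewrite /pen_mass set_itvoc0 Rintegral_set0 mulr0. Qed.

Let incr u v : 0 <= u -> u <= v -> enorm (k v - k u) <= pen_mass v - pen_mass u.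
Proof.
move=> u0 uv; have v0 := le_trans u0 uv.
apply: (vprim_le uv (vprimS u0 (lexx v) (vprim_pen v0))
  (rprimS u0 (lexx v) (rprim_pen_mass v0))) => t _.
by rewrite enormZ (enormB (proj D _)) ger0_norm.
Qed.

Definition pen_functional t : R := \int[stieltjes (tvar k)]_(s in `]0, t]) g s (x s).

Lemma pen_functional0 : pen_functional 0 = 0.
Proof. by rewrite /pen_functional set_itvoc0 Rintegral_set0. Qed.

Lemma rprim_pen_functional b : 0 <= b ->
  rprim 0 b pen_functional (fun u => g u (x u) * (n%:R * rho u)).
Proof.
move=> b0; have [C hC] := integrand_path_bounded hg cx b0.
have tv : rprim 0 b (tvar k) (fun u => n%:R * rho u).
  have := rprim_tvar incr (vprim_pen b0) _.
  have E u : enorm (n%:R *: (proj D (x u) - x u)) = n%:R * rho u.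
    by rewrite enormZ (enormB (proj D _)) ger0_norm.
  move=> h; apply: eq_rprim (h _) => [u _|]; first exact: E.
  by apply: eq_rprim (rprim_pen_mass b0) => u _; rewrite E.
have rc : right_continuous (tvar k).
  apply: (tvar_right_continuous incr) => t t0.
  have [h _] := rprim_pen_mass (addr_ge0 t0 ler01).
  have tt : 0 <= t < t + 1 by rewrite t0/= ltrDl ltr01.
  exact: rderiv_cvg (h _ tt).
apply: (@rprim_primitive R _ (tvar k) b _ _ (integrand_right_cont hg cx) _ b) => //.
  move=> u v u0 uv _; apply: stieltjes_itvoc => //.
  exact: tvar_nondecreasing incr.
by exists C.
Qed.

End PenalizedCalculus.

(** * The reflection measure *)

Section IntervalSplit.
Context {R : realType}.
Notation TR := (measurableTypeR R).
Context (mu : {measure set TR -> \bar R}).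
Implicit Types (a x y : itv_bound R).

Lemma itv_disjoint a x y :
  [set` Interval a x] `&` [set` Interval x y] = set0 :> set TR.
Proof.
apply/seteqP; split => // t [/=]; rewrite !itv_boundlr => /andP[_ h1] /andP[h2 _].
by have := le_trans h1 h2; rewrite bnd_simp ltxx.
Qed.

Lemma Rintegral_itv_split a x y (h : TR -> R) : (a <= x)%O -> (x <= y)%O ->
  bounded_on mu [set` Interval a y] h ->
  \int[mu]_(t in [set` Interval a y]) h t =
  \int[mu]_(t in [set` Interval a x]) h t + \int[mu]_(t in [set` Interval x y]) h t.
Proof.
move=> ax xy; rewrite (itv_bndbnd_setU ax xy) => hb.
by apply: Rintegral_disjoint => //; exact: itv_disjoint.
Qed.

Lemma mass_itv_split a x y : (a <= x)%O -> (x <= y)%O ->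
  (mu [set` Interval a y] < +oo)%E ->
  mass mu [set` Interval a y] = mass mu [set` Interval a x] + mass mu [set` Interval x y].
Proof.
move=> ax xy; rewrite (itv_bndbnd_setU ax xy) => hb.
by apply: mass_disjoint => //; exact: itv_disjoint.
Qed.

Lemma Rintegral_point (t : R) (h : TR -> R) :
  \int[mu]_(s in `[t, t]) h s = h t * mass mu `[t, t].
Proof.
rewrite -Rintegral_cst//; apply: eq_Rintegral => s.
by rewrite inE/= in_itv/= => /andP[ts st]; congr h; apply/eqP; rewrite eq_le st ts.
Qed.

Lemma mass_le (A B : set TR) : measurable A -> measurable B -> A `<=` B ->
  (mu B < +oo)%E -> mass mu A <= mass mu B.
Proof.
move=> mA mB AB fB; rewrite /mass fine_le//.
- by rewrite ge0_fin_numE// (le_lt_trans _ fB)// le_measure// inE.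
- by rewrite ge0_fin_numE.
- by rewrite le_measure// inE.
Qed.

(** Continuity from above along intervals that decrease to the empty set, as [t] is excluded; a
    possible atom at [t] does not interfere. *)
Lemma mass_shrink (t e : R) : 0 < e -> 0 < t -> (mu `[0%R, t[%classic < +oo)%E ->
  exists2 r, 0 < r <= t & mass mu `]t - r, t[ <= e.
Proof.
move=> e0 t0 fin.
pose F (n : nat) : set TR := `]t - t / n.+1%:R, t[%classic.
have sub n : F n `<=` `[0, t[%classic.
  move=> s; rewrite /F/= !in_itv/= => /andP[h ->]; rewrite andbT.
  apply: le_trans (ltW h); rewrite subr_ge0 ler_pdivrMr//.
  by rewrite ler_peMr ?ler1n// ltW.
have F0 : \bigcap_n F n = set0.
  apply/seteqP; split => // s Fs.
  have st : s < t by have := Fs 0%N I; rewrite /F/= in_itv/= => /andP[].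
  pose n := Num.truncn (t / (t - s)).
  have := Fs n I; rewrite /F/= in_itv/= => /andP[+ _].
  rewrite ltrBlDr -ltrBlDl ltr_pdivlMr// -ltr_pdivlMl ?subr_gt0// mulrC.
  have := truncnS_gt (t / (t - s)); rewrite -/n; lra.
have fF n : (mu (F n) < +oo)%E.
  by rewrite (le_lt_trans _ fin)// le_measure ?inE//; exact: measurable_itv.
have cv : mu \o F @ \oo --> 0%E.
  rewrite -(measure0 mu) -F0; apply: nonincreasing_cvg_mu => //.
  - by move=> i; exact: measurable_itv.
  - by rewrite F0; exact: measurable0.
  move=> m n mn; apply/subsetPset => s; rewrite /F/= !in_itv/= => /andP[h ->].
  rewrite andbT; apply: le_lt_trans h; rewrite lerD2l lerN2 ler_pM2l//.
  by rewrite lef_pV2 ?posrE// ler_nat.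
have /fine_cvg /cvgrPdist_le /(_ _ e0)[N _ /(_ N (leqnn N))] /= := cv.
rewrite sub0r normrN => h; exists (t / N.+1%:R).
  by rewrite divr_gt0//= ler_pdivrMr// ler_peMr ?ler1n// ltW.
by apply: le_trans h; exact: ler_norm.
Qed.

Context {d : nat}.

Lemma dot_vintegral (A : set TR) (f : R -> 'rV[R]_d) (e : 'rV[R]_d) :
  measurable A -> (mu A < +oo)%E -> (forall i, bounded_on mu A (fun s => f s 0 i)) ->
  dot e (vintegral mu A f) = \int[mu]_(s in A) dot e (f s).
Proof.
move=> mA fA hf; rewrite /dot Rintegral_sum//; last by move=> i; exact: bounded_onZ.
apply: eq_bigr => i _; rewrite mxE RintegralZl//.
exact: bounded_on_integrable.
Qed.

Lemma bounded_on_dot (A : set TR) (f : R -> 'rV[R]_d) (e : 'rV[R]_d) :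
  measurable A -> (mu A < +oo)%E -> (forall i, bounded_on mu A (fun s => f s 0 i)) ->
  bounded_on mu A (fun s => dot e (f s)).
Proof. by move=> mA fA hf; apply: bounded_on_sum => // i; exact: bounded_onZ. Qed.

Lemma vintegral_le_mass (A : set TR) (f : R -> 'rV[R]_d) (c : R) :
  measurable A -> (mu A < +oo)%E -> (forall i, bounded_on mu A (fun s => f s 0 i)) ->
  0 <= c -> (forall s, A s -> enorm (f s) <= c) ->
  enorm (vintegral mu A f) <= c * mass mu A.
Proof.
move=> mA fA hf c0 hc; apply: enorm_dir; first by rewrite mulr_ge0// mass_ge0.
move=> e e1; rewrite dot_vintegral//; apply: Rintegral_le_mass.
  exact: bounded_on_dot.
by move=> s /hc h; rewrite -[c]mul1r; apply: dot_le => //; rewrite e1.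
Qed.

Lemma vintegral_itv_split a x y (f : R -> 'rV[R]_d) : (a <= x)%O -> (x <= y)%O ->
  (forall i, bounded_on mu [set` Interval a y] (fun s => f s 0 i)) ->
  vintegral mu [set` Interval a y] f =
  vintegral mu [set` Interval a x] f + vintegral mu [set` Interval x y] f.
Proof.
by move=> ax xy hf; apply/rowP => i; rewrite !mxE (Rintegral_itv_split ax xy).
Qed.

Lemma vintegral_point (t : R) (f : R -> 'rV[R]_d) :
  vintegral mu `[t, t] f = mass mu `[t, t] *: f t.
Proof. by apply/rowP => i; rewrite !mxE Rintegral_point mulrC. Qed.

End IntervalSplit.

Section ReflectionMeasure.
Context {R : realType} {d : nat} (D : set 'rV[R]_d).
Context (C2D : C2_domain D) (bndD : bounded_set D) (cvxD : convex_set D).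
Context (y x k : R -> 'rV[R]_d) (sk : skorokhod_solution D y x k).
Notation TR := (measurableTypeR R).
Let mu := stieltjes (tvar k).
Let mu0 := stieltjes (tvar0 k).

Lemma tvar0_at0 : tvar k 0 = 0.
Proof. by rewrite (sk_support sk (lexx 0)) set_itvoc0 Rintegral_set0. Qed.

(* If [tvar k] were not monotone or not right-continuous then [mu] would be zero,
   and [tvar k] would vanish by the support condition. *)
Lemma tvar_cumulative : nondecreasing (tvar k) /\ right_continuous (tvar k).
Proof.
have [//|h] := pselect (nondecreasing (tvar k) /\ right_continuous (tvar k)).
suff tv0 : tvar k = fun=> 0.
  by rewrite tv0; split => // t; exact: cvg_cst.
apply/funext => t; have [t0|/tvar_neg//] := leP 0 t.
rewrite (sk_support sk t0) (stieltjes_default h).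
by rewrite /Rintegral integral_measure_zero.
Qed.

Lemma tvar0_cumulative : nondecreasing (tvar0 k) /\ right_continuous (tvar0 k).
Proof.
have [nd rc] := tvar_cumulative; split=> [u v uv|t].
  rewrite /tvar0; case: ifPn => [u0|]; first by rewrite (le_trans u0 uv) lerD2l nd.
  by case: ifPn => // v0 _; rewrite addr_ge0// -tvar0_at0 nd.
have [t0|t0] := leP 0 t.
  have h : enorm (k 0) + tvar k u @[u --> t^'+] --> enorm (k 0) + tvar k t.
    by apply: cvgD; [exact: cvg_cst|exact: rc].
  rewrite {2}/tvar0 t0; apply: cvg_trans h; apply: near_eq_cvg; near=> u.
  by rewrite /tvar0 (le_trans t0)//; near: u; exact: nbhs_right_ge.
rewrite {2}/tvar0 leNgt t0/=.
apply: (@cvg_trans _ ((fun=> 0 : R) @ t^'+)); last exact: cvg_cst.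
apply: near_eq_cvg; near=> u; rewrite /tvar0 leNgt (_ : u < 0)//.
Unshelve. all: by end_near. Qed.

Let c0 : {nonneg R} := NngNum (enorm_ge0 (k 0)).

(** The convention [k_{0-} = 0] adds an atom of mass [enorm (k 0)] at 0. It suffices to compare the
    measures on intervals []a, b]], according to the position of 0. *)
Lemma mu0E (A : set TR) : measurable A ->
  mu0 A = (measure_add (mscale c0 (dirac (0 : TR))) mu) A.
Proof.
have [nd rc] := tvar_cumulative; have [nd0 rc0] := tvar0_cumulative.
move=> mA; rewrite /mu0 /stieltjes; case: pselect => [H|]; last by case.
apply: lebesgue_stieltjes_measure_unique => // X [[a b] _ <-]; rewrite [RHS]measure_addE /mscale/=.
have [ab|ba] := leP a b; last by rewrite set_itv_ge ?bnd_simp -?leNgt ?(ltW ba)// !measure0 adde0.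
have := stieltjes_itvoc nd0 rc0 ab; rewrite /stieltjes; case: pselect => [H'|]; last by case.
rewrite (Prop_irrelevance H' H) => ->.
rewrite /mscale/= /mu (stieltjes_itvoc nd rc ab) diracE.
rewrite -EFinM -EFinD; congr EFin.
rewrite mem_setE in_itv/= /tvar0; case: (leP 0 b) => [b0|b0]; last first.
  have a0 := le_lt_trans ab b0.
  by rewrite (leNgt 0 a) a0 andbF /= (tvar_neg _ b0) (tvar_neg _ a0) mulr0 !subrr addr0.
case: (leP 0 a) => [a0|a0]; rewrite ?andbT ?andbF/= ?mulr0 ?mulr1 ?(tvar_neg _ a0); lra.
Qed.

End ReflectionMeasure.

(** * Measurability of the normal along the path *)

Section NormalApproximation.
Context {R : realType} {d : nat} (D : set 'rV[R]_d).
Context (C2D : C2_domain D) (bndD : bounded_set D) (cvxD : convex_set D).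
Context (a : 'rV[R]_d) (r : R) (r0 : 0 < r)
  (hr : forall w, enorm (w - a) <= r -> D w).
Let D_neq0 : D !=set0. Proof. by case: C2D. Qed.
Let openD : open D. Proof. by case: C2D. Qed.

(* [z] is pushed away from [a], out of [D] when [z] is on the boundary, and the
   normal is read off the projection of the resulting point. *)
Definition pushed (m : nat) (z : 'rV[R]_d) := z + m.+1%:R^-1 *: (z - a).
Definition normal_approx (m : nat) (z : 'rV[R]_d) : 'rV[R]_d :=
  (enorm (pushed m z - proj D (pushed m z)) + m.+1%:R^-1 ^+ 2)^-1 *:
    (proj D (pushed m z) - pushed m z).

Let small (e : R) : 0 < e -> \forall m \near \oo, m.+1%:R^-1 <= e :> R.
Proof.
by move=> e0; near=> m; apply: ltW; near: m; exact: near_infty_natSinv_lt (PosNum e0).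
Unshelve. all: by end_near. Qed.

(** At a boundary point the displacement of the pushed point is at least [r / m.+1] ([vr]), so the
    square added to the denominator is negligible. At an interior point the displacement is
    eventually 0, and the square keeps the denominator positive. *)
Lemma normal_approx_cvg z : closure D z ->
  normal_approx m z @[m --> \oo] --> normal D z.
Proof.
move=> Cz; apply/enorm_cvg => e e0.
have s0 m : 0 < m.+1%:R^-1 :> R by rewrite invr_gt0.
have za1 : 0 < enorm (z - a) + 1 by rewrite ltr_wpDl.
have [Dz|nDz] := pselect (D z).
  have [r' r'0 h] := inner_ball openD Dz.
  rewrite normal_off; last by move=> /(boundaryE C2D)[].
  near=> m; rewrite subr0 /normal_approx proj_id//.
    by rewrite subrr scaler0 enorm0 ltW.
  apply: subset_closure; apply: h.
  rewrite /pushed addrAC subrr add0r enormZ gtr0_norm//.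
  have : m.+1%:R^-1 <= r' / (enorm (z - a) + 1).
    by near: m; apply: small; rewrite divr_gt0.
  rewrite ler_pdivlMr//; have := s0 m; move: (m.+1%:R^-1 : R) => s; lra.
have bz : boundary D z by apply/(boundaryE C2D).
have e20 : 0 < e / 2 by rewrite divr_gt0.
have [q q0 hq] := normal_unif_continuous C2D bndD cvxD e20.
have rb := dot_normal_ball C2D cvxD hr (ltW r0) bz.
have [_ n1 _] := normal_inner C2D cvxD bz.
near=> m.
have hs1 : m.+1%:R^-1 <= e / 2 * r by near: m; apply: small; rewrite mulr_gt0.
have hs2 : m.+1%:R^-1 * (enorm (z - a) + 1) <= q.
  by rewrite -ler_pdivlMr//; near: m; apply: small; rewrite divr_gt0.
set s := m.+1%:R^-1 : R; rewrite -/s in hs1 hs2.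
have s0' : 0 < s by exact: s0.
set w := pushed m z; set v := proj D w - w.
have vr : s * r <= enorm v.
  have h1 : 0 <= dot (proj D w - z) (normal D z).
    by apply: (dot_normal_ge0 C2D cvxD); exact: proj_in.
  have h2 := cauchy_schwarz v (normal D z); rewrite n1 mulr1 in h2.
  have E : dot v (normal D z) = dot (proj D w - z) (normal D z) + s * dot (a - z) (normal D z).
    by rewrite /v /w /pushed -/s; move: (proj D _) => p; rewrite !dotE; ring.
  have := ler_wpM2l (ltW s0') rb; lra.
have v0 : 0 < enorm v by rewrite (lt_le_trans _ vr)// mulr_gt0.
have wp : w != proj D w.
  by apply: contra_ltN v0 => /eqP h; rewrite /v -h subrr enorm0.
have bp := boundary_proj C2D bndD cvxD wp.
have [_ n1' _] := normal_inner C2D cvxD bp.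
have vE : v = enorm v *: normal D (proj D w).
  by rewrite {1}/v (proj_normal C2D bndD cvxD) enormB.
have nE : normal_approx m z = (enorm v / (enorm v + s ^+ 2)) *: normal D (proj D w).
  by rewrite /normal_approx -/w enormB -/v {2}vE scalerA mulrC.
rewrite (le_trans (ler_enorm_dist (normal D (proj D w)) _ _))//.
have d0 : 0 < enorm v + s ^+ 2 by rewrite addr_gt0// exprn_gt0.
have h1 : enorm (normal_approx m z - normal D (proj D w)) <= e / 2.
  rewrite nE -{2}[normal D _]scale1r -scalerBl enormZ n1' mulr1.
  have -> : enorm v / (enorm v + s ^+ 2) - 1 = - (s ^+ 2 / (enorm v + s ^+ 2)).
    by field; rewrite gt_eqF.
  rewrite normrN ger0_norm ?divr_ge0 ?exprn_ge0 ?(ltW d0) ?(ltW s0')//.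
  rewrite ler_pdivrMr//.
  have h := ler_wpM2l (ltW s0') hs1.
  rewrite [leLHS]expr2 (le_trans h)// mulrCA ler_pM2l// (le_trans vr)//.
  by rewrite lerDl exprn_ge0// ltW.
have h2 : enorm (normal D (proj D w) - normal D z) <= e / 2.
  apply: hq => //; rewrite -[X in _ - X](proj_id D_neq0 bndD cvxD Cz).
  rewrite (le_trans (proj_lip D_neq0 bndD cvxD _ _))//.
  rewrite /w /pushed addrAC subrr add0r enormZ gtr0_norm//.
  by rewrite (le_trans _ hs2)// ler_pM2l// lerDl.
by rewrite (splitr e); exact: (lerD h1 h2).
Unshelve. all: by end_near. Qed.

Lemma normal_approx_path_rc (x : R -> 'rV[R]_d) m i : cadlag x ->
  right_cont (fun t => normal_approx m (x t) 0 i).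
Proof.
move=> [xr _] t t0.
have px : pushed m (x s) @[s --> t^'+] --> pushed m (x t).
  apply: cvgD; first exact: xr.
  apply: cvgZ; first exact: cvg_cst.
  by apply: cvgB; [exact: xr|exact: cvg_cst].
have pp : proj D (pushed m (x s)) @[s --> t^'+] --> proj D (pushed m (x t)).
  apply/enorm_cvg => e e0; have /enorm_cvg /(_ e e0) := px.
  apply: filterS => s; apply: le_trans; exact: proj_lip.
apply: cvg_coord; apply: cvgZ; last exact: cvgB pp px.
have s2 : 0 < m.+1%:R^-1 ^+ 2 :> R by rewrite exprn_gt0// invr_gt0.
apply: cvgV; first by rewrite gt_eqF// ltr_wpDl.
apply: cvgD; last exact: cvg_cst.
by apply: cvg_enorm; exact: cvgB px pp.
Qed.

Lemma measurable_normal_path (x : R -> 'rV[R]_d) i : cadlag x ->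
  (forall t, 0 <= t -> closure D (x t)) ->
  measurable_fun (`[0%R, +oo[%classic : set (measurableTypeR R))
    (fun t : measurableTypeR R => normal D (x t) 0 i).
Proof.
move=> cx Cx; apply: (@measurable_fun_cvg _ _ _ _
  (fun m (t : measurableTypeR R) => normal_approx m (x t) 0 i)) => [m|t].
  by apply: measurable_right_cont; exact: normal_approx_path_rc.
rewrite /= in_itv/= andbT => t0; apply: cvg_coord.
by apply: normal_approx_cvg; exact: Cx.
Qed.

End NormalApproximation.

(** * The reflection term of the Skorokhod problem *)

Section ReflectionPath.
Context {R : realType} {d : nat} (D : set 'rV[R]_d).
Context (C2D : C2_domain D) (bndD : bounded_set D) (cvxD : convex_set D).
Context (y x k : R -> 'rV[R]_d) (sk : skorokhod_solution D y x k).
Notation TR := (measurableTypeR R).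
Let N s := normal D (x s).
Let mu := stieltjes (tvar k).
Let mu0 := stieltjes (tvar0 k).
Let D_neq0 : D !=set0. Proof. by case: C2D. Qed.
Let openD : open D. Proof. by case: C2D. Qed.
Implicit Types (A : set TR) (a b t T : R).

Lemma mu0_fin T A : measurable A -> A `<=` `[0, T] -> (mu0 A < +oo)%E.
Proof.
have [nd0 rc0] := tvar0_cumulative sk.
move=> mA AT; have [T0|T0] := leP 0 T; last first.
  rewrite (_ : A = set0) ?measure0//; apply/seteqP; split => // s /AT /=.
  by rewrite in_itv/= => /andP[/le_trans h /h]; rewrite leNgt T0.
have h : (mu0 `](-1)%R, T]%classic < +oo)%E.
  by rewrite /mu0 (stieltjes_itvoc nd0 rc0) ?ltry//; lra.
apply: le_lt_trans h; rewrite le_measure ?inE//.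
by move=> s /AT /=; rewrite !in_itv/= => /andP[s0 ->]; rewrite andbT; lra.
Qed.

Let mu0_mu T A : measurable A -> A `<=` `]0, T] -> mu0 A = mu A.
Proof.
move=> mA AT; rewrite [LHS](mu0E sk mA) measure_addE/= /mscale/= diracE.
rewrite memNset ?mule0 ?add0e// => /AT /=.
by rewrite in_itv/= ltxx.
Qed.

Let mu_fin T : 0 <= T -> mu `]0, T]%classic = (tvar k T)%:E.
Proof.
have [nd rc] := tvar_cumulative sk => T0.
by rewrite /mu (stieltjes_itvoc nd rc)// (tvar0_at0 sk) subr0.
Qed.

Lemma mass_initial : mass mu0 `[0, 0] = enorm (k 0).
Proof.
have [nd rc] := tvar_cumulative sk.
have m0 : mu `[0%R, 0%R]%classic = 0%E.
  apply/eqP; rewrite eq_le measure_ge0 andbT.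
  have : (mu `[0%R, 0%R]%classic <= mu `](-1)%R, 0%R]%classic)%E.
    apply: le_measure; rewrite ?inE; [exact: measurable_itv|exact: measurable_itv|].
    by move=> s /=; rewrite !in_itv/= => /andP[s0 ->]; rewrite andbT; lra.
  by rewrite /mu (stieltjes_itvoc nd rc) ?lerN10// (tvar0_at0 sk) tvar_neg ?subrr// ltrN10.
rewrite /mass [X in fine X](mu0E sk) ?measure_addE; last exact: measurable_itv.
rewrite /= /mscale/= diracE mem_set/= ?in_itv/= ?lexx//.
by rewrite [X in (_ + X)%E](m0 : _) adde0 mule1.
Qed.

Let kinit : k 0 = enorm (k 0) *: N 0.
Proof.
have xE := sk_eq sk (lexx 0); rewrite (sk_k0 sk) addrCA subrr addr0 in xE.
by rewrite /N xE {1 2}(sk_k0 sk) {1}(proj_normal C2D bndD cvxD) enormB.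
Qed.

Let initial_boundary : k 0 != 0 -> boundary D (x 0).
Proof.
have xE := sk_eq sk (lexx 0); rewrite (sk_k0 sk) addrCA subrr addr0 in xE.
rewrite (sk_k0 sk) subr_eq0 xE => h.
by apply: (boundary_proj C2D bndD cvxD); rewrite eq_sym.
Qed.

Lemma bounded_on_normal T A i : measurable A -> A `<=` `[0, T] ->
  bounded_on mu0 A (fun s => N s 0 i).
Proof.
move=> mA AT; split => //; first exact: mu0_fin AT.
  have [a Da] := D_neq0; have [r r0 hr] := inner_ball openD Da.
  have := measurable_normal_path C2D bndD cvxD r0 hr i (sk_cadlag_x sk) (sk_in sk).
  apply: measurable_funS => //.
  by move=> s /AT /=; rewrite !in_itv/= => /andP[->].
exists 1 => t _; rewrite (le_trans (coord_le_enorm _ _))//.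
exact: enorm_normal_le1.
Qed.

(** The initial projection is [enorm (k 0)] times the normal at [x 0], that is, the contribution of
    the atom of [mu0] at 0. Time 0 thereby becomes a jump time like any other. *)
Lemma reflection_at t : 0 <= t -> k t = vintegral mu0 `[0, t] N.
Proof.
move=> t0.
have hs := @vintegral_itv_split _ mu0 _ (BLeft 0) (BRight 0) (BRight t) N.
rewrite {}hs ?bnd_simp//; last first.
  by move=> i; apply: (@bounded_on_normal t); [exact: measurable_itv|].
rewrite vintegral_point mass_initial.
have E : vintegral mu `]0, t] N = vintegral mu0 `]0, t] N.
  apply/rowP => i; apply: (etrans (mxE _ _ _ _)); apply: (etrans _ (esym (mxE _ _ _ _))).
  apply: (f_equal (@fine R)); apply: eq_measure_integral => A mA AT.
  exact/esym/(mu0_mu mA AT).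
apply: (etrans (sk_normal sk t0)); exact: (f_equal2 +%R kinit E).
Qed.

Let NN s : dot (N s) (N s) = \1_[set u | boundary D (x u)] s.
Proof.
rewrite indicE; have [bx|bx] := pselect (boundary D (x s)).
  have [_ n1 _] := normal_inner C2D cvxD bx.
  by rewrite mem_set// -sqr_enorm n1 expr1n.
by rewrite memNset// /N normal_off// dot0l.
Qed.

Let bounded_on_NN T A : measurable A -> A `<=` `[0, T] ->
  bounded_on mu0 A (fun s => dot (N s) (N s)).
Proof.
move=> mA AT; apply: bounded_on_sum => //; first exact: mu0_fin AT.
by move=> i; apply: bounded_onM; exact: bounded_on_normal AT.
Qed.

(** The integrand is the indicator of the boundary. On all of [[0, T]] equality is the support
    condition; on [A] and on its complement the integral is at most the mass, so both must be
    equalities. *)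
Lemma mass_support T A : measurable A -> A `<=` `[0, T] ->
  \int[mu0]_(s in A) dot (N s) (N s) = mass mu0 A.
Proof.
move=> mA AT; have [T0|T0] := leP 0 T; last first.
  rewrite (_ : A = set0) ?Rintegral_set0 /mass ?measure0//; apply/seteqP; split => // s /AT /=.
  by rewrite in_itv/= => /andP[/le_trans h /h]; rewrite leNgt T0.
have mT : measurable (`[0%R, T]%classic : set TR) by exact: measurable_itv.
have fT := mu0_fin mT (@subset_refl _ _).
have bT := bounded_on_NN mT (@subset_refl _ _).
have NN1 s : dot (N s) (N s) <= 1.
  by rewrite -sqr_enorm expr_le1// enorm_normal_le1.
have full : \int[mu0]_(s in `[0, T]) dot (N s) (N s) = mass mu0 `[0, T].
  rewrite (@Rintegral_itv_split _ _ _ (BRight 0)) ?bnd_simp//.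
  rewrite (@mass_itv_split _ _ _ (BRight 0)) ?bnd_simp// Rintegral_point mass_initial.
  congr (_ + _).
    have [->|k0] := eqVneq (k 0) 0; first by rewrite enorm0 mulr0.
    by rewrite NN indicE mem_set ?mul1r//; exact: initial_boundary.
  have -> : mass mu0 `]0, T] = tvar k T.
    by rewrite /mass (@mu0_mu T) ?mu_fin//; exact: measurable_itv.
  rewrite (sk_support sk T0) /Rintegral; under eq_integral do rewrite NN.
  apply: (f_equal (@fine R)); apply: eq_measure_integral => B mB BT.
  exact: mu0_mu mB BT.
have mC : measurable (`[0%R, T]%classic `\` A) by exact: measurableD.
have AE : `[0%R, T]%classic = A `|` (`[0%R, T]%classic `\` A) :> set TR.
  by rewrite setDUK.
have bA := bounded_on_NN mA AT.
have CT : (`[0%R, T]%classic `\` A) `<=` `[0%R, T] by move=> s [].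
have bC := bounded_on_NN mC CT.
have AC : A `&` (`[0%R, T]%classic `\` A) = set0 by rewrite setDE setICA setICr setI0.
have h1 : mass mu0 `[0, T] = mass mu0 A + mass mu0 (`[0, T]%classic `\` A).
  by rewrite {1}AE mass_disjoint// -AE.
have h2 : \int[mu0]_(s in `[0, T]) dot (N s) (N s) = \int[mu0]_(s in A) dot (N s) (N s) +
   \int[mu0]_(s in `[0, T]%classic `\` A) dot (N s) (N s).
  by rewrite {1}AE Rintegral_disjoint// -AE.
have h3 := Rintegral_le_mass bA (fun s _ => NN1 s).
have h4 := Rintegral_le_mass bC (fun s _ => NN1 s).
lra.
Qed.

Lemma mass_point_boundary t : 0 <= t -> 0 < mass mu0 `[t, t] -> boundary D (x t).
Proof.
move=> t0 m0; apply: contrapT => bx.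
have : \int[mu0]_(s in `[t, t]) dot (N s) (N s) = mass mu0 `[t, t].
  apply: (@mass_support t); first exact: measurable_itv.
  by move=> s /=; rewrite !in_itv/= => /andP[/(le_trans t0) -> ->].
rewrite Rintegral_point NN indicE memNset// mul0r => E.
by move: m0; rewrite -E ltxx.
Qed.

(** The left limit of [k] ([kleft_cvg]), with the value 0 at time 0 prescribed by [k_{0-} = 0]. As
    an integral it is additive over links. *)
Definition kleft t := vintegral mu0 `[0, t[ N.

Lemma kleft0 : kleft 0 = 0.
Proof.
by apply/rowP => i; rewrite /kleft !mxE set_itvco0 Rintegral_set0.
Qed.

Let co_sub a b T : 0 <= a -> b <= T -> (`[a, b[%classic : set TR) `<=` `[0, T].
Proof.
move=> a0 bT s /=; rewrite !in_itv/= => /andP[h1 h2].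
by rewrite (le_trans a0)// (le_trans (ltW h2)).
Qed.

Lemma kleftB a b : 0 <= a -> a <= b -> kleft b - kleft a = vintegral mu0 `[a, b[ N.
Proof.
move=> a0 ab; rewrite /kleft.
rewrite (@vintegral_itv_split _ mu0 _ (BLeft 0) (BLeft a) (BLeft b)) ?bnd_simp//.
  by rewrite addrAC subrr add0r.
by move=> i; apply: (@bounded_on_normal b); [exact: measurable_itv|exact: co_sub].
Qed.

Lemma reflectionB a t : 0 <= a -> a <= t -> k t - kleft a = vintegral mu0 `[a, t] N.
Proof.
move=> a0 ta; rewrite reflection_at ?(le_trans a0)// /kleft.
rewrite (@vintegral_itv_split _ mu0 _ (BLeft 0) (BLeft a) (BRight t)) ?bnd_simp//.
  by rewrite addrAC subrr add0r.
by move=> i; apply: (@bounded_on_normal t); [exact: measurable_itv|].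
Qed.

Lemma reflection_jump t : 0 <= t -> k t - kleft t = mass mu0 `[t, t] *: N t.
Proof. by move=> t0; rewrite (reflectionB t0 (lexx t)); exact: vintegral_point. Qed.

Lemma kleft_cvg t : 0 < t -> k s @[s --> t^'-] --> kleft t.
Proof.
move=> t0; apply/enorm_cvg => e e0.
have fin : (mu0 `[0%R, t[%classic < +oo)%E.
  by apply: (@mu0_fin t); [exact: measurable_itv|exact: co_sub].
have [r /andP[r0 rt] hr] := mass_shrink e0 t0 fin.
apply/nbhs_leftP; exists r => // s /andP[rs st].
have s0 : 0 <= s by lra.
have ot_sub : (`]s, t[%classic : set TR) `<=` `[0, t].
  move=> u /=; rewrite !in_itv/= => /andP[h1 h2].
  by rewrite (le_trans s0) ?ltW.
have mo : measurable (`]s, t[%classic : set TR) by exact: measurable_itv.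
rewrite enormB /kleft (@vintegral_itv_split _ mu0 _ (BLeft 0) (BRight s) (BLeft t)) ?bnd_simp// ?(ltW st)//; last first.
  by move=> i; apply: (@bounded_on_normal t); [exact: measurable_itv|exact: co_sub].
rewrite (reflection_at s0) addrAC subrr add0r.
apply: (@le_trans _ _ (1 * mass mu0 `]s, t[)).
  apply: vintegral_le_mass => //.
  - exact: mu0_fin mo ot_sub.
  - by move=> i; exact: bounded_on_normal mo ot_sub.
  - by move=> u _; exact: enorm_normal_le1.
rewrite mul1r (le_trans _ hr)//.
apply: mass_le; [exact: measurable_itv|exact: measurable_itv| |].
  by move=> u /=; rewrite !in_itv/= => /andP[/(lt_trans rs) -> ->].
apply: (@mu0_fin t); first exact: measurable_itv.
move=> u /=; rewrite !in_itv/= => /andP[h1 /ltW ->]; rewrite andbT; lra.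
Qed.

Lemma jumpE t : 0 <= t -> jump k t = mass mu0 `[t, t] *: N t.
Proof.
move=> t0; rewrite -reflection_jump// /jump; case: ltP => [t0'|t0'].
  by congr (_ - _); apply: cvg_lim => //; exact: kleft_cvg.
have -> : t = 0 by apply/eqP; rewrite eq_le t0 t0'.
by rewrite kleft0 subr0.
Qed.

Lemma enorm_jump t : 0 <= t -> enorm (jump k t) = mass mu0 `[t, t].
Proof.
move=> t0; rewrite jumpE// enormZ ger0_norm ?mass_ge0//.
have := mass_ge0 mu0 `[t, t]; rewrite le_eqVlt => /predU1P[<-|m0].
  by rewrite mul0r.
have [_ n1 _] := normal_inner C2D cvxD (mass_point_boundary t0 m0).
by rewrite n1 mulr1.
Qed.

Lemma pre_reflection t : 0 <= t -> y t + kleft t = x t - mass mu0 `[t, t] *: N t.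
Proof.
move=> t0; rewrite -reflection_jump// (sk_eq sk t0).
by rewrite opprB addrA addrAC addrK.
Qed.

(** [y t + kleft t] is the position just before reflection; it lies on the outward normal ray at
    [x t], at a distance equal to the jump of [k]. *)
Lemma proj_pre_reflection t : 0 <= t -> proj D (y t + kleft t) = x t.
Proof.
move=> t0; rewrite pre_reflection// proj_ray//; last exact: mass_ge0.
exact: sk_in sk _ t0.
Qed.

(** By [mass_support] only times with [x s] on the boundary count, and there [N s] is a unit vector,
    so its product with [nu] is at least [1 - w]. *)
Lemma normal_mass T A nu w : measurable A -> A `<=` `[0, T] -> enorm nu = 1 ->
  (forall s, A s -> boundary D (x s) -> enorm (N s - nu) <= w) ->
  (1 - w) * mass mu0 A <= dot nu (vintegral mu0 A N) <= mass mu0 A.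
Proof.
move=> mA AT nu1 hw; have fA := mu0_fin mA AT.
have bA i : bounded_on mu0 A (fun s => N s 0 i) by exact: bounded_on_normal AT.
have bnu := bounded_on_dot nu mA fA bA.
rewrite dot_vintegral//; apply/andP; split; last first.
  rewrite -[leRHS]mul1r; apply: Rintegral_le_mass => // s _.
  by rewrite -[1]mul1r; apply: dot_le; rewrite ?nu1// enorm_normal_le1.
have bNN := bounded_on_NN mA AT.
rewrite -(mass_support mA AT) -RintegralZl//; last exact: bounded_on_integrable.
apply: Rintegral_mono => //; first exact: bounded_onZ.
move=> s As; have [bx|bx] := pselect (boundary D (x s)); last first.
  by rewrite /N normal_off// !dot0r mulr0.
have [_ n1 _] := normal_inner C2D cvxD bx.
have n11 : dot (N s) (N s) = 1 by rewrite -sqr_enorm n1 expr1n.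
have h : dot (N s - nu) (N s) <= w * 1 by apply: dot_le; rewrite ?n1//; exact: hw.
by move: h; rewrite dotDl dotNl n11; lra.
Qed.

(** The counterpart of [normal_pairing] for the limit: the normal at [x s] has a nonnegative product
    with [q - x s], and freezing [x s] at [c] costs at most [e]. *)
Lemma reflection_pairing T A q c (e : R) : measurable A -> A `<=` `[0, T] ->
  closure D q -> (forall s, A s -> enorm (x s - c) <= e) ->
  - (e * mass mu0 A) <= dot (q - c) (vintegral mu0 A N).
Proof.
move=> mA AT Cq he; have fA := mu0_fin mA AT.
have bA i : bounded_on mu0 A (fun s => N s 0 i) by exact: bounded_on_normal AT.
rewrite dot_vintegral// -mulNr; apply: Rintegral_ge_mass; first exact: bounded_on_dot.
move=> s As; have h1 : 0 <= dot (q - x s) (N s).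
  by apply: (dot_normal_ge0 C2D cvxD).
have h2 : dot (- (x s - c)) (N s) <= e * 1.
  by apply: dot_le; rewrite ?enormN ?he// enorm_normal_le1.
have h3 : dot (x s - c) (- N s) <= e * 1.
  by apply: dot_le; rewrite ?enormN ?he// enorm_normal_le1.
move: h1 h3; rewrite !dotE; lra.
Qed.

(** When [y] does not jump, [y T + kleft T] is the left limit of [x] and lies in [closure D]. It is
    also [x T] moved outwards along the normal by the mass of the atom, which the supporting
    half-space forbids unless that mass is 0. *)
Lemma mass_point_continuity T : 0 < T -> jump y T = 0 -> mass mu0 `[T, T] = 0.
Proof.
move=> T0; rewrite /jump T0 => /eqP; rewrite subr_eq0 => /eqP yT.
apply/eqP; rewrite eq_le mass_ge0 andbT leNgt; apply/negP => m0.
have bx := mass_point_boundary (ltW T0) m0.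
have [_ n1 hn] := normal_inner C2D cvxD bx.
have yc : y s @[s --> T^'-] --> y T.
  have xc : cvg (x s @[s --> T^'-]) by case: (sk_cadlag_x sk) => _; apply.
  have : x s - k s @[s --> T^'-] --> lim (x s @[s --> T^'-]) - kleft T.
    by apply: cvgB => //; exact: kleft_cvg.
  have E : {near T^'-, (fun s => x s - k s) =1 y}.
    near=> s; rewrite (sk_eq sk) ?addrK//; near: s; exact: nbhs_left_ge.
  move/(cvg_trans (near_eq_cvg E)) => h; rewrite yT.
  by have /cvg_lim -> := h.
have xc : x s @[s --> T^'-] --> y T + kleft T.
  have : y s + k s @[s --> T^'-] --> y T + kleft T.
    by apply: cvgD => //; exact: kleft_cvg.
  apply: cvg_trans; apply: near_eq_cvg; near=> s.
  by rewrite (sk_eq sk)//; near: s; exact: nbhs_left_ge.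
have Cx : closure D (y T + kleft T).
  have nr : \forall s \near T^'-, closure D (x s).
    by near=> s; apply: (sk_in sk); near: s; exact: nbhs_left_ge.
  exact: (@closed_cvg _ _ (T^'-) _ x (closure D) (@closed_closure _ D) nr _ xc).
have := hn _ Cx; rewrite pre_reflection ?(ltW T0)//.
rewrite addrAC subrr add0r dotNl dotZl -sqr_enorm n1 expr1n mulr1 oppr_ge0.
by rewrite leNgt m0.
Unshelve. all: by end_near. Qed.

End ReflectionPath.

(** * The limit functional *)

Section PointSums.
Context {R : realType}.
Notation TR := (measurableTypeR R).
Context (mu : {measure set TR -> \bar R}).
Implicit Types (A B : set TR) (f h : R -> R) (C : R).

(** This makes a sum over uncountably many times absolutely convergent: singletons are disjoint, so
    every finite sum of atoms is at most the mass of [A]. *)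
Definition atom_dominated A f C :=
  [/\ measurable A, (mu A < +oo)%E, 0 <= C &
      forall s, A s -> `|f s| <= C * mass mu `[s, s]].

Lemma esum_atoms A h C : measurable A -> (mu A < +oo)%E -> 0 <= C ->
  (forall s, A s -> 0 <= h s <= C * mass mu `[s, s]) ->
  (\esum_(s in A) (h s)%:E <= (C * mass mu A)%:E)%E.
Proof.
move=> mA fA C0 hC; apply: ge_ereal_sup => _ [F [finF FA] <-].
have atom s : A s -> mu `[s, s]%classic = (mass mu `[s, s])%:E.
  move=> As; rewrite fineK// ge0_fin_numE// (le_lt_trans _ fA)//.
  by apply: le_measure; rewrite ?inE// set_itv1 => _ ->.
apply: (@le_trans _ _ (\sum_(s \in F) C%:E * mu `[s, s]%classic)%E).
  apply: lee_fsum => // s Fs; have As := FA s Fs.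
  by rewrite (atom s As) -EFinM lee_fin; have /andP[] := hC s As.
rewrite -ge0_mule_fsumr//.
have trF : trivIset F (fun s : R => `[s, s]%classic : set TR).
  move=> s t _ _ [u [/=]]; rewrite !in_itv/= => /andP[su us] /andP[tu ut].
  by apply/eqP; rewrite eq_le (le_trans su ut) (le_trans tu us).
rewrite -measure_fin_bigcup//.
rewrite EFinM lee_wpmul2l ?lee_fin// /mass fineK ?ge0_fin_numE//.
apply: le_measure; rewrite ?inE//.
  by apply: fin_bigcup_measurable => // s _; exact: measurable_itv.
move=> s [t Ft /=]; rewrite in_itv/= => /andP[ts st].
by rewrite (_ : s = t); [exact: FA|apply/eqP; rewrite eq_le st].
Qed.

Let pos_le A f C : atom_dominated A f C ->
  (\esum_(s in A) (f^\+ s)%:E <= (C * mass mu A)%:E)%E.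
Proof.
move=> [mA fA C0 hf]; apply: esum_atoms => // s /hf h.
rewrite funrpos_ge0 /= (le_trans _ h)// /funrpos ge_max ler_norm/=.
exact: normr_ge0.
Qed.

Let neg_le A f C : atom_dominated A f C ->
  (\esum_(s in A) (f^\- s)%:E <= (C * mass mu A)%:E)%E.
Proof.
move=> [mA fA C0 hf]; apply: esum_atoms => // s /hf h.
rewrite funrneg_ge0 /= (le_trans _ h)// /funrneg ge_max -normrN ler_norm/=.
exact: normr_ge0.
Qed.

Let fin_esum A h C : (forall s, A s -> 0 <= h s) ->
  (\esum_(s in A) (h s)%:E <= C%:E)%E -> \esum_(s in A) (h s)%:E \is a fin_num.
Proof.
move=> h0 hC; rewrite ge0_fin_numE; first by rewrite (le_lt_trans hC)// ltry.
by apply: esum_ge0 => s /h0; rewrite lee_fin.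
Qed.

Lemma usum_norm_le A f C : atom_dominated A f C -> `|usum A f| <= C * mass mu A.
Proof.
move=> hA; have p1 := pos_le hA; have p2 := neg_le hA.
have q1 : 0 <= fine (\esum_(s in A) (f^\+ s)%:E).
  by apply/fine_ge0/esum_ge0 => s _; rewrite lee_fin funrpos_ge0.
have q2 : 0 <= fine (\esum_(s in A) (f^\- s)%:E).
  by apply/fine_ge0/esum_ge0 => s _; rewrite lee_fin funrneg_ge0.
have f1 := fin_esum (fun s _ => funrpos_ge0 f s) p1.
have f2 := fin_esum (fun s _ => funrneg_ge0 f s) p2.
rewrite -(fineK f1) lee_fin in p1; rewrite -(fineK f2) lee_fin in p2.
by rewrite /usum ler_norml; lra.
Qed.

Lemma usum_split A B f C : atom_dominated (A `|` B) f C -> A `&` B = set0 ->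
  usum (A `|` B) f = usum A f + usum B f.
Proof.
move=> hAB AB; have p1 := pos_le hAB; have p2 := neg_le hAB.
have f1 := fin_esum (fun s _ => funrpos_ge0 f s) p1.
have f2 := fin_esum (fun s _ => funrneg_ge0 f s) p2.
have EA : (A `|` B) `&` A = A by apply/setIidPr => s; left.
have EB : (A `|` B) `&` ~` A = B.
  rewrite setIUl setICr set0U; apply/setIidPl => s Bs As.
  by have : (A `&` B) s by []; rewrite AB.
have split h : (forall s, 0 <= h s) ->
    \esum_(s in A `|` B) (h s)%:E \is a fin_num ->
    fine (\esum_(s in A `|` B) (h s)%:E) =
    fine (\esum_(s in A) (h s)%:E) + fine (\esum_(s in B) (h s)%:E).
  move=> h0; rewrite (esumID A) => [|s _]; last by rewrite lee_fin.
  rewrite EA EB => /[dup] fAB; rewrite fin_numD => /andP[fA fB].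
  by rewrite fineD.
rewrite /usum (split _ (funrpos_ge0 f) f1) (split _ (funrneg_ge0 f) f2); lra.
Qed.

Lemma usum_point (t : R) f : usum `[t, t] f = f t.
Proof.
rewrite /usum set_itv1 !esum_set1 ?lee_fin ?funrpos_ge0 ?funrneg_ge0//=.
exact: (f_equal (fun F : R -> R => F t) (funrposBneg f)).
Qed.

End PointSums.

(** * Integrals of the integrand along a ray *)

Section RayIntegral.
Context {R : realType} {d : nat} (g : R -> 'rV[R]_d -> R).
Context (hg : {within [set p : R * 'rV[R]_d | 0 <= p.1],
  continuous (fun p => g p.1 p.2)}).
Notation TR := (measurableTypeR R).
Context (a : R) (a0 : 0 <= a) (z v : 'rV[R]_d).
Let h (r : R) := g a (z - r *: v).

Let ray_bound (l u r : R) : l <= r <= u ->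
  enorm (z - r *: v) <= enorm z + (`|l| + `|u|) * enorm v.
Proof.
move=> /andP[lr ru]; rewrite (le_trans (ler_enormB _ _))// lerD2l enormZ ler_wpM2r//.
rewrite ler_norml; have := ler_norm u; have := ler_norm (- l); rewrite normrN.
have := normr_ge0 u; have := normr_ge0 l; lra.
Qed.

Lemma ray_modulus (l u e : R) : 0 < e -> exists2 q, 0 < q &
  forall r r', l <= r <= u -> l <= r' <= u -> `|r - r'| <= q -> `|h r - h r'| <= e.
Proof.
move=> e0; have [q q0 hq] := integrand_modulus hg a (enorm z + (`|l| + `|u|) * enorm v) e0.
exists (q / (enorm v + 1)); first by rewrite divr_gt0// ltr_wpDl.
move=> r r' hr hr'; rewrite ler_pdivlMr ?ltr_wpDl// => rr.
apply: hq; rewrite ?lexx ?a0//; first exact: ray_bound.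
- exact: ray_bound.
- by rewrite subrr normr0 ltW.
have -> : z - r *: v - (z - r' *: v) = (r' - r) *: v.
  by apply/rowP => i; rewrite !mxE; ring.
by rewrite enormZ distrC (le_trans _ rr)// ler_wpM2l// lerDl.
Qed.

Lemma ray_bounded_on (A : set TR) (l u : R) : measurable A -> A `<=` `[l, u] ->
  bounded_on lebesgue_measure A h.
Proof.
move=> mA Alu; split => //.
- apply: (@le_lt_trans _ _ (lebesgue_measure (`[l, u]%classic : set TR))).
    by apply: le_measure; rewrite ?inE//; exact: measurable_itv.
  by rewrite lebesgue_measure_itv/=; case: ifP => // _; rewrite -EFinB ltry.
- have ch : continuous h.
    move=> r; apply/(@cvgrPdist_le _ _ _ (nbhs r)) => e e0.
    have [q q0 hq] := @ray_modulus (r - 1) (r + 1) e e0.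
    near=> r'; apply: hq; [lra| |].
      have : `|r - r'| <= 1 by near: r'; exact: (@cvgr_dist_le _ _ _ (nbhs r) _ id r cvg_id).
      by rewrite ler_norml; lra.
    by near: r'; exact: (@cvgr_dist_le _ _ _ (nbhs r) _ id r cvg_id).
  exact: measurable_funTS (continuous_measurable_fun ch).
have [C _ hC] := integrand_bounded hg a (enorm z + (`|l| + `|u|) * enorm v).
exists C => r /Alu /=; rewrite in_itv/= => hr.
by apply: hC; [rewrite lexx a0|exact: ray_bound].
Unshelve. all: by end_near. Qed.

End RayIntegral.

Lemma lebesgue_cc_fin {R : realType} (l u : R) :
  (lebesgue_measure (`[l, u]%classic : set (measurableTypeR R)) < +oo)%E.
Proof.
rewrite [X in (X < _)%E](lebesgue_measure_itv `[l, u]%R)/=.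
by case: ifP => // _; rewrite -EFinB ltry.
Qed.

Section RayPrimitive.
Context {R : realType} {d : nat} (g : R -> 'rV[R]_d -> R).
Context (hg : {within [set p : R * 'rV[R]_d | 0 <= p.1],
  continuous (fun p => g p.1 p.2)}).
Context (a : R) (a0 : 0 <= a) (z v : 'rV[R]_d) (m : R).
Let h (r : R) := g a (z - r *: v).

(* The upper end [m + 1] leaves room for a two-sided derivative at [0]. *)
Definition ray_primitive (c : R) : R :=
  \int[lebesgue_measure]_(r in `[m - c, m + 1[) g a (z - r *: v).

Lemma mass_lebesgue_co (l u : R) : l <= u ->
  mass lebesgue_measure (`[l, u[%classic : set (measurableTypeR R)) = u - l.
Proof.
move=> lu; rewrite /mass [X in fine X](lebesgue_measure_itv `[l, u[%R)/= lte_fin.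
by case: ltP => //= ul; apply/esym/eqP; rewrite subr_eq0 eq_le ul lu.
Qed.

Lemma ray_primitiveB (c1 c2 : R) : -1 <= c1 -> c1 <= c2 ->
  ray_primitive c2 - ray_primitive c1 =
  \int[lebesgue_measure]_(r in `[m - c2, m - c1[) g a (z - r *: v).
Proof.
move=> c1N c12; rewrite /ray_primitive.
have := @Rintegral_itv_split R lebesgue_measure (BLeft (m - c2)) (BLeft (m - c1))
  (BLeft (m + 1)) h.
rewrite !bnd_simp => H; rewrite {1}/h in H; rewrite H; [ring|lra|lra|].
apply: (ray_bounded_on hg a0 z v (l := m - c2) (u := m + 1)).
  exact: measurable_itv.
by move=> r /=; rewrite !in_itv/= => /andP[-> /ltW].
Qed.

Lemma ray_primitive_close (c1 c2 v0 e : R) : -1 <= c1 -> c1 <= c2 ->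
  (forall r, m - c2 <= r <= m - c1 -> `|h r - v0| <= e) ->
  `|ray_primitive c2 - ray_primitive c1 - v0 * (c2 - c1)| <= e * (c2 - c1).
Proof.
move=> c1N c12 he; rewrite (ray_primitiveB c1N c12).
have lu : m - c2 <= m - c1 by lra.
have E : c2 - c1 = mass lebesgue_measure
    (`[m - c2, m - c1[%classic : set (measurableTypeR R)).
  by rewrite mass_lebesgue_co//; ring.
rewrite E; apply: Rintegral_close.
  apply: (ray_bounded_on hg a0 z v (l := m - c2) (u := m - c1)).
    exact: measurable_itv.
  by move=> r /=; rewrite !in_itv/= => /andP[-> /ltW].
by move=> r /=; rewrite in_itv/= => /andP[h1 /ltW h2]; apply: he; rewrite h1.
Qed.

(** [c] is the distance travelled from [z - m *: v], so [z] is reached at [c = m] and the derivative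
    at [c0] is the integrand at [z - (m - c0) *: v]. *)
Lemma ray_primitive_expansion (c0 : R) : -1 < c0 -> forall e, 0 < e ->
  \forall c \near c0, `|ray_primitive c - ray_primitive c0 - h (m - c0) * (c - c0)|
    <= e * `|c - c0|.
Proof.
move=> c0N e e0.
have [q q0 hq] := ray_modulus hg a0 z v (m - c0 - 1) (m - c0 + 1) e0.
(* [q] is for the modulus, 1 keeps the parameters in the range on which it holds, and [c0 + 1] keeps
   [c] above [-1]. *)
pose b := Num.min (Num.min q 1) (c0 + 1).
have b0 : 0 < b by rewrite !lt_min q0 ltr01/=; lra.
have : \forall c \near c0, `|c0 - c| <= b.
  exact: (@cvgr_dist_le _ _ _ (nbhs c0) _ id c0 cvg_id).
apply: filterS => c; rewrite /b !le_min => /andP[/andP[hcq hc1] hc0].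
have [cc|cc] := leP c0 c.
  rewrite (ger0_norm (_ : 0 <= c - c0)) ?subr_ge0//.
  apply: ray_primitive_close => //; first lra.
  rewrite distrC ger0_norm ?subr_ge0// in hcq hc1.
  move=> r /andP[r1 r2]; apply: hq; [lra|lra|].
  by rewrite distrC ger0_norm; lra.
rewrite ger0_norm ?subr_ge0 ?(ltW cc)// in hcq hc1 hc0.
rewrite (ltr0_norm (_ : c - c0 < 0)) ?subr_lt0//.
have -> : `|ray_primitive c - ray_primitive c0 - h (m - c0) * (c - c0)| =
    `|ray_primitive c0 - ray_primitive c - h (m - c0) * (c0 - c)|.
  by rewrite -normrN; congr `|_|; ring.
rewrite opprB; apply: ray_primitive_close; [lra|exact: ltW|].
move=> r /andP[r1 r2]; apply: hq; [lra|lra|].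
by rewrite ger0_norm; lra.
Qed.

End RayPrimitive.

(** * The limit functional as a function of the time interval *)

Section LimitFunctional.
Context {R : realType} {d : nat} (D : set 'rV[R]_d).
Context (C2D : C2_domain D) (bndD : bounded_set D) (cvxD : convex_set D).
Context (y x k : R -> 'rV[R]_d) (sk : skorokhod_solution D y x k).
Context (g : R -> 'rV[R]_d -> R).
Context (hg : {within [set p : R * 'rV[R]_d | 0 <= p.1],
  continuous (fun p => g p.1 p.2)}).
Notation TR := (measurableTypeR R).
Let N s := normal D (x s).
Let mu0 := stieltjes (tvar0 k).
Let at_ s := mass mu0 `[s, s].
Implicit Types (A B : set TR) (a b t T : R).

Definition jump_cost s := \int[lebesgue_measure]_(r in `[0, enorm (jump k s)])
  gbar D g s (x s - r *: normal D (x s)).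
(** [I_lim] on an arbitrary set of times, so that it can be split along the links. *)
Definition limit_functional A :=
  \int[stieltjes (tvar0 k)]_(s in A) g s (x s) + usum A jump_cost.

Let cx : cadlag x. Proof. exact: sk_cadlag_x sk. Qed.

Lemma bounded_on_path T A : measurable A -> A `<=` `[0, T] ->
  bounded_on mu0 A (fun s => g s (x s)).
Proof.
move=> mA AT; have [T0|T0] := leP 0 T.
  apply: (right_cont_bounded_on (T := T)) => //.
  - exact: integrand_right_cont.
  - exact: (mu0_fin sk mA AT).
  - exact: integrand_path_bounded.
rewrite (_ : A = set0).
  by split; [exact: measurable0|rewrite measure0|exact: measurable_fun_set0|exists 0].
apply/seteqP; split => // s /AT /=.
by rewrite in_itv/= => /andP[/le_trans h /h]; rewrite leNgt T0.
Qed.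

Lemma jump_costE s : 0 <= s -> jump_cost s =
  \int[lebesgue_measure]_(r in `[0, at_ s]) (g s (x s - r *: N s) - g s (x s)).
Proof.
move=> s0; rewrite /jump_cost (enorm_jump C2D bndD cvxD sk s0).
apply: eq_Rintegral => r; rewrite inE/= in_itv/= => /andP[r0 _].
by rewrite /gbar proj_ray//; exact: sk_in sk _ s0.
Qed.

Let mass_cc (u : R) : 0 <= u -> mass lebesgue_measure (`[0, u]%classic : set TR) = u.
Proof.
move=> u0; rewrite /mass [X in fine X](lebesgue_measure_itv `[0%R, u]%R)/= lte_fin; case: ltP => h /=.
  by rewrite subr0.
by apply/eqP; rewrite eq_le u0 h.
Qed.

Lemma jump_cost_le s (e : R) : 0 <= s ->
  (forall r, 0 <= r <= at_ s -> `|g s (x s - r *: N s) - g s (x s)| <= e) ->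
  `|jump_cost s| <= e * at_ s.
Proof.
move=> s0 he; rewrite (jump_costE s0).
have m0 : 0 <= at_ s by exact: mass_ge0.
rewrite -{2}(mass_cc m0); apply: Rintegral_norm_le; last first.
  by move=> r /=; rewrite in_itv/= => /he.
apply: bounded_onD.
  apply: (ray_bounded_on hg s0 (x s) (N s) (l := 0) (u := at_ s)).
    exact: measurable_itv.
  exact: subset_refl.
apply: bounded_on_cst; first exact: measurable_itv.
exact: lebesgue_cc_fin.
Qed.

Lemma jump_cost_dominated T : 0 <= T -> exists C, forall A, measurable A ->
  A `<=` `[0, T] -> atom_dominated mu0 A jump_cost C.
Proof.
move=> T0; have [M M0 hM] := cadlag_bounded cx T0.
have mT : measurable (`[0%R, T]%classic : set TR) by exact: measurable_itv.
have [C C0 hC] := integrand_bounded hg T (M + mass mu0 `[0, T]).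
exists (C + C) => A mA AT; split => //; first exact: (mu0_fin sk mA AT).
  by rewrite addr_ge0// ltW.
move=> s /AT /=; rewrite in_itv/= => hs; have /andP[s0 sT] := hs.
apply: jump_cost_le => // r /andP[r0 rm].
have mle : at_ s <= mass mu0 `[0, T].
  apply: mass_le; [exact: measurable_itv|exact: measurable_itv| |]; last first.
    exact: (mu0_fin sk mT (@subset_refl _ _)).
  move=> u /=; rewrite !in_itv/= => /andP[/(le_trans s0) ->] /=.
  by move/le_trans; apply.
rewrite (le_trans (ler_normB _ _))// lerD//; apply: hC => //.
  rewrite (le_trans (ler_enormB _ _))// lerD ?hM// enormZ ger0_norm//.
  rewrite -[leRHS]mulr1 ler_pM//; first exact: le_trans rm mle.
  exact: (enorm_normal_le1 C2D cvxD).
by rewrite (le_trans (hM _ hs))// lerDl mass_ge0.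
Qed.

Lemma limit_functional_split (i j l : itv_bound R) T : 0 <= T ->
  (i <= j)%O -> (j <= l)%O -> [set` Interval i l] `<=` `[0, T] ->
  limit_functional [set` Interval i l] =
  limit_functional [set` Interval i j] + limit_functional [set` Interval j l].
Proof.
move=> T0 ij jl sub; have mI : measurable ([set` Interval i l] : set TR).
  exact: measurable_itv.
have [C hC] := jump_cost_dominated T0.
rewrite /limit_functional (Rintegral_itv_split ij jl); last exact: bounded_on_path sub.
have h := hC _ mI sub; rewrite (itv_bndbnd_setU ij jl) in h *.
rewrite (usum_split h); last exact: itv_disjoint.
by rewrite addrACA.
Qed.

Lemma limit_functional_point T : 0 <= T -> at_ T = 0 -> limit_functional `[T, T] = 0.
Proof.
move=> T0 m0; rewrite /limit_functional Rintegral_point usum_point.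
rewrite [X in _ * X](m0 : _) mulr0 add0r.
have := @jump_cost_le T 0 T0; rewrite mul0r => h.
suff : `|jump_cost T| <= 0 by rewrite normr_le0 => /eqP.
apply: h => r; rewrite m0 => /andP[r0 r0'].
have -> : r = 0 by apply/eqP; rewrite eq_le r0' r0.
by rewrite scale0r subr0 subrr normr0.
Qed.

(** The displacement of [kleft] along [nu] is the atom at [a] plus [c1], where [c1] is within
    [w * m1] of the mass [m1] of the open link. The three [e] come from the ray beyond [x a], the
    integral over []a, b[] and the jumps inside; [C * w] comes from exchanging [c1] and [m1]. *)
Lemma limit_functional_link a b (nu : 'rV[R]_d) (w e C : R) :
  0 <= a -> a < b -> enorm nu = 1 -> w <= 1 -> 0 <= e ->
  (boundary D (x a) -> nu = N a) ->
  (forall s, a < s < b -> boundary D (x s) -> enorm (N s - nu) <= w) ->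
  (forall s, a < s < b -> `|g s (x s) - g a (x a)| <= e) ->
  (forall s r, a < s < b -> 0 <= r <= at_ s ->
     `|g s (x s - r *: N s) - g s (x s)| <= e) ->
  (forall r, - mass mu0 `]a, b[ <= r <= 0 ->
     `|g a (x a - r *: nu) - g a (x a)| <= e) ->
  `|g a (x a)| <= C ->
  `|ray_primitive g a (x a) nu (at_ a) (dot nu (kleft D x k b - kleft D x k a))
    - ray_primitive g a (x a) nu (at_ a) 0 - limit_functional `[a, b[ |
   <= (3 * e + C * w) * mass mu0 `]a, b[.
Proof.
move=> a0 ab nu1 w1 e0 hnu hdir h1 h2 h3 hC.
have b0 : 0 <= b by rewrite (le_trans a0)// ltW.
set A : set TR := `]a, b[%classic; set m1 := mass mu0 A.
set c1 := dot nu (vintegral mu0 A N).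
have mA : measurable A by exact: measurable_itv.
have AT : A `<=` `[0, b].
  move=> s /=; rewrite !in_itv/= => /andP[as_ sb].
  by rewrite (le_trans a0) ?(ltW as_)// ltW.
have cosub : (`[a, b[%classic : set TR) `<=` `[0, b].
  move=> s /=; rewrite !in_itv/= => /andP[as_ sb].
  by rewrite (le_trans a0 as_) ltW.
have mpos : 0 <= at_ a by exact: mass_ge0.
have m1pos : 0 <= m1 by exact: mass_ge0.
have /andP[cl cu] : (1 - w) * m1 <= c1 <= m1.
  apply: (normal_mass C2D bndD cvxD sk mA AT nu1) => s.
  by rewrite /A/= in_itv/= => hs bs; exact: hdir.
have c1pos : 0 <= c1 by rewrite (le_trans _ cl)// mulr_ge0// subr_ge0.
have cinf : dot nu (kleft D x k b - kleft D x k a) = at_ a + c1.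
  rewrite (kleftB C2D bndD cvxD sk a0 (ltW ab)).
  rewrite (@vintegral_itv_split _ _ _ (BLeft a) (BRight a) (BLeft b)) ?bnd_simp//.
    rewrite dotDr vintegral_point dotZr; congr (_ + _); rewrite -/(at_ a).
    move: (mpos); rewrite le_eqVlt => /predU1P[m0|mpos']; first by rewrite -m0 mul0r.
    have bx := mass_point_boundary C2D bndD cvxD sk a0 mpos'.
    have [_ n1 _] := normal_inner C2D cvxD bx.
    by rewrite (hnu bx) -sqr_enorm n1 expr1n mulr1.
  by move=> i; apply: (bounded_on_normal C2D bndD cvxD sk i _ cosub); exact: measurable_itv.
rewrite cinf.
(* The ray integral over [[0, m]] is the contribution of the jump at [a]. *)
have jumpa : ray_primitive g a (x a) nu (at_ a) (at_ a) -
    ray_primitive g a (x a) nu (at_ a) 0 = g a (x a) * at_ a + jump_cost a.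
  rewrite (ray_primitiveB hg a0) ?lerN10// subrr subr0 (jump_costE a0).
  move: (mpos); rewrite le_eqVlt => /predU1P[m0|mpos'].
    by rewrite -m0 set_itvco0 Rintegral_set0 mulr0 add0r set_itv1 Rintegral_set1.
  have bx := mass_point_boundary C2D bndD cvxD sk a0 mpos'.
  rewrite (hnu bx).
  have bray : bounded_on lebesgue_measure (`[0%R, at_ a]%classic : set TR)
      (fun r => g a (x a - r *: N a)).
    apply: (ray_bounded_on hg a0 (x a) (N a) (l := 0) (u := at_ a)).
      exact: measurable_itv.
    exact: subset_refl.
  have mcc : measurable (`[0%R, at_ a]%classic : set TR) by exact: measurable_itv.
  have bcst : bounded_on lebesgue_measure (`[0%R, at_ a]%classic : set TR)
      (fun=> g a (x a)).
    apply: bounded_on_cst => //.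
    exact: lebesgue_cc_fin.
  rewrite RintegralB//; try exact: bounded_on_integrable.
  rewrite Rintegral_cst// -/(mass _ _) (mass_cc mpos) addrCA subrr addr0.
  apply: Rintegral_itv_bndo_bndc.
  have := bounded_on_integrable bray; apply: integrableS => //.
  by move=> s /=; rewrite !in_itv/= => /andP[-> /ltW].
have tail : `|ray_primitive g a (x a) nu (at_ a) (at_ a + c1) -
    ray_primitive g a (x a) nu (at_ a) (at_ a) - g a (x a) * c1| <= e * c1.
  have := @ray_primitive_close R d g hg a a0 (x a) nu (at_ a) (at_ a) (at_ a + c1) (g a (x a)) e.
  have -> : at_ a + c1 - at_ a = c1 by ring.
  apply; [lra|lra|] => r /andP[r1 r2].
  by apply: h3; rewrite -/A -/m1; lra.
have bA := bounded_on_path mA AT.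
have cont : `|\int[mu0]_(s in A) g s (x s) - g a (x a) * m1| <= e * m1.
  by apply: Rintegral_close => // s /=; rewrite /A/= in_itv/=; exact: h1.
have us : `|usum A jump_cost| <= e * m1.
  apply: usum_norm_le; split => //; first exact: (mu0_fin sk mA AT).
  move=> s /=; rewrite /A/= in_itv/= => hs; apply: jump_cost_le.
    by rewrite (le_trans a0)// ltW//; case/andP: hs.
  by move=> r hr; exact: h2.
rewrite (@limit_functional_split (BLeft a) (BRight a) (BLeft b) b) ?bnd_simp//.
rewrite {1}/limit_functional Rintegral_point usum_point -/(at_ a).
rewrite /limit_functional -/A.
have hw : `|g a (x a) * (c1 - m1)| <= C * w * m1.
  rewrite normrM -mulrA; apply: ler_pM => //.
  by rewrite distrC ger0_norm ?subr_ge0//; lra.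
have ec : e * c1 <= e * m1 by rewrite ler_wpM2l.
move: jumpa tail cont us hw ec; rewrite -/mu0.
move: (ray_primitive _ _ _ _ _ _) (ray_primitive _ _ _ _ _ _)
  (ray_primitive _ _ _ _ _ _) (\int[mu0]_(s in A) _) (usum _ _) (jump_cost a) => X Y Z V U W.
rewrite mulrBr !ler_norml; lra.
Qed.

End LimitFunctional.

Lemma unit_vector_exists {R : realType} {d : nat} : (0 < d)%N ->
  exists v : 'rV[R]_d, enorm v = 1.
Proof.
case: d => // d _; exists (delta_mx 0 ord0).
rewrite enormE /dot (bigD1 ord0)//= big1 => [|i i0].
  by rewrite !mxE !eqxx mulr1 addr0 sqrtr1.
by rewrite !mxE eqxx (negbTE i0) mulr0.
Qed.

(* Off the boundary the direction is that of some nearby boundary point, if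
   there is any. *)
Lemma direction_modulus {R : realType} {d : nat} (D : set 'rV[R]_d) (w : R) :
  C2_domain D -> bounded_set D -> convex_set D -> (0 < d)%N -> 0 < w ->
  exists2 r, 0 < r & forall z, exists nu,
    [/\ enorm nu = 1, boundary D z -> nu = normal D z
      & forall z', boundary D z' -> enorm (z' - z) <= r ->
          enorm (normal D z' - nu) <= w].
Proof.
move=> C2D bndD cvxD d0 w0.
have [r r0 hr] := normal_unif_continuous C2D bndD cvxD w0.
exists (r / 2) => [|z]; first by rewrite divr_gt0.
have [bz|nbz] := pselect (boundary D z).
  exists (normal D z); have [_ n1 _] := normal_inner C2D cvxD bz.
  split; [exact: n1|by []|move=> z' bz' h].
  by apply: hr => //; apply: (le_trans h); rewrite ler_pdivrMr// ler_peMr ?ler1n// ltW.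
have [[z1 [bz1 hz1]]|none] := pselect (exists z1, boundary D z1 /\ enorm (z1 - z) <= r / 2).
  exists (normal D z1); have [_ n1 _] := normal_inner C2D cvxD bz1.
  split; [exact: n1|by move/nbz|move=> z' bz' h].
  apply: hr => //; rewrite (le_trans (ler_enorm_dist z _ _))// (enormB z); lra.
have [v v1] := @unit_vector_exists R d d0; exists v; split; [exact: v1|by move/nbz|move=> z' bz' h].
by case: none; exists z'.
Qed.

(** * Penalized equation on a link *)

Section TimeChange.
Context {R : realType} (l : R -> R) (tc : time_change l).
Implicit Types (a b t u : R).

Lemma time_change_lt a b : 0 <= a -> a < b -> l a < l b.
Proof.
case: tc => _ h _ _ a0 ab; apply: h => //; rewrite in_itv/= andbT//.
by rewrite (le_trans a0)// ltW.
Qed.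

Lemma time_change_le a b : 0 <= a -> a <= b -> l a <= l b.
Proof.
move=> a0; rewrite le_eqVlt => /predU1P[->//|ab].
by apply: ltW; exact: time_change_lt.
Qed.

Lemma time_change_ge0 a : 0 <= a -> 0 <= l a.
Proof. by case: (tc) => l0 _ _ _ a0; rewrite -l0; exact: time_change_le. Qed.

Lemma time_change_surj a b u : 0 <= a -> 0 <= b -> l a <= u < l b ->
  exists2 t, a <= t < b & l t = u.
Proof.
move=> a0 b0 /andP[au ub]; have u0 : 0 <= u := le_trans (time_change_ge0 a0) au.
have [_ _ _ im] := tc; have : `[0, +oo[%classic u by rewrite /= in_itv/= andbT.
rewrite -im => -[t /=]; rewrite in_itv/= andbT => t0 tu; exists t => //.
apply/andP; split.
  by rewrite leNgt; apply/negP => /(time_change_lt t0); rewrite tu ltNge au.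
by rewrite ltNge; apply/negP => /(time_change_le b0); rewrite tu leNgt ub.
Qed.

(** Surjectivity supplies a time before [b] whose image is slightly to the left of [l b];
    monotonicity does the rest. *)
Lemma time_change_left b (P : R -> Prop) : 0 < b ->
  (\forall u \near (l b)^'-, P u) -> \forall t \near b^'-, P (l t).
Proof.
move=> b0 /nbhs_leftP[r r0 hr].
have l0b : l 0 < l b by exact: time_change_lt.
have l00 : l 0 = 0 by case: tc.
pose u := Num.max 0 (l b - r / 2).
have [|t /andP[t0 tb] tu] := @time_change_surj 0 b u (lexx 0) (ltW b0).
  by rewrite /u le_max l00 lexx/= gt_max -{1}l00 l0b/=; lra.
apply/nbhs_leftP; exists (b - t); first by rewrite subr_gt0.
move=> v; rewrite subKr => /andP[tv vb]; apply: hr.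
rewrite (time_change_lt (le_trans t0 (ltW tv)) vb) andbT.
apply: lt_trans (time_change_lt t0 tv); rewrite tu lt_max; apply/orP; right; lra.
Qed.

End TimeChange.

(** * The Skorokhod solution on a link *)

Section ReflectedLink.
Context {R : realType} {d : nat} (D : set 'rV[R]_d).
Context (C2D : C2_domain D) (bndD : bounded_set D) (cvxD : convex_set D).
Context (y x k : R -> 'rV[R]_d) (sk : skorokhod_solution D y x k).
Context (a b e : R) (a0 : 0 <= a) (ab : a < b) (lk : link e y x a b).
Notation TR := (measurableTypeR R).
Let mu0 := stieltjes (tvar0 k).
Let N s := normal D (x s).
Let b0 : 0 < b. Proof. exact: le_lt_trans ab. Qed.

Lemma kleft_link : enorm (kleft D x k b - k a) <= 2 * e.
Proof.
have [_ sy sx] := lk; apply/ler_addgt0Pr => q q0.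
have /enorm_cvg /(_ q q0) h1 := kleft_cvg C2D bndD cvxD sk b0.
have : \forall t \near b^'-, enorm (kleft D x k b - k a) <= 2 * e + q.
  near=> t.
  have h2 : enorm (k t - kleft D x k b) <= q by near: t; exact: h1.
  have at_ : a <= t by near: t; exact: nbhs_left_ge.
  have tb : t < b by near: t; exact: nbhs_left_lt.
  rewrite (le_trans (ler_enorm_dist (k t) _ _))// addrC (enormB _ (k t)); apply: lerD => //.
  have t0 : 0 <= t := le_trans a0 at_.
  have kE u : 0 <= u -> k u = x u - y u.
    by move=> u0; rewrite (sk_eq sk u0) addrAC subrr add0r.
  rewrite !kE//.
  have -> : x t - y t - (x a - y a) = (x t - x a) - (y t - y a).
    by apply/rowP => i; rewrite !mxE; ring.
  rewrite (le_trans (ler_enormB _ _))//.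
  have := sy t; have := sx t; rewrite at_ tb => /(_ isT) ? /(_ isT) ?; lra.
by move=> /nbhs_leftP[r r0 h]; apply: (h (b - r / 2)); lra.
Unshelve. all: by end_near. Qed.

Let co_sub : (`[a, b[%classic : set TR) `<=` `[0, b].
Proof.
move=> s /=; rewrite !in_itv/= => /andP[as_ sb].
by rewrite (le_trans a0 as_) ltW.
Qed.

Let oo_sub : (`]a, b[%classic : set TR) `<=` `[0, b].
Proof.
move=> s /=; rewrite !in_itv/= => /andP[as_ sb].
by rewrite (le_trans a0 (ltW as_)) ltW.
Qed.

Let kleft_open : vintegral mu0 `]a, b[ N = kleft D x k b - k a.
Proof.
have := kleftB C2D bndD cvxD sk a0 (ltW ab).
rewrite (@vintegral_itv_split _ _ _ (BLeft a) (BRight a) (BLeft b)) ?bnd_simp//.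
  rewrite vintegral_point -(reflection_jump C2D bndD cvxD sk a0) => E.
  apply/(addrI (k a - kleft D x k a)); apply: (etrans (esym E)).
  by rewrite [RHS]addrC addrA subrK.
by move=> i; apply: (bounded_on_normal C2D bndD cvxD sk i _ co_sub); exact: measurable_itv.
Qed.

Context (nu : 'rV[R]_d) (w rd : R) (nu1 : enorm nu = 1) (w2 : w <= 1 / 2)
  (hnu : boundary D (x a) -> nu = N a)
  (hdir : forall z, boundary D z -> enorm (z - x a) <= rd ->
     enorm (normal D z - nu) <= w)
  (erd : e <= rd).

Let dir s : a <= s < b -> boundary D (x s) -> enorm (N s - nu) <= w.
Proof.
have [_ _ sx] := lk; move=> hs bs; apply: hdir => //; apply: le_trans erd.
exact: sx.
Qed.

(** With [w] at most [1 / 2] the pushes cannot cancel: the mass is at most twice the displacement of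
    [k], and the latter is at most [2 * e] because [k = x - y]. In particular all jumps inside a
    link are small. *)
Lemma mass_link : mass mu0 `]a, b[ <= 4 * e.
Proof.
have mA : measurable (`]a, b[%classic : set TR) by exact: measurable_itv.
have hA s : (`]a, b[%classic : set TR) s -> boundary D (x s) -> enorm (N s - nu) <= w.
  by rewrite /= in_itv/= => /andP[/ltW as_ sb]; apply: dir; rewrite as_.
have /andP[+ _] := normal_mass C2D bndD cvxD sk mA oo_sub nu1 hA.
have -> : vintegral (stieltjes (tvar0 k)) `]a, b[ (fun s => normal D (x s)) =
  kleft D x k b - k a by exact: kleft_open.
have := kleft_link; have := cauchy_schwarz nu (kleft D x k b - k a).
rewrite nu1 mul1r; have := mass_ge0 (stieltjes (tvar0 k)) `]a, b[; rewrite -/mu0.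
move: (mass mu0 _) (dot _ _) (enorm _) => m c q m0 h1 h2 h3.
have : 1 / 2 * m <= (1 - w) * m.
  by apply: ler_wpM2r => //; have := w2; lra.
lra.
Qed.

Let w1 : w <= 1.
Proof. have := w2; lra. Qed.

Lemma kleft_direction_ge0 : 0 <= dot nu (kleft D x k b - kleft D x k a).
Proof.
rewrite (kleftB C2D bndD cvxD sk a0 (ltW ab)).
have mA : measurable (`[a, b[%classic : set TR) by exact: measurable_itv.
have hA s : (`[a, b[%classic : set TR) s -> boundary D (x s) -> enorm (N s - nu) <= w.
  by rewrite /= in_itv/=; exact: dir.
have /andP[h _] := normal_mass C2D bndD cvxD sk mA co_sub nu1 hA.
by apply: le_trans h; rewrite mulr_ge0 ?mass_ge0// subr_ge0.
Qed.

Let at_le s : a < s < b -> mass mu0 `[s, s] <= 4 * e.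
Proof.
move=> /andP[as_ sb]; apply: le_trans mass_link.
apply: mass_le; [exact: measurable_itv|exact: measurable_itv| |].
  move=> u /=; rewrite !in_itv/= => /andP[su us].
  by rewrite (lt_le_trans as_ su)/= (le_lt_trans us).
by apply: (mu0_fin sk _ oo_sub); exact: measurable_itv.
Qed.

Context (g : R -> 'rV[R]_d -> R).
Context (hg : {within [set q : R * 'rV[R]_d | 0 <= q.1],
  continuous (fun q => g q.1 q.2)}).
Context (Tg Mg C kap rg : R)
  (hC : forall s z, 0 <= s <= Tg -> enorm z <= Mg -> `|g s z| <= C)
  (hmod : forall s s' z z', 0 <= s <= Tg -> 0 <= s' <= Tg ->
     enorm z <= Mg -> enorm z' <= Mg -> `|s - s'| <= rg -> enorm (z - z') <= rg ->
     `|g s z - g s' z'| <= kap)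
  (bTg : b <= Tg) (hxM : forall s, a <= s < b -> enorm (x s) + rg <= Mg)
  (kap0 : 0 <= kap) (e0 : 0 <= e) (erg : 4 * e <= rg).

Lemma limit_functional_steady :
  `|ray_primitive g a (x a) nu (mass mu0 `[a, a])
      (dot nu (kleft D x k b - kleft D x k a)) -
    ray_primitive g a (x a) nu (mass mu0 `[a, a]) 0 - limit_functional D x k g `[a, b[ |
  <= (3 * kap + C * w) * mass mu0 `]a, b[.
Proof.
have [ba _ sx] := lk; have erg' : e <= rg by move: (e0) (erg); lra.
have rg0 : 0 <= rg := le_trans e0 erg'.
have inT s : a <= s < b -> 0 <= s <= Tg.
  by move=> /andP[as_ sb]; rewrite (le_trans a0)//= (le_trans (ltW sb)).
have ha : a <= a < b by rewrite lexx.
have xM s : a <= s < b -> enorm (x s) <= Mg.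
  by move=> /hxM; apply: le_trans; rewrite lerDl.
have oc s : a < s < b -> a <= s < b by move=> /andP[/ltW-> ->].
apply: (limit_functional_link C2D bndD cvxD sk hg a0 ab nu1 w1 kap0 hnu).
- by move=> s /oc; exact: dir.
- move=> s /oc hs; apply: hmod; [exact: inT|exact: inT|exact: xM|exact: xM| |].
    have /andP[as_ sb] := hs; rewrite ger0_norm ?subr_ge0//; lra.
  by apply: le_trans erg'; exact: sx.
- move=> s r hs /andP[r0 rs].
  have hr : enorm (r *: normal D (x s)) <= rg.
    rewrite enormZ ger0_norm//; apply: (@le_trans _ _ r).
      by rewrite ler_piMr// (enorm_normal_le1 C2D cvxD).
    by apply: (le_trans rs); apply: le_trans erg; exact: at_le.
  have {}hs := oc _ hs.
  apply: hmod; [exact: inT|exact: inT| |exact: xM| |].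
  + rewrite (le_trans (ler_enormB _ _))// (le_trans _ (hxM hs))// lerD2l.
    exact: hr.
  + by rewrite subrr normr0.
  + by rewrite addrAC subrr add0r enormN.
- move=> r /andP[r1 r2].
  have hr : enorm (r *: nu) <= rg.
    rewrite enormZ nu1 mulr1 ler0_norm//; apply: le_trans erg.
    by apply: le_trans mass_link; rewrite lerNl.
  apply: hmod; [exact: inT|exact: inT| |exact: xM| |].
  + rewrite (le_trans (ler_enormB _ _))// (le_trans _ (hxM ha))// lerD2l.
    exact: hr.
  + by rewrite subrr normr0.
  + by rewrite addrAC subrr add0r enormN.
- by apply: hC; [exact: inT|exact: xM].
Qed.

End ReflectedLink.

(** [u] is the difference of the reflection terms at the end of a link, [v] and [w] are their
    increments, and [z] is the approximation of [u] at which the signs of the products are known. *)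
Lemma dot_step {R : realType} {d : nat} (u z v w : 'rV[R]_d) (a1 a2 b1 b2 : R) :
  dot z v <= a1 -> dot (u - z) v <= a2 -> - b1 <= dot z w -> dot (z - u) w <= b2 ->
  dot u u <= dot (u - (v - w)) (u - (v - w)) + 2 * (a1 + a2 + b1 + b2).
Proof.
have : dot u u + dot (v - w) (v - w) = dot (u - (v - w)) (u - (v - w)) +
    2 * (dot (u - z) v + dot z v + dot (z - u) w - dot z w) by dot_ring.
have := dot_ge0 (v - w); lra.
Qed.

(** * The time-changed penalized path on a link *)

Section TimeChangedLink.
Context {R : realType} {d : nat} (D : set 'rV[R]_d).
Context (C2D : C2_domain D) (bndD : bounded_set D) (cvxD : convex_set D).
Context (n : nat) (n0 : (0 < n)%N) (Y X V : R -> 'rV[R]_d)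
  (pen : penalized_solution D n Y X V).
Context (l : R -> R) (tc : time_change l).
Context (y : R -> 'rV[R]_d) (a b e del : R) (a0 : 0 <= a) (ab : a < b)
  (sy : steady e y a b)
  (hdel : forall t, a <= t < b -> enorm (Y (l t) - y t) <= del).
Notation TR := (measurableTypeR R).
Let A := pen_mass D n X.
Let v u := X (l a) + (V u - V (l a)).
Let p u := proj D (X u).

Let la0 : 0 <= l a. Proof. exact: time_change_ge0. Qed.
Let b0 : 0 <= b. Proof. exact: ltW (le_lt_trans a0 ab). Qed.
Let lab : l a < l b. Proof. exact: time_change_lt. Qed.
Let lb0 : 0 <= l b. Proof. exact: time_change_ge0. Qed.
Let n0' : 0 < n%:R :> R. Proof. by rewrite ltr0n. Qed.

Lemma link_vprim : vprim (l a) (l b) V (fun u => n%:R *: (p u - X u)).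
Proof. exact: vprimS la0 (lexx _) (vprim_pen C2D bndD cvxD pen lb0). Qed.

Lemma link_rprim : rprim (l a) (l b) A (fun u => n%:R * enorm (X u - p u)).
Proof. exact: rprimS la0 (lexx _) (rprim_pen_mass C2D bndD cvxD pen lb0). Qed.

Lemma link_increment : enorm (V (l b) - V (l a)) <= A (l b) - A (l a).
Proof. exact: (enorm_increment_le n0' link_vprim link_rprim (lexx _) (ltW lab) (lexx _)). Qed.

(** [X - v] is the increment of [Y] since the start of the link: at most [e] from [y], and one J1
    error [del] at each of the two times. *)
Lemma link_noise u : l a <= u < l b -> enorm (X u - v u) <= e + 2 * del.
Proof.
move=> hu; have [t ht tu] := time_change_surj tc a0 b0 hu.
have u0 : 0 <= u by rewrite (le_trans la0)//; case/andP: hu.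
rewrite /v (pen_eq pen u0) (pen_eq pen la0).
have -> : Y u + V u - (Y (l a) + V (l a) + (V u - V (l a))) =
    (Y (l t) - y t) + ((y t - y a) - (Y (l a) - y a)).
  by rewrite tu; apply/rowP => i; rewrite !mxE; ring.
rewrite (le_trans (ler_enormD _ _))//.
have := hdel ht; have := hdel (t := a); rewrite lexx ab => /(_ isT).
have := sy ht; have := ler_enormB (y t - y a) (Y (l a) - y a); lra.
Qed.

Lemma link_decrease q r : (forall w, enorm (w - q) <= r -> D w) -> 0 <= r ->
  e + 2 * del <= r / 2 ->
  dot (v (l b) - q) (v (l b) - q) + r * (A (l b) - A (l a)) <=
  dot (X (l a) - q) (X (l a) - q).
Proof.
move=> hr r0 er.
have := mass_decrease C2D bndD cvxD n0' link_vprim link_rprim (fun=> erefl)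
  link_noise hr r0 er (lexx _) (ltW lab) (lexx _).
by rewrite subrr addr0.
Qed.

Lemma link_mass_bound q r : (forall w, enorm (w - q) <= r -> D w) -> 0 <= r ->
  e + 2 * del <= r / 2 -> r * (A (l b) - A (l a)) <= enorm (X (l a) - q) ^+ 2.
Proof.
move=> hr r0 er; rewrite sqr_enorm; have := link_decrease hr r0 er.
by have := dot_ge0 (v (l b) - q); lra.
Qed.

(** Expanding the square in [link_decrease] keeps the displacement as a factor, so a small
    displacement forces a small variation. *)
Lemma link_mass_displacement q r : (forall w, enorm (w - q) <= r -> D w) -> 0 <= r ->
  e + 2 * del <= r / 2 ->
  r * (A (l b) - A (l a)) <=
  2 * (enorm (X (l a) - q) * enorm (V (l b) - V (l a))).
Proof.
move=> hr r0 er; have := link_decrease hr r0 er.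
have -> : v (l b) - q = (X (l a) - q) + (V (l b) - V (l a)) by rewrite /v addrAC.
move: (X (l a) - q) (V (l b) - V (l a)) => u w.
rewrite !dotE (dotC w u); have := dot_ge0 w.
have := cauchy_schwarz_norm u w; rewrite ler_norml => /andP[]; lra.
Qed.

Context (x k : R -> 'rV[R]_d) (sk : skorokhod_solution D y x k)
  (sx : steady e x a b).
Context (theta B M : R) (theta0 : 0 < theta) (theta1 : theta <= 1)
  (het : e + 2 * del <= theta ^+ 2)
  (hB : enorm (X (l a) - p (l a)) <= B) (hM : A (l b) - A (l a) <= M).
Let K := 2 + B + 2 * M.

Let noise u : l a <= u < l b -> enorm (X u - v u) <= theta ^+ 2.
Proof. by move=> /link_noise /le_trans; apply. Qed.

Lemma link_late_path u : l a + (n%:R * theta ^+ 2)^-1 <= u -> u < l b ->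
  enorm (X u - p (l a)) <= K * theta.
Proof.
exact: (late_path C2D bndD cvxD n0' (ltW lab) link_vprim link_rprim
  (v := v) (fun=> erefl) noise theta0 theta1 erefl hB hM).
Qed.

Lemma link_proj_oscillation u : l a <= u < l b ->
  enorm (p u - p (l a)) <= K * theta.
Proof.
exact: (proj_oscillation C2D bndD cvxD n0' (ltW lab) link_vprim link_rprim
  (v := v) (fun=> erefl) noise theta0 theta1 erefl hB hM).
Qed.

Let Kd t := V (l t) - kleft D x k t.
Let mu0 := stieltjes (tvar0 k).

(** The two equations are subtracted just before [b], where [X (l t)] is close to [p (l a)] and
    [x t] to [x a], and then [t] tends to [b] from the left. [K * theta], [e] and [del] add up to
    [(K + 2) * theta]. *)
Lemma late_difference : l a + (n%:R * theta ^+ 2)^-1 < l b -> e <= theta ->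
  del <= theta -> enorm (Kd b - (p (l a) - x a)) <= (K + 2) * theta.
Proof.
move=> late et dt; apply/ler_addgt0Pr => q q0; have q2 : 0 < q / 2 by lra.
have bpos : 0 < b := le_lt_trans a0 ab.
have /enorm_cvg /(_ _ q2) h1 := kleft_cvg C2D bndD cvxD sk bpos.
have h2 : \forall u \near (l b)^'-, enorm (V u - V (l b)) <= q / 2.
  have [_ hA] := link_rprim; have hb : l a < l b <= l b by rewrite lab lexx.
  have /cvgrPdist_le /(_ _ q2) hA' := hA _ hb.
  near=> u; have ul : l a <= u by near: u; exact: nbhs_left_ge.
  have ub : u <= l b by near: u; exact: nbhs_left_le.
  rewrite enormB (le_trans (enorm_increment_le n0' link_vprim link_rprim ul ub (lexx _)))//.
  by rewrite (le_trans (ler_norm _))//; near: u; exact: hA'.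
have h3 := time_change_left tc bpos h2.
have h4 := time_change_left tc bpos (nbhs_left_ge late).
have : \forall t \near b^'-, enorm (Kd b - (p (l a) - x a)) <= (K + 2) * theta + q.
  near=> t.
  have at_ : a <= t by near: t; exact: nbhs_left_ge.
  have tb : t < b by near: t; exact: nbhs_left_lt.
  have t0 : 0 <= t := le_trans a0 at_.
  have e1 : enorm (k t - kleft D x k b) <= q / 2 by near: t; exact: h1.
  have e2 : enorm (V (l t) - V (l b)) <= q / 2 by near: t; exact: h3.
  have e3 : l a + (n%:R * theta ^+ 2)^-1 <= l t by near: t; exact: h4.
  have e4 := link_late_path e3 (time_change_lt tc t0 tb).
  have ht : a <= t < b by rewrite at_.
  have e5 := sx ht; have e6 := hdel ht.
  have -> : Kd b - (p (l a) - x a) = ((k t - kleft D x k b) - (V (l t) - V (l b))) +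
      ((X (l t) - p (l a)) - (x t - x a) - (Y (l t) - y t)).
    rewrite /Kd (pen_eq pen (time_change_ge0 tc t0)) (sk_eq sk t0).
    by apply/rowP => i; rewrite !mxE; ring.
  rewrite (le_trans (ler_enormD _ _))//.
  have := ler_enormB (k t - kleft D x k b) (V (l t) - V (l b)).
  have := ler_enormB (X (l t) - p (l a) - (x t - x a)) (Y (l t) - y t).
  have := ler_enormB (X (l t) - p (l a)) (x t - x a); lra.
by move=> /nbhs_leftP[r r0 h]; apply: (h (b - r / 2)); lra.
Unshelve. all: by end_near. Qed.

(* [|K b|^2 - |K a|^2 <= 2 K b (K b - K a)], and [K b] is close to the difference
   of two points of [closure D] on which both reflection terms almost act. *)
Lemma link_reflection_step : l a + (n%:R * theta ^+ 2)^-1 < l b -> e <= theta ->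
  del <= theta ->
  dot (Kd b) (Kd b) <= dot (Kd a) (Kd a) +
    (4 * K + 4) * theta * (A (l b) - A (l a) + mass mu0 `[a, b[).
Proof.
move=> late et dt; have hK := late_difference late et dt.
set z := p (l a) - x a in hK; set dV := V (l b) - V (l a).
set dk := kleft D x k b - kleft D x k a.
have mA : measurable (`[a, b[%classic : set TR) by exact: measurable_itv.
have sub : (`[a, b[%classic : set TR) `<=` `[0, b].
  move=> s /=; rewrite !in_itv/= => /andP[as_ sb].
  by rewrite (le_trans a0 as_) ltW.
have h1 : dot z dV <= K * theta * (A (l b) - A (l a)).
  exact: (normal_pairing C2D bndD cvxD n0' (ltW lab) link_vprim link_rprim
    (v := v) (fun=> erefl) noise theta0 theta1 erefl hB hM
    (sk_in sk a0) (lexx _) (ltW lab) (lexx _)).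
have D_neq0 : D !=set0 by case: C2D.
have h2 : - (e * mass mu0 `[a, b[) <= dot z dk.
  rewrite /dk (kleftB C2D bndD cvxD sk a0 (ltW ab)).
  apply: (reflection_pairing C2D bndD cvxD sk mA sub (@proj_in _ _ _ D_neq0 bndD _)).
  by move=> s /=; rewrite in_itv/=; exact: sx.
have h3 : enorm dk <= mass mu0 `[a, b[.
  rewrite /dk (kleftB C2D bndD cvxD sk a0 (ltW ab)) -[leRHS]mul1r.
  apply: vintegral_le_mass => //.
  - exact: (mu0_fin sk mA sub).
  - by move=> i; exact: (bounded_on_normal C2D bndD cvxD sk i mA sub).
  - by move=> s _; exact: (enorm_normal_le1 C2D cvxD).
have h4 := link_increment; rewrite -/dV in h4.
have h5 : Kd a = Kd b - (dV - dk).
  by rewrite /Kd /dV /dk; apply/rowP => i; rewrite !mxE; ring.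
have h6 : dot (Kd b - z) dV <= (K + 2) * theta * (A (l b) - A (l a)) by exact: dot_le.
have h7 : dot (z - Kd b) dk <= (K + 2) * theta * mass mu0 `[a, b[.
  by apply: dot_le => //; rewrite enormB.
have m0 : 0 <= mass mu0 `[a, b[ by exact: mass_ge0.
(* The mass of the limit comes with the coefficient [2 * K + 6], that of the penalized path with
   [4 * K + 4]; this bound allows a common one. *)
have K2 : 2 <= K.
  have := le_trans (enorm_ge0 _) hB; have := le_trans (enorm_ge0 _) (le_trans h4 hM).
  by rewrite /K; lra.
have h8 : e * mass mu0 `[a, b[ <= theta * mass mu0 `[a, b[ by rewrite ler_wpM2r.
have h9 : 2 * (theta * mass mu0 `[a, b[) <= K * (theta * mass mu0 `[a, b[).
  by rewrite ler_wpM2r// mulr_ge0// ltW.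
have := dot_step h1 h6 h2 h7; rewrite -h5 => /le_trans; apply; rewrite lerD2l.
clear h1 h2 h3 h4 h5 h6 h7 hK; move: m0 h8 h9.
move: (mass mu0 _) (A (l b) - A (l a)) => m dA m0 h8 h9.
have : 0 <= theta * m by rewrite mulr_ge0 // ltW.
lra.
Qed.

Context (g : R -> 'rV[R]_d -> R).
Context (hg : {within [set q : R * 'rV[R]_d | 0 <= q.1],
  continuous (fun q => g q.1 q.2)}).
Context (Tg Mg C kap rg : R)
  (hC : forall s z, 0 <= s <= Tg -> enorm z <= Mg -> `|g s z| <= C)
  (hmod : forall s s' z z', 0 <= s <= Tg -> 0 <= s' <= Tg ->
     enorm z <= Mg -> enorm z' <= Mg -> `|s - s'| <= rg -> enorm (z - z') <= rg ->
     `|g s z - g s' z'| <= kap).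
Context (nu : 'rV[R]_d) (w rd h : R) (nu1 : enorm nu = 1) (w0 : 0 <= w) (w1 : w <= 1)
  (hnu : boundary D (x a) -> nu = normal D (x a))
  (hdir : forall z, boundary D z -> enorm (z - x a) <= rd ->
     enorm (normal D z - nu) <= w)
  (hp : enorm (p (l a) - x a) <= rd / 2) (hKt : K * theta <= rd / 2)
  (hX : enorm (X (l a) - (y a + kleft D x k a)) <= h)
  (hrg : theta ^+ 2 + 2 * w * M + h <= rg)
  (aTg : a <= Tg) (bTg : l b <= Tg)
  (hua : forall u, l a <= u < l b -> `|u - a| <= rg)
  (hXM : forall u, l a <= u < l b -> enorm (X u) <= Mg)
  (hxM : enorm (x a) + mass mu0 `[a, a] + M <= Mg).
Let m := mass mu0 `[a, a].
Let c u := dot nu (V u - V (l a)).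

Let dir u : l a <= u < l b -> X u != p u -> enorm (normal D (p u) - nu) <= w.
Proof.
move=> hu xp; apply: hdir; first exact: (boundary_proj C2D bndD cvxD xp).
rewrite (le_trans (ler_enorm_dist (p (l a)) _ _))//.
by rewrite [leRHS]splitr lerD// (le_trans (link_proj_oscillation hu)).
Qed.

Let c_bound u : l a <= u <= l b -> 0 <= c u <= M.
Proof.
move=> hu; rewrite (directed_ge0 C2D bndD cvxD n0' link_vprim dir w1 hu)/=.
have /andP[lu ul] := hu.
rewrite (le_trans (cauchy_schwarz _ _))// nu1 mul1r.
have := enorm_increment_le n0' link_vprim link_rprim (lexx _) lu ul.
have := enorm_increment_le n0' link_vprim link_rprim lu ul (lexx _).
by have := enorm_ge0 (V (l b) - V u); have := hM; lra.
Qed.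

(** The three terms of [hrg]: the noise [X - v], the part of the displacement orthogonal to [nu],
    and the error of the starting point. *)
Let ray_close u : l a <= u < l b ->
  enorm (X u - (x a - (m - c u) *: nu)) <= rg.
Proof.
move=> hu; apply: le_trans hrg.
have [lu ul] := andP hu; have hu' : l a <= u <= l b by rewrite lu ltW.
have e1 := straight_displacement C2D bndD cvxD n0' link_vprim link_rprim nu1 dir hu'.
have e2 : 2 * w * (A u - A (l a)) <= 2 * w * M.
  apply: ler_wpM2l; first by rewrite mulr_ge0.
  have := enorm_increment_le n0' link_vprim link_rprim lu (ltW ul) (lexx _).
  by have := enorm_ge0 (V (l b) - V u); have := hM; lra.
have e3 := noise hu.
have mN : m *: normal D (x a) = m *: nu.
  (* [nu] is the normal at [x a] only on the boundary; elsewhere [a] is no atom and both sides are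
     0. *)
  have := mass_ge0 mu0 `[a, a]; rewrite -/m le_eqVlt => /predU1P[<-|m0].
    by rewrite !scale0r.
  by rewrite hnu//; exact: (mass_point_boundary C2D bndD cvxD sk a0 m0).
move: hX; rewrite (pre_reflection C2D bndD cvxD sk a0).
rewrite (_ : mass (stieltjes (tvar0 k)) `[a, a] *: normal D (x a) = m *: nu)// => hX'.
have -> : X u - (x a - (m - c u) *: nu) = (X u - v u) +
    (V u - V (l a) - c u *: nu) + (X (l a) - (x a - m *: nu)).
  by rewrite /v; apply/rowP => i; rewrite !mxE; ring.
rewrite (le_trans (ler_enormD _ _))// lerD// (le_trans (ler_enormD _ _))// lerD//.
exact: le_trans e2.
Qed.

Let G r := g a (x a - (m - r) *: nu).

Let ray_radius u : l a <= u <= l b -> enorm (x a - (m - c u) *: nu) <= Mg.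
Proof.
move=> /c_bound /andP[c0 cM]; apply: le_trans hxM.
rewrite (le_trans (ler_enormB _ _))// -addrA lerD2l enormZ nu1 mulr1.
have := mass_ge0 mu0 `[a, a]; rewrite -/m => m0.
by rewrite (le_trans (ler_normB _ _))// (ger0_norm m0) (ger0_norm c0) lerD2l.
Qed.

Lemma link_functional_step :
  `|pen_functional X V g (l b) - pen_functional X V g (l a) -
    (ray_primitive g a (x a) nu m (c (l b)) - ray_primitive g a (x a) nu m 0)|
  <= (kap + C * w) * (A (l b) - A (l a)).
Proof.
have hH : rprim (l a) (l b) (pen_functional X V g)
    (fun u => g u (X u) * (n%:R * enorm (X u - p u))).
  exact: rprimS la0 (lexx _) (rprim_pen_functional C2D bndD cvxD pen hg lb0).
have ha : 0 <= a <= Tg by rewrite a0.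
apply: (functional_along_direction C2D bndD cvxD n0' (ltW lab) link_vprim link_rprim
  dir (G := G) hH).
- move=> u hu q q0; apply: (ray_primitive_expansion hg a0) => //.
  by have /andP[] := c_bound hu; rewrite /c; lra.
- move=> u hu; have /andP[lu ul] := hu.
  apply: hmod => //; [|exact: hXM|by apply: ray_radius; rewrite lu ltW|exact: hua|exact: ray_close].
  by rewrite (le_trans la0)//= (le_trans (ltW ul)).
- move=> u /andP[lu ul]; apply: hC => //.
  by apply: ray_radius; rewrite lu ltW.
Qed.

End TimeChangedLink.

(** * Passage to the limit *)

Section PenalizedMass.
Context {R : realType} {d : nat} (D : set 'rV[R]_d).
Context (C2D : C2_domain D) (bndD : bounded_set D) (cvxD : convex_set D).
Context (n : nat) (n0 : (0 < n)%N) (Y X V : R -> 'rV[R]_d)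
  (pen : penalized_solution D n Y X V).
Implicit Types a b : R.

Lemma pen_increment a b : 0 <= a -> a <= b ->
  enorm (V b - V a) <= pen_mass D n X b - pen_mass D n X a.
Proof.
move=> a0 ab; have b0 := le_trans a0 ab; have n0' : 0 < n%:R :> R by rewrite ltr0n.
exact: (enorm_increment_le n0' (vprim_pen C2D bndD cvxD pen b0)
  (rprim_pen_mass C2D bndD cvxD pen b0) a0 ab (lexx b)).
Qed.

Lemma pen_mass_nondecreasing a b : 0 <= a -> a <= b ->
  pen_mass D n X a <= pen_mass D n X b.
Proof.
by move=> a0 ab; rewrite -subr_ge0 (le_trans (enorm_ge0 _) (pen_increment a0 ab)).
Qed.

Lemma pen_mass_ge0 b : 0 <= b -> 0 <= pen_mass D n X b.
Proof. by move=> b0; rewrite -(pen_mass0 D n X); exact: pen_mass_nondecreasing. Qed.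

Lemma enorm_pen_le b : 0 <= b -> enorm (V b) <= pen_mass D n X b.
Proof.
move=> b0; have := pen_increment (lexx 0) b0.
by rewrite (pen0 pen) pen_mass0 !subr0.
Qed.

Lemma pen_functional_increment g (C a b : R) :
  {within [set p : R * 'rV[R]_d | 0 <= p.1], continuous (fun p => g p.1 p.2)} ->
  0 <= a -> a <= b -> (forall t, a <= t < b -> `|g t (X t)| <= C) ->
  `|pen_functional X V g b - pen_functional X V g a|
    <= C * (pen_mass D n X b - pen_mass D n X a).
Proof.
move=> hg a0 ab hC; have b0 := le_trans a0 ab.
have hH := rprimS a0 (lexx b) (rprim_pen_functional C2D bndD cvxD pen hg b0).
have hA := rprimZ C (rprimS a0 (lexx b) (rprim_pen_mass C2D bndD cvxD pen b0)).
have dA t : 0 <= n%:R * enorm (X t - proj D (X t)) by rewrite mulr_ge0// enorm_ge0.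
rewrite mulrBr ler_norml; apply/andP; split.
  rewrite lerNl -[leLHS]mulN1r mulrBr.
  apply: (rprim_le2 ab (rprimZ (-1) hH) hA) => t /hC; rewrite ler_norml => /andP[h _].
  by rewrite mulN1r -mulNr ler_wpM2r// lerNl.
apply: (rprim_le2 ab hH hA) => t /hC; rewrite ler_norml => /andP[_ h].
by rewrite ler_wpM2r.
Qed.

End PenalizedMass.

Lemma ray_primitive_near {R : realType} {d : nat} (g : R -> 'rV[R]_d -> R)
    (a m c0 e : R) (z v : 'rV[R]_d) :
  {within [set p : R * 'rV[R]_d | 0 <= p.1], continuous (fun p => g p.1 p.2)} ->
  0 <= a -> -1 < c0 -> 0 < e -> exists2 r, 0 < r & forall c, `|c - c0| <= r ->
    `|ray_primitive g a z v m c - ray_primitive g a z v m c0| <= e.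
Proof.
move=> hg a0 c1 e0; set G := ray_primitive g a z v m.
set h := g a (z - (m - c0) *: v).
have h0 : 0 < `|h| + 1 by rewrite ltr_wpDl.
have /nbhs_ballP[r /= r0 hr] := ray_primitive_expansion hg a0 z v m c1 ltr01.
exists (Num.min (r / 2) (e / (`|h| + 1))) => [|c].
  by rewrite lt_min !divr_gt0.
rewrite le_min => /andP[cr ce].
have := hr c _; rewrite /ball/= distrC => /(_ (le_lt_trans cr _)).
move=> /(_ ltac:(lra)); rewrite -/G -/h mul1r => hc.
rewrite -(subrK (h * (c - c0)) (G c - G c0)) (le_trans (ler_normD _ _))//.
rewrite normrM; move: ce; rewrite ler_pdivlMr//; lra.
Qed.

Lemma telescope_add {R : realType} (c a1 a2 a3 m1 m2 : R) : a1 <= c * (a2 + m1) ->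
  a1 + c * (a3 - a2 + m2) <= c * (a3 + (m1 + m2)).
Proof. lra. Qed.

Lemma telescope_le {R : realType} (h1 h2 j1 j2 a1 a2 m1 m2 om e : R) :
  `|h1 - j1| <= om * (a1 + m1) + e / 2 ->
  `|h2 - h1 - j2| <= om * (a2 - a1 + m2) + e / 2 ->
  `|h2 - (j1 + j2)| <= om * (a2 + (m1 + m2)) + e.
Proof. rewrite !ler_norml; lra. Qed.

Lemma limit_functional_empty {R : realType} {d : nat} (D : set 'rV[R]_d)
    (x k : R -> 'rV[R]_d) g (a : R) : limit_functional D x k g `[a, a[ = 0.
Proof.
rewrite /limit_functional set_itvco0 Rintegral_set0 add0r /usum.
by rewrite !esum_set0 subrr.
Qed.

Lemma small_direction {R : realType} (rg M C e : R) : 0 < rg -> 0 <= M -> 0 < C ->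
  0 < e -> exists w, [/\ 0 < w, w <= 1 / 2, 2 * w * M <= rg & C * w <= e].
Proof.
move=> rg0 M0 C0 e0; have M1 : 0 < 2 * (M + 1) by lra.
exists (Num.min (1 / 2) (Num.min (rg / (2 * (M + 1))) (e / C))); set w := Num.min _ _.
have w0 : 0 < w by rewrite !lt_min !divr_gt0.
have w1 : w <= rg / (2 * (M + 1)) by rewrite !ge_min lexx !orbT.
have w2 : w <= e / C by rewrite !ge_min lexx !orbT.
split=> //; first by rewrite ge_min lexx.
  by move: w1; rewrite ler_pdivlMr//; lra.
by move: w2; rewrite ler_pdivlMr// mulrC.
Qed.

Lemma link_combine {R : realType} (dH Gc Gi G0 j dA m1 m om u eta : R) :
  0 <= dA -> 0 <= m1 -> m1 <= m -> 0 < om -> u <= om / 8 ->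
  `|dH - (Gc - G0)| <= (om / 8 + u) * dA -> `|Gc - Gi| <= eta ->
  `|Gi - G0 - j| <= (3 * (om / 8) + u) * m1 -> `|dH - j| <= om * (dA + m) + eta.
Proof.
move=> dA0 m10 m1m om0 uom h1 h2 h3.
have h4 : (om / 8 + u) * dA <= om * dA by rewrite ler_wpM2r//; lra.
have h5 : (3 * (om / 8) + u) * m1 <= om * m.
  by apply: (@le_trans _ _ (om * m1)); [rewrite ler_wpM2r//; lra|rewrite ler_pM2l].
move: h1 h2 h3; rewrite !ler_norml; lra.
Qed.

Lemma small_noise {R : realType} (K rg rd : R) : 0 < K -> 0 < rg -> 0 < rd ->
  exists th, [/\ 0 < th, th <= 1, th ^+ 2 <= rg & K * th <= rd].
Proof.
move=> K0 rg0 rd0; exists (Num.min 1 (Num.min rg (rd / K))); set th := Num.min _ _.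
have th0 : 0 < th by rewrite !lt_min ltr01 rg0 divr_gt0.
have th1 : th <= 1 by rewrite ge_min lexx.
have thg : th <= rg by rewrite !ge_min lexx !orbT.
have thK : th <= rd / K by rewrite !ge_min lexx !orbT.
split => //; last by move: thK; rewrite ler_pdivlMr// mulrC.
by apply: le_trans thg; rewrite expr2 ger_pMr.
Qed.

Lemma small_link {R : realType} (th rg rd : R) : 0 < th -> 0 < rg -> 0 < rd ->
  exists e, [/\ 0 < e, e + 2 * (th ^+ 2 / 4) <= th ^+ 2, 4 * e <= rg & e <= rd].
Proof.
move=> th0 rg0 rd0; have th2 : 0 < th ^+ 2 by rewrite exprn_gt0.
exists (Num.min (th ^+ 2 / 2) (Num.min (rg / 4) rd)); set e := Num.min _ _.
have e1 : e <= th ^+ 2 / 2 by rewrite ge_min lexx.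
have e2 : e <= rg / 4 by rewrite !ge_min lexx !orbT.
split; [by rewrite !lt_min rd0 !divr_gt0|lra|lra|by rewrite !ge_min lexx !orbT].
Qed.

(** * Convergence along the time change *)

Section Convergence.
Context {R : realType} {d : nat} (D : set 'rV[R]_d).
Context (C2D : C2_domain D) (bndD : bounded_set D) (cvxD : convex_set D).
Context (y x k : R -> 'rV[R]_d) (cy : cadlag y) (sk : skorokhod_solution D y x k).
Context (yn xn kn : nat -> R -> 'rV[R]_d)
  (pen : forall n, (1 <= n)%N -> penalized_solution D n (yn n) (xn n) (kn n)).
Context (l : nat -> R -> R) (tc : forall n, time_change (l n))
  (lid : forall e, 0 < e ->
     \forall n \near \oo, forall t, 0 <= t -> `|l n t - t| <= e)
  (ly : forall N e : R, 0 < e ->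
     \forall n \near \oo, forall t, 0 <= t <= N -> enorm (yn n (l n t) - y t) <= e).
Notation TR := (measurableTypeR R).
Let A n t := pen_mass D n (xn n) t.
Let mu0 := stieltjes (tvar0 k).
Implicit Types (T e : R).

Let D_neq0 : D !=set0. Proof. by case: C2D. Qed.
Let openD : open D. Proof. by case: C2D. Qed.
Let cx : cadlag x. Proof. exact: sk_cadlag_x sk. Qed.

Let near_pos : \forall n \near \oo, (0 < n)%N.
Proof. exact: nbhs_infty_gt. Qed.

(** Induction over the links: a bound at the start of a link bounds the starting point, and
    [link_mass_bound] then bounds the variation added. The bound depends on the number of links,
    which does not depend on [n]. *)
Lemma mass_bound T : 0 <= T ->
  exists2 M, 0 <= M & \forall n \near \oo, A n (l n T) <= M.
Proof.
move=> T0; have [q Dq] := D_neq0; have [r r0 hr] := inner_ball openD Dq.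
(* Oscillation and J1 error [r / 8] make a noise of [3 * r / 8], below the admissible [r / 2]. *)
have r8 : 0 < r / 8 by lra.
elim: (link_chain cy cx r8 (lexx 0) T0) => [|b c cb [M M0 hM] bc [_ sy _]].
  exists 0 => //; near=> n.
  by have [-> _ _ _] := tc n; rewrite /A pen_mass0.
have b0 : 0 <= b := chain_le cb.
pose Q := enorm (y b) + r / 8 + M + enorm q.
exists (M + Q ^+ 2 / r); first by rewrite addr_ge0// divr_ge0 ?sqr_ge0// ltW.
near=> n; have n0 : (0 < n)%N by near: n; exact: near_pos.
have hn : A n (l n b) <= M by near: n; exact: hM.
have hd t : 0 <= t <= c -> enorm (yn n (l n t) - y t) <= r / 8.
  by move: t; near: n; exact: ly.
have lb0 : 0 <= l n b by exact: time_change_ge0.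
have hX : enorm (xn n (l n b) - q) <= Q.
  rewrite (le_trans (ler_enormB _ _))// lerD2r (pen_eq (pen n0) lb0).
  rewrite (le_trans (ler_enormD _ _))// lerD//; last first.
    exact: le_trans (enorm_pen_le C2D bndD cvxD n0 (pen n0) lb0) hn.
  rewrite -(subrK (y b) (yn n _)) (le_trans (ler_enormD _ _))// addrC lerD2l.
  by apply: hd; rewrite b0 ltW.
have hd' t : b <= t < c -> enorm (yn n (l n t) - y t) <= r / 8.
  by move=> /andP[bt tc']; apply: hd; rewrite (le_trans b0 bt) ltW.
have er : r / 8 + 2 * (r / 8) <= r / 2 by lra.
have := link_mass_bound C2D bndD cvxD n0 (pen n0) (tc n) b0 bc sy hd' hr (ltW r0) er.
have hQ : enorm (xn n (l n b) - q) ^+ 2 <= Q ^+ 2.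
  by rewrite ler_pXn2r// nnegrE ?enorm_ge0// (le_trans (enorm_ge0 _) hX).
move=> /le_trans /(_ hQ); rewrite mulrC -ler_pdivlMr// -/(A n _) -/(A n _); lra.
Unshelve. all: by end_near. Qed.

Lemma path_bound T : 0 <= T -> exists M B, [/\ 0 <= M, 0 <= B &
  \forall n \near \oo, A n (l n T) <= M /\
    forall u, 0 <= u <= l n T -> enorm (xn n u) <= B].
Proof.
move=> T0; have [M M0 hM] := mass_bound T0.
have [By By0 hBy] := cadlag_bounded cy T0.
exists M, (By + 1 + M); split => //; first by rewrite !addr_ge0// ltW.
near=> n; have n0 : (0 < n)%N by near: n; exact: near_pos.
have hn : A n (l n T) <= M by near: n; exact: hM.
have hd t : 0 <= t <= T -> enorm (yn n (l n t) - y t) <= 1.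
  by move: t; near: n; exact: ly.
split => // u /andP[u0 uT].
have [t ht tu] : exists2 t, 0 <= t <= T & l n t = u.
  move: uT; rewrite le_eqVlt => /predU1P[->|uT].
    by exists T => //; rewrite T0 lexx.
  have [|t /andP[t0 tT] tu] := @time_change_surj _ _ (tc n) 0 T u (lexx 0) T0.
    by have [-> _ _ _] := tc n; rewrite u0.
  by exists t => //; rewrite t0 ltW.
rewrite (pen_eq (pen n0) u0) (le_trans (ler_enormD _ _))// lerD//.
  rewrite -tu -(subrK (y t) (yn n _)) (le_trans (ler_enormD _ _))// addrC lerD//.
    exact: hBy.
  exact: hd.
rewrite (le_trans (enorm_pen_le C2D bndD cvxD n0 (pen n0) u0))//.
exact: le_trans (pen_mass_nondecreasing C2D bndD cvxD n0 (pen n0) u0 uT) hn.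
Unshelve. all: by end_near. Qed.

Lemma late_near (th a b : R) : 0 < th -> 0 <= a -> a < b ->
  \forall n \near \oo, l n a + (n%:R * th)^-1 < l n b.
Proof.
move=> th0 a0 ab; have b0 : 0 <= b := ltW (le_lt_trans a0 ab).
have e0 : 0 < (b - a) / 4 by lra.
near=> n; have h : forall t, 0 <= t -> `|l n t - t| <= (b - a) / 4.
  by near: n; exact: lid.
have hn : (th * ((b - a) / 4))^-1 < n%:R by near: n; exact: nbhs_infty_gtr.
have n0 : 0 < n%:R :> R by apply: le_lt_trans hn; rewrite invr_ge0 mulr_ge0// ltW.
have : (n%:R * th)^-1 < (b - a) / 4.
  move: hn; rewrite -[ltLHS]mul1r ltr_pdivrMr ?(mulr_gt0 th0 e0)// => hn.
  by rewrite -[ltLHS]mul1r ltr_pdivrMr ?mulr_gt0//; lra.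
by have := h _ a0; have := h _ b0; rewrite !ler_norml => /andP[? ?] /andP[? ?]; lra.
Unshelve. all: by end_near. Qed.

(** The squared difference is 0 at time 0 and is propagated along the chain. The finitely many links
    are eventually all longer than the relaxation time ([late_near]). *)
Lemma reflection_cvg T e : 0 <= T -> 0 < e ->
  \forall n \near \oo, enorm (kn n (l n T) - kleft D x k T) <= e.
Proof.
move=> T0 e0; have [M [B [M0 B0 hMB]]] := path_bound T0.
have [Bd Bd0 hBd] := bounded_closureD bndD.
(* The factor [4 * K + 4] of [link_reflection_step], with the displacement from [closure D] bounded
   by [B + Bd]. *)
pose C := 4 * (2 + (B + Bd) + 2 * M) + 4.
have C0 : 0 < C by rewrite /C; lra.
pose m := mass mu0 `[0, T[; have m0 : 0 <= m by exact: mass_ge0.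
(* Summed over the links, the steps give [C * th * (M + m)]; this bounds a squared distance, hence
   the comparison with [e ^+ 2]. *)
pose th := Num.min 1 (e ^+ 2 / (C * (M + m + 1))).
have Cm0 : 0 < C * (M + m + 1) by rewrite mulr_gt0//; lra.
have th0 : 0 < th by rewrite lt_min ltr01/= divr_gt0// exprn_gt0.
have th1 : th <= 1 by rewrite ge_min lexx.
have thC : C * th * (M + m) <= e ^+ 2.
  have : th <= e ^+ 2 / (C * (M + m + 1)) by rewrite ge_min lexx orbT.
  rewrite ler_pdivlMr//; have := mulr_gt0 C0 th0; lra.
have th2 : 0 < th ^+ 2 by rewrite exprn_gt0.
have th2' : th ^+ 2 <= th by rewrite expr2 ger_pMr.
have e1 : th ^+ 2 / 2 + 2 * (th ^+ 2 / 4) <= th ^+ 2 by lra.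
have e2 : th ^+ 2 / 2 <= th by lra.
have e3 : th ^+ 2 / 4 <= th by lra.
have el0 : 0 < th ^+ 2 / 2 by lra.
have dl0 : 0 < th ^+ 2 / 4 by lra.
have fin b : 0 <= b -> (mu0 (`[0%R, b[%classic : set TR) < +oo)%E.
  move=> b0; apply: (mu0_fin sk (T := b)); first exact: measurable_itv.
  by move=> s /=; rewrite !in_itv/= => /andP[-> /ltW].
have main b : chain (link (th ^+ 2 / 2) y x) 0 b -> b <= T ->
  \forall n \near \oo, dot (kn n (l n b) - kleft D x k b) (kn n (l n b) - kleft D x k b)
    <= C * th * (A n (l n b) + mass mu0 `[0, b[).
  elim=> [_|{}b c cb IH bc [_ sy sx] cT].
    near=> n; have n0 : (0 < n)%N by near: n; exact: near_pos.
    have [-> _ _ _] := tc n; rewrite (pen0 (pen n0)) (kleft0 D x k) subrr dot0l.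
    by rewrite mulr_ge0 ?(ltW (mulr_gt0 C0 th0))// /A pen_mass0 add0r mass_ge0.
  have b0 : 0 <= b := chain_le cb; have bT : b <= T := le_trans (ltW bc) cT.
  have c0 : 0 <= c := le_trans b0 (ltW bc).
  near=> n; have n0 : (0 < n)%N by near: n; exact: near_pos.
  have hb : dot (kn n (l n b) - kleft D x k b) (kn n (l n b) - kleft D x k b)
    <= C * th * (A n (l n b) + mass mu0 `[0, b[) by near: n; exact: IH bT.
  have [hM hB] : A n (l n T) <= M /\ forall u, 0 <= u <= l n T -> enorm (xn n u) <= B.
    by near: n; exact: hMB.
  have hd t : 0 <= t <= T -> enorm (yn n (l n t) - y t) <= th ^+ 2 / 4.
    by move: t; near: n; exact: ly.
  have late : l n b + (n%:R * th ^+ 2)^-1 < l n c.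
    by near: n; exact: late_near.
  have hd' t : b <= t < c -> enorm (yn n (l n t) - y t) <= th ^+ 2 / 4.
    by move=> /andP[bt tc']; apply: hd; rewrite (le_trans b0 bt)/= (le_trans (ltW tc')).
  have lb0 : 0 <= l n b by exact: time_change_ge0.
  have lc0 : 0 <= l n c by exact: time_change_ge0.
  have hrho : enorm (xn n (l n b) - proj D (xn n (l n b))) <= B + Bd.
    rewrite (le_trans (ler_enormB _ _))// lerD//.
      by apply: hB; rewrite lb0 time_change_le.
    by apply: hBd; exact: proj_in.
  have hdA : pen_mass D n (xn n) (l n c) - pen_mass D n (xn n) (l n b) <= M.
    have h1 := pen_mass_ge0 C2D bndD cvxD n0 (pen n0) lb0.
    have lcT : l n c <= l n T by exact: time_change_le.
    have h2 := pen_mass_nondecreasing C2D bndD cvxD n0 (pen n0) lc0 lcT.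
    by rewrite lerBlDr (le_trans h2)// (le_trans hM)// lerDl.
  have := link_reflection_step C2D bndD cvxD n0 (pen n0) (tc n) b0 bc sy hd' sk sx
    th0 th1 e1 hrho hdA late e2 e3.
  rewrite -/C -/mu0 /=; move=> /le_trans; apply.
  have := @mass_itv_split _ mu0 (BLeft 0) (BLeft b) (BLeft c).
  rewrite !bnd_simp => /(_ b0 (ltW bc) (fin _ c0)) ->.
  exact: telescope_add hb.
have := main T (link_chain cy cx el0 (lexx 0) T0) (lexx T).
apply: filterS2 hMB => n [hM _] h; rewrite enorm_leP; last exact: ltW.
rewrite (le_trans h)// (le_trans _ thC)// ler_pM2l ?mulr_gt0//.
by rewrite lerD2r.
Unshelve. all: by end_near. Qed.

Context (d0 : (0 < d)%N) (g : R -> 'rV[R]_d -> R).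
Context (hg : {within [set p : R * 'rV[R]_d | 0 <= p.1],
  continuous (fun p => g p.1 p.2)}).
Let H n t := pen_functional (xn n) (kn n) g t.
Let J := limit_functional D x k g.

Let mu0_co T : (mu0 (`[0%R, T]%classic : set TR) < +oo)%E.
Proof. by apply: (mu0_fin sk (T := T)); [exact: measurable_itv|]. Qed.

Let start_cvg a e : 0 <= a -> 0 < e ->
  \forall n \near \oo, enorm (xn n (l n a) - (y a + kleft D x k a)) <= e.
Proof.
move=> a0 e0; have e2 : 0 < e / 2 by lra.
near=> n; have n0 : (0 < n)%N by near: n; exact: near_pos.
have h1 : enorm (kn n (l n a) - kleft D x k a) <= e / 2.
  by near: n; exact: reflection_cvg.
have hd t : 0 <= t <= a -> enorm (yn n (l n t) - y t) <= e / 2.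
  by move: t; near: n; exact: ly.
have h2 : enorm (yn n (l n a) - y a) <= e / 2 by apply: hd; rewrite a0 lexx.
rewrite (pen_eq (pen n0)) ?time_change_ge0//.
rewrite opprD addrACA (le_trans (ler_enormD _ _))//; lra.
Unshelve. all: by end_near. Qed.

(** The thresholds [rg], [w], [rd], [th] and [e0] are derived from [om] in this order and do not
    depend on the link; only the rank from which the estimate holds depends on the link and on
    [eta]. *)
Lemma functional_link_near T M B om : 0 <= T -> 0 <= M -> 0 <= B ->
  (\forall n \near \oo, A n (l n T) <= M /\
    forall u, 0 <= u <= l n T -> enorm (xn n u) <= B) ->
  0 < om -> exists2 e0, 0 < e0 & forall a b, 0 <= a -> a < b -> b <= T ->
    link e0 y x a b -> forall eta, 0 < eta -> \forall n \near \oo,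
      `|H n (l n b) - H n (l n a) - J `[a, b[ |
        <= om * (A n (l n b) - A n (l n a) + mass mu0 `[a, b[) + eta.
Proof.
move=> T0 M0 B0 hMB om0.
have [Bd Bd0 hBd] := bounded_closureD bndD.
have [Bx Bx0 hBx] := cadlag_bounded cx T0.
pose mT := mass mu0 `[0, T]; have mT0 : 0 <= mT by exact: mass_ge0.
have [om8 rMg] : 0 < om / 8 /\ B <= B + Bx + mT + M + 1 by lra.
(* A radius that covers [xn], [x] with a margin [rg], and the rays from [x a], whose length is at
   most [mT + M]. *)
set Mg := _ + 1 in rMg.
(* The horizon is [T + 1] because [l n b] may exceed [T]. *)
have [C C0 hC] := integrand_bounded hg (T + 1) Mg.
have [rg [rg0 rg1 hmod]] : exists rg, [/\ 0 < rg, rg <= 1 &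
    forall s s' z z', 0 <= s <= T + 1 -> 0 <= s' <= T + 1 ->
     enorm z <= Mg -> enorm z' <= Mg -> `|s - s'| <= rg -> enorm (z - z') <= rg ->
     `|g s z - g s' z'| <= om / 8].
  have [r r0 h] := integrand_modulus hg (T + 1) Mg om8.
  exists (Num.min r 1); rewrite lt_min r0 ltr01 ge_min lexx orbT; split => //.
  move=> s s' z z' h1 h2 h3 h4; rewrite !le_min => /andP[h5 _] /andP[h6 _].
  exact: h.
have [hxMg hxm] : Bx + rg <= Mg /\ Bx + mT + M <= Mg by rewrite /Mg; lra.
have rg4 : 0 < rg / 4 by rewrite divr_gt0.
have [w [w0 w2 wM wC]] := small_direction rg4 M0 C0 om8.
have [K0 w1] : 0 < 2 + (B + Bd) + 2 * M /\ w <= 1 by lra.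
have [rd rd0 hdir] := direction_modulus C2D bndD cvxD d0 w0.
have rd2 : 0 < rd / 2 by rewrite divr_gt0.
have [th [th0 th1 thg thK]] := small_noise K0 rg4 rd2.
have [e0 [e00 eth erg erd]] := small_link th0 rg0 rd0.
exists e0 => // a b a0 ab bT lk eta eta0.
have [ba sy sx] := lk; have b0 : 0 <= b := le_trans a0 (ltW ab).
have aT : a <= T := le_trans (ltW ab) bT.
have T1 t : t <= T -> t <= T + 1 by move=> h; rewrite (le_trans h)// lerDl.
have [nu [nu1 hnu hdn]] := hdir (x a).
have xB s : a <= s < b -> enorm (x s) <= Bx.
  by move=> /andP[as_ sb]; apply: hBx; rewrite (le_trans a0 as_)/= (le_trans (ltW sb)).
have xM s : a <= s < b -> enorm (x s) + rg <= Mg.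
  by move=> /xB h; apply: le_trans hxMg; rewrite lerD2r.
have hl := limit_functional_steady C2D bndD cvxD sk a0 ab lk nu1 w2 hnu hdn
  erd hg hC hmod (T1 _ bT) xM (ltW om8) (ltW e00) erg.
have cinf0 : -1 < dot nu (kleft D x k b - kleft D x k a).
  apply: (@lt_le_trans _ _ 0); first by rewrite ltrN10.
  exact: (kleft_direction_ge0 C2D bndD cvxD sk a0 ab lk nu1 w2 hdn erd).
have [rc rc0 hrc] := ray_primitive_near (mass mu0 `[a, a]) (x a) nu hg a0 cinf0 eta0.
have rc2 : 0 < rc / 2 by rewrite divr_gt0.
have dl0 : 0 < th ^+ 2 / 4 by rewrite divr_gt0// exprn_gt0.
pose h := Num.min (rd / 2) (rg / 4).
have h0 : 0 < h by rewrite lt_min rd2 rg4.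
have hrg : th ^+ 2 + 2 * w * M + h <= rg.
  have : h <= rg / 4 by rewrite ge_min lexx orbT.
  lra.
have hxm' : enorm (x a) + mass mu0 `[a, a] + M <= Mg.
  apply: le_trans hxm; rewrite lerD2r lerD ?xB ?lexx//.
  apply: mass_le; [exact: measurable_itv|exact: measurable_itv| |exact: mu0_co].
  move=> u /=; rewrite !in_itv/= => /andP[au ua].
  by rewrite (le_trans a0 au)/= (le_trans ua).
have m1co : mass mu0 `]a, b[ <= mass mu0 `[a, b[.
  apply: mass_le; [exact: measurable_itv|exact: measurable_itv| |].
    by move=> s /=; rewrite !in_itv/= => /andP[/ltW -> ->].
  apply: (mu0_fin sk (T := b)); first exact: measurable_itv.
  by move=> s /=; rewrite !in_itv/= => /andP[/(le_trans a0) -> /ltW].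
have dt0 : 0 < Num.min 1 (rg / 2) by rewrite lt_min ltr01 divr_gt0.
have near_a := reflection_cvg a0 rc2.
have near_b := reflection_cvg b0 rc2.
have near_x := start_cvg a0 h0.
have near_l := lid dt0.
have near_y := ly T dl0.
near=> n; have n0 : (0 < n)%N by near: n; exact: near_pos.
have [hM hB] : A n (l n T) <= M /\ forall u, 0 <= u <= l n T -> enorm (xn n u) <= B.
  by near: n; exact: hMB.
have hdt t : 0 <= t <= T -> enorm (yn n (l n t) - y t) <= th ^+ 2 / 4.
  by move: t; near: n; exact: near_y.
have hlt t : 0 <= t -> `|l n t - t| <= Num.min 1 (rg / 2).
  by move: t; near: n; exact: near_l.
have hX : enorm (xn n (l n a) - (y a + kleft D x k a)) <= h.
  by near: n; exact: near_x.
have [hva hvb] : enorm (kn n (l n a) - kleft D x k a) <= rc / 2 /\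
    enorm (kn n (l n b) - kleft D x k b) <= rc / 2.
  by near: n; exact: filterI near_a near_b.
have la0 : 0 <= l n a by exact: time_change_ge0.
have lb0 : 0 <= l n b by exact: time_change_ge0.
have lbT : l n b <= l n T by exact: time_change_le.
have lab : l n a < l n b by exact: time_change_lt.
have hdt' t : a <= t < b -> enorm (yn n (l n t) - y t) <= th ^+ 2 / 4.
  by move=> /andP[at_ tb]; apply: hdt; rewrite (le_trans a0 at_)/= (le_trans (ltW tb)).
have hrho : enorm (xn n (l n a) - proj D (xn n (l n a))) <= B + Bd.
  rewrite (le_trans (ler_enormB _ _))// lerD//.
    by apply: hB; rewrite la0 (le_trans (ltW lab)).
  by apply: hBd; exact: proj_in.
have hA0 := pen_mass_ge0 C2D bndD cvxD n0 (pen n0) la0.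
have hdA0 := pen_mass_nondecreasing C2D bndD cvxD n0 (pen n0) la0 (ltW lab).
have hdA : pen_mass D n (xn n) (l n b) - pen_mass D n (xn n) (l n a) <= M.
  rewrite lerBlDr (le_trans (pen_mass_nondecreasing C2D bndD cvxD n0 (pen n0) lb0 lbT))//.
  by rewrite (le_trans hM)// lerDl.
have hp : enorm (proj D (xn n (l n a)) - x a) <= rd / 2.
  rewrite -(proj_pre_reflection C2D bndD cvxD sk a0).
  rewrite (le_trans (proj_lip D_neq0 bndD cvxD _ _))// (le_trans hX)//.
  by rewrite ge_min lexx.
have bTg : l n b <= T + 1.
  have := hlt _ b0; rewrite le_min => /andP[+ _]; rewrite ler_norml => /andP[_].
  by rewrite lerBlDl => /le_trans; apply; rewrite lerD2r.
have hua u : l n a <= u < l n b -> `|u - a| <= rg.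
  move=> hu; have [t /andP[at_ tb] <-] := time_change_surj (tc n) a0 b0 hu.
  rewrite -(subrK t (l n t)) -addrA (le_trans (ler_normD _ _))// [leRHS]splitr.
  have := hlt _ (le_trans a0 at_); rewrite le_min => /andP[_ ?]; rewrite lerD//.
  rewrite ger0_norm ?subr_ge0// (le_trans (lerB (ltW tb) (lexx a)))// (le_trans ba)//.
  by rewrite ler_pdivlMr// (le_trans _ erg)// [leRHS]mulrC ler_wpM2l ?(ltW e00)// ler_nat.
have hXM u : l n a <= u < l n b -> enorm (xn n u) <= Mg.
  move=> /andP[au ub]; apply: le_trans rMg.
  by apply: hB; rewrite (le_trans la0 au) (le_trans (ltW ub)).
have hs := link_functional_step C2D bndD cvxD n0 (pen n0) (tc n) a0 ab sy hdt' sk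
  th0 th1 eth hrho hdA hg hC hmod nu1 (ltW w0) w1 hnu hdn hp thK hX hrg (T1 _ aT) bTg
  hua hXM hxm'.
have hc : `|dot nu (kn n (l n b) - kn n (l n a)) -
    dot nu (kleft D x k b - kleft D x k a)| <= rc.
  have -> : dot nu (kn n (l n b) - kn n (l n a)) - dot nu (kleft D x k b - kleft D x k a)
    = dot nu ((kn n (l n b) - kleft D x k b) - (kn n (l n a) - kleft D x k a)).
    by rewrite !dotE; ring.
  rewrite (le_trans (cauchy_schwarz_norm _ _))// nu1 mul1r (le_trans (ler_enormB _ _))//.
  by rewrite [leRHS]splitr; exact: lerD hvb hva.
apply: (link_combine _ (mass_ge0 _ _) m1co om0 wC hs (hrc _ hc) hl).
by rewrite subr_ge0.
Unshelve. all: by end_near. Qed.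

Lemma functional_cvg T e : 0 <= T -> 0 < e ->
  \forall n \near \oo, `|H n (l n T) - J `[0, T[ | <= e.
Proof.
move=> T0 e0; have [M [B [M0 B0 hMB]]] := path_bound T0.
pose m := mass mu0 `[0, T[; have m0 : 0 <= m by exact: mass_ge0.
have Mm : 0 < 2 * (M + m + 1) by move: M0 m0; clearbody m; lra.
(* The error proportional to the masses then takes at most [e / 2], which leaves [e / 2] for the
   slack [eta]. *)
pose om := e / (2 * (M + m + 1)); have om0 : 0 < om by rewrite divr_gt0.
have hom : om * (M + m) + e / 2 <= e.
  have E : om * (2 * (M + m + 1)) = e by rewrite divfK// gt_eqF.
  by move: om0 E; clearbody om m; lra.
have [el el0 hlink] := functional_link_near T0 M0 B0 hMB om0.
have fin b : (mu0 (`[0%R, b[%classic : set TR) < +oo)%E.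
  apply: (mu0_fin sk (T := b)); first exact: measurable_itv.
  by move=> s /=; rewrite !in_itv/= => /andP[-> /ltW].
have main b : chain (link el y x) 0 b -> b <= T -> forall eta, 0 < eta ->
  \forall n \near \oo, `|H n (l n b) - J `[0, b[ |
    <= om * (A n (l n b) + mass mu0 `[0, b[) + eta.
  elim=> [_ eta eta0|{}b c cb IH bc lk cT eta eta0].
    near=> n; have [-> _ _ _] := tc n.
    rewrite /H pen_functional0 /J limit_functional_empty subrr normr0.
    by rewrite addr_ge0 ?(ltW eta0)// mulr_ge0 ?(ltW om0)// /A pen_mass0 add0r mass_ge0.
  have b0 : 0 <= b := chain_le cb; have c0 : 0 <= c := le_trans b0 (ltW bc).
  (* The slack is arbitrary in the induction: half of it goes to the links before [b], half to the
     new link. *)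
  have e2 : 0 < eta / 2 by rewrite divr_gt0.
  have h1 := IH (le_trans (ltW bc) cT) _ e2.
  have h2 := hlink _ _ b0 bc cT lk _ e2.
  apply: filterS2 h1 h2 => n h1 h2.
  have := @mass_itv_split _ mu0 (BLeft 0) (BLeft b) (BLeft c).
  rewrite !bnd_simp => /(_ b0 (ltW bc) (fin _)) ->.
  have -> : J `[0, c[ = J `[0, b[ + J `[b, c[.
    apply: (limit_functional_split C2D bndD cvxD sk hg (T := c) c0); rewrite ?bnd_simp//.
      exact: ltW.
    by move=> s /=; rewrite !in_itv/= => /andP[-> /ltW].
  exact: telescope_le h1 h2.
have e2 : 0 < e / 2 by rewrite divr_gt0.
have := main T (link_chain cy cx el0 (lexx 0) T0) (lexx T) _ e2.
apply: filterS2 hMB => n [hM _] /le_trans; apply; apply: le_trans hom.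
by rewrite lerD2r ler_pM2l// lerD2r.
Unshelve. all: by end_near. Qed.

Let kleft_close b z e : 0 < b -> (\forall t \near b^'-, enorm (k t - z) <= e) ->
  enorm (kleft D x k b - z) <= e.
Proof.
move=> b0 h; apply/ler_addgt0Pr => q q0.
have /enorm_cvg /(_ q q0) h1 := kleft_cvg C2D bndD cvxD sk b0.
have : \forall t \near b^'-, enorm (kleft D x k b - z) <= e + q.
  apply: filterS2 h h1 => t ht hq.
  rewrite (le_trans (ler_enorm_dist (k t) _ _))// addrC lerD//.
  by rewrite enormB.
by move=> /nbhs_leftP[r r0 hr]; apply: (hr (b - r / 2)); lra.
Qed.

(* The jump of [k] at a continuity point of [y] vanishes, so [kn] hardly moves
   near such a point, and [link_mass_displacement] bounds the mass by that move. *)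
Lemma mass_near T e : 0 < T -> jump y T = 0 -> 0 < e ->
  exists T1 T2, [/\ 0 <= T1, T1 < T, T < T2, T2 <= T + 1 &
    \forall n \near \oo, A n (l n T2) - A n (l n T1) <= e].
Proof.
move=> T0 yT e0; have [q Dq] := D_neq0; have [r r0 hr] := inner_ball openD Dq.
have T10 : 0 <= T + 1 by rewrite addr_ge0// ltW.
have [M [B [M0 B0 hMB]]] := path_bound T10.
have Q0 : 0 < 2 * (B + enorm q) + 1 by have := enorm_ge0 q; lra.
(* A displacement of at most [s] makes the right-hand side of [link_mass_displacement] at most
   [r * e]. *)
pose s := r * e / (2 * (B + enorm q) + 1).
have s0 : 0 < s by rewrite divr_gt0// mulr_gt0.
have s8 : 0 < s / 8 by rewrite divr_gt0.
have r16 : 0 < r / 16 by rewrite divr_gt0.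
have er : r / 8 + 2 * (r / 16) <= r / 2 by lra.
have kT : k T = kleft D x k T.
  have := reflection_jump C2D bndD cvxD sk (ltW T0).
  by rewrite (mass_point_continuity C2D bndD cvxD sk T0 yT) scale0r => /subr0_eq.
have [p1 p10 h1] := cadlag_left cy r16 T0.
have {}h1 u : T - p1 < u < T -> enorm (y u - y T) <= r / 16.
  by move=> /h1; move: yT; rewrite /jump T0 => /subr0_eq <-.
have [p2 p20 h2] := cadlag_right cy r16 (ltW T0).
have /enorm_cvg /(_ _ s8) /nbhs_leftP[p3 p30 h3] := kleft_cvg C2D bndD cvxD sk T0.
have [p4 p40 h4] := cadlag_right (sk_cadlag_k sk) s8 (ltW T0).
pose d1 := Num.min T (Num.min p1 p3) / 2; pose d2 := Num.min 1 (Num.min p2 p4) / 2.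
have d10 : 0 < d1 by rewrite divr_gt0// !lt_min T0 p10.
have d20 : 0 < d2 by rewrite divr_gt0// !lt_min ltr01 p20.
have [d1T d1p1 d1p3] : [/\ d1 < T, d1 < p1 & d1 < p3].
  have h : d1 < Num.min T (Num.min p1 p3).
    by rewrite /d1 ltr_pdivrMr// ltr_pMr ?ltr1n// !lt_min T0 p10.
  by move: h; rewrite !lt_min => /andP[-> /andP[]].
have [d21 d2p2 d2p4] : [/\ d2 < 1, d2 < p2 & d2 < p4].
  have h : d2 < Num.min 1 (Num.min p2 p4).
    by rewrite /d2 ltr_pdivrMr// ltr_pMr ?ltr1n// !lt_min ltr01 p20.
  by move: h; rewrite !lt_min => /andP[-> /andP[]].
clearbody d1 d2.
exists (T - d1), (T + d2).
have T1pos : 0 < T - d1 by rewrite subr_gt0.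
have T12 : T - d1 < T + d2 by lra.
split; [exact: ltW|by rewrite gtrBl|by rewrite ltrDl|by rewrite lerD2l ltW|].
have sy : steady (r / 8) y (T - d1) (T + d2).
  have hy u : T - d1 <= u < T + d2 -> enorm (y u - y T) <= r / 16.
    move=> /andP[u1 u2]; have [uT|Tu] := ltP u T.
      by apply: h1; rewrite uT andbT (lt_le_trans _ u1)// ltrD2l ltrN2.
    by apply: h2; rewrite Tu (lt_trans u2)// ltrD2l.
  move=> u hu; rewrite (le_trans (ler_enorm_dist (y T) _ _))// (enormB _ (y (T - d1))).
  have := hy _ hu; have := hy (T - d1); rewrite lexx T12 => /(_ isT); lra.
have k1 : enorm (kleft D x k (T - d1) - kleft D x k T) <= s / 8.
  apply: kleft_close => //; apply/nbhs_leftP; exists (p3 - d1); first by rewrite subr_gt0.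
  by move=> u /andP[u1 u2]; apply: h3; lra.
have k2 : enorm (kleft D x k (T + d2) - kleft D x k T) <= s / 8.
  apply: kleft_close; first by rewrite addr_gt0.
  apply/nbhs_leftP; exists d2 => // u; rewrite addrK => /andP[u1 u2].
  by rewrite -kT; apply: h4; rewrite (ltW u1) (lt_trans u2)// ltrD2l.
have s4 : 0 < s / 4 by rewrite divr_gt0.
have T1n := ltW T1pos; have T2n : 0 <= T + d2 by rewrite (le_trans T1n) ?ltW.
have near1 := reflection_cvg T1n s4; have near2 := reflection_cvg T2n s4.
have near_y := ly (T + d2) r16.
apply: (filterS2 _ _ (filterI near_pos (filterI near1 near2)) (filterI hMB near_y)).
move=> n [n0 [v1 v2]] [[_ hB] hd].
have hd' t : T - d1 <= t < T + d2 -> enorm (yn n (l n t) - y t) <= r / 16.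
  by move=> /andP[t1 t2]; apply: hd; rewrite (le_trans T1n t1) ltW.
have h := link_mass_displacement C2D bndD cvxD n0 (pen n0) (tc n) T1n T12 sy hd' hr
  (ltW r0) er.
have hV : enorm (kn n (l n (T + d2)) - kn n (l n (T - d1))) <= s.
  move: v1 v2 k1 k2; move: (kleft D x k (T - d1)) (kleft D x k (T + d2)) (kleft D x k T).
  move: (kn n (l n (T + d2))) (kn n (l n (T - d1))) => c2 c1 z1 z2 z v1 v2 k1 k2.
  rewrite (le_trans (ler_enorm_dist z2 _ _))//.
  have := ler_enorm_dist z z2 c1; have := ler_enorm_dist z1 z c1.
  by rewrite (enormB z1 c1) (enormB z z1); lra.
have hX : enorm (xn n (l n (T - d1)) - q) <= B + enorm q.
  rewrite (le_trans (ler_enormB _ _))// lerD2r; apply: hB.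
  by rewrite time_change_ge0// time_change_le// lerD2l (le_trans _ ler01)// oppr_le0 ltW.
have hp : enorm (xn n (l n (T - d1)) - q) * enorm (kn n (l n (T + d2)) - kn n (l n (T - d1)))
    <= (B + enorm q) * s by exact: ler_pM.
have Es : s * (2 * (B + enorm q) + 1) = r * e by rewrite /s divfK// gt_eqF.
rewrite -(ler_pM2l r0) (le_trans h)// -Es.
apply: (@le_trans _ _ (2 * ((B + enorm q) * s))); first by rewrite ler_pM2l.
by rewrite mulrA mulrC ler_pM2l// lerDl.
Qed.

(** For large [n] both [T] and [l n T] lie between [l n T1] and [l n T2], where the variation of
    [kn] is small by [mass_near] and the integrand is bounded. The horizon [T + 2] is [T2 <= T + 1]
    plus a time shift of at most 1. *)
Lemma functional_near T e : 0 < T -> jump y T = 0 -> 0 < e ->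
  \forall n \near \oo, `|H n T - H n (l n T)| <= e.
Proof.
move=> T0 yT e0; have T10 : 0 <= T + 1 by rewrite addr_ge0// ltW.
have [M [B [M0 B0 hMB]]] := path_bound T10.
have [C C0 hC] := integrand_bounded hg (T + 2) B.
have [T1 [T2 [T1n T1T TT2 T21 hA]]] := mass_near T0 yT (divr_gt0 e0 C0).
have dl0 : 0 < Num.min 1 (Num.min (T - T1) (T2 - T)).
  by rewrite !lt_min ltr01 !subr_gt0 T1T.
have near_l := lid dl0.
apply: (filterS2 _ _ (filterI near_pos hA) (filterI hMB near_l)).
move=> n [n0 {}hA] [[_ hB] hl].
have T2n : 0 <= T2 := le_trans (ltW T0) (ltW TT2).
have l1 : l n T1 <= T.
  have := hl _ T1n; rewrite !le_min => /and3P[_ + _].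
  by rewrite ler_norml => /andP[_]; rewrite lerD2r.
have l2 : T <= l n T2.
  have := hl _ T2n; rewrite !le_min => /and3P[_ _].
  by rewrite ler_norml opprB => /andP[+ _]; rewrite lerD2r.
have l3 : l n T2 <= T + 2.
  have := hl _ T2n; rewrite !le_min => /and3P[+ _ _].
  rewrite ler_norml => /andP[_]; lra.
have l4 : l n T2 <= l n (T + 1) by exact: time_change_le.
have l10 : 0 <= l n T1 by exact: time_change_ge0.
have l5 : l n T1 <= l n T by apply: time_change_le => //; exact: ltW.
have l6 : l n T <= l n T2 by apply: time_change_le => //; exact: ltW.
have key u v : l n T1 <= u -> u <= v -> v <= l n T2 -> `|H n v - H n u| <= e.
  move=> u1 uv v2; have u0 := le_trans l10 u1; have v0 := le_trans u0 uv.
  have hgC t : u <= t < v -> `|g t (xn n t)| <= C.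
    move=> /andP[ut tv]; have tl : t <= l n T2 by rewrite (le_trans (ltW tv)).
    by apply: hC; rewrite ?hB// (le_trans u0 ut)/= (le_trans tl).
  rewrite (le_trans (pen_functional_increment C2D bndD cvxD (pen n0) hg u0 uv hgC))//.
  rewrite mulrC -ler_pdivlMr// (le_trans _ hA)// lerB//.
    exact: (pen_mass_nondecreasing C2D bndD cvxD n0 (pen n0)).
  exact: (pen_mass_nondecreasing C2D bndD cvxD n0 (pen n0)).
have [TlT|lTT] := leP T (l n T); last exact: key l5 (ltW lTT) l2.
by rewrite distrC; apply: key.
Qed.

End Convergence.

Theorem theorem2p6 (R : realType) (d : nat) (hd : (0 < d)%N)
  (D : set 'rV[R]_d)
  (hC2 : C2_domain D) (hbounded : bounded_set D) (hconvex : convex_set D)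
  (y : R -> 'rV[R]_d) (yn : nat -> R -> 'rV[R]_d)
  (hy : cadlag y) (hyn : forall n, (1 <= n)%N -> cadlag (yn n))
  (hJ1 : J1_cvg yn y)
  (x k : R -> 'rV[R]_d) (hxk : skorokhod_solution D y x k)
  (xn kn : nat -> R -> 'rV[R]_d)
  (hxkn : forall n, (1 <= n)%N ->
     penalized_solution D n (yn n) (xn n) (kn n))
  (g : R -> 'rV[R]_d -> R)
  (hg : {within [set p : R * 'rV[R]_d | 0 <= p.1],
           continuous (fun p => g p.1 p.2)})
  (T : R) (hT : 0 < T) (hyT : jump y T = 0) :
  \int[stieltjes (tvar (kn n))]_(s in `]0, T]) g s (xn n s) @[n --> \oo]
    --> I_lim D T g x k.
Proof.
have [l [tc lid ly]] := hJ1; have T0 := ltW hT.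
(* The links cover [[0, T[] only; the endpoint contributes nothing because [T] is no atom when [y]
   is continuous there. *)
have -> : I_lim D T g x k = limit_functional D x k g `[0, T[.
  have E : limit_functional D x k g `[0, T] =
      limit_functional D x k g `[0, T[ + limit_functional D x k g `[T, T].
    by apply: (limit_functional_split hC2 hbounded hconvex hxk hg T0); rewrite ?bnd_simp.
  apply: (etrans (E : I_lim D T g x k = _)).
  have hm := mass_point_continuity hC2 hbounded hconvex hxk hT hyT.
  by rewrite (limit_functional_point hC2 hbounded hconvex hxk hg T0 hm) addr0.
apply/cvgrPdist_le => e e0; have e2 : 0 < e / 2 by rewrite divr_gt0.
have h1 := functional_cvg hC2 hbounded hconvex hy hxk hxkn tc lid ly hd hg T0 e2.
have h2 := functional_near hC2 hbounded hconvex hy hxk hxkn tc lid ly hg hT hyT e2.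
apply: filterS2 h1 h2 => n h1 h2.
rewrite distrC [leRHS]splitr; apply: le_trans (lerD h2 h1).
exact: ler_distD.
Qed.
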